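(* Let $T:\Omega\times X\to\Omega\times X$, $T(\omega,x)=(f(\omega),g(\omega,x))$, be a skew-product map satisfying assumptions (A1)--(A4) listed in the context, with $f$-invariant probability measure $\eta$ as in (A2)(b), and let $\mu=\int_\Omega\nu_\omega\,d\eta(\omega)$ be the $T$-invariant probability measure whose disintegration $\boldsymbol\nu=\{\nu_\omega\}_{\omega\in\Omega}$ is the unique fixed point of the sectional transfer operator $\mathcal K$ in $\mathbf P$. Then: 1. $\mu$ is a physical measure for $T$ if and only if $\eta$ is a physical measure for $f$; 2. $T$ has a unique physical measure if and only if $f$ has a unique physical measure.
   Context: Setting. $\Omega,X$ are compact Riemannian manifolds (possibly with boundary) with Riemannian distances $d_\Omega,d_X$; $m$ is Lebesgue (Riemannian volume) measure on $\Omega$. $\Omega\times X$ carries the product Riemannian structure. $f:\Omega\to\Omega$ and $g:\Omega\times X\to X$ are Borel measurable, and $g_\omega=g(\omega,\cdot):X\to X$. For a map $\varphi:(Y,d_Y)\to(Z,d_Z)$ of metric spaces, $\mathrm{Lip}(\varphi)=\sup_{x\ne y}\frac{d_Z(\varphi(x),\varphi(y))}{d_Y(x,y)}$, and for $q\in(0,1)$, $[\varphi]_q=\sup_{x\ne y}\frac{d_Z(\varphi(x),\varphi(y))}{d_Y(x,y)^q}$. Assumptions. (A1) There is $L>0$ such that for every $\omega\in\Omega$ the map $g_\omega$ is Lipschitz with $\frac1L\le\mathrm{Lip}(g_\omega)\le L$. (A2) (a) There are pairwise disjoint open sets $\Omega_1,\dots,\Omega_N\subset\Omega$ with $m(\Omega\setminus\bigcup_{i=1}^N\Omega_i)=0$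 such that each restriction $f|_{\Omega_i}$ has an extension to $\overline\Omega_i$ which is a $C^1$ bijection onto $\Omega$; the corresponding inverse branch $\theta_i:\Omega\to\overline\Omega_i$ satisfies $\mathrm{Lip}(\theta_i)\le1$. (b) $f$ has an invariant probability measure $\eta$ that is equivalent to $m$, with density $\rho=d\eta/dm$. Set $p_i(\omega)=\frac{\rho(\theta_i(\omega))}{|\det Df(\theta_i(\omega))|\,\rho(\omega)}$ for $\omega\in\Omega$, $i=1,\dots,N$. (A3) There is $\lambda<0$ such that for $\eta$-almost every $\omega$, $\sum_{i=1}^Np_i(\omega)\log\big(\mathrm{Lip}(g_{\theta_i(\omega)})\big)\le\lambda$. (A4) There are $q\in(0,1)$ and $L>0$ such that for all $i=1,\dots,N$: (a) $[p_i]_q\le L$; (b) for all $x\in X$, the map $g_{x,i}:\Omega\to X$, $g_{x,i}(\omega)=g(\theta_i(\omega),x)$, satisfies $\mathrm{Lip}(g_{x,i})\le L$. Operator. $\mathcal M_1(X)$ is the set of Borel probability measures on $X$ with the Wasserstein-1 distance $W_1$. $\mathbf P$ is the set of measurable maps $\boldsymbol\nu:\Omega\to\mathcal M_1(X)$, $\omega\mapsto\nu_\omega$, identified when they agree $\eta$-a.e. The sectional transfer operator $\mathcal K:\mathbf P\to\mathbf P$ is defined for $\eta$-a.e. $\omega$ by $(\mathcal K\boldsymbol\nu)_\omega=\sum_{i=1}^Np_i(\omega)\,(g_{\theta_i(\omega)})_*\nu_{\theta_i(\omega)}$. Under (A1)--(A4) it has a unique fixed point in $\mathbf P$, and this fixed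 point is the disintegration of a $T$-invariant probability measure with marginal $\eta$ on $\Omega$. Physical measures. For a map $S:M\to M$ of a manifold and an $S$-invariant probability measure $\zeta$, the basin $B(\zeta)$ is the set of $x\in M$ with $\frac1n\sum_{j=0}^{n-1}\delta_{S^j(x)}\to\zeta$ in the weak-$*$ topology; $\zeta$ is a physical measure for $S$ if $B(\zeta)$ has positive Lebesgue measure on $M$. *)

(* Defs.v *)
From HB Require Import structures.
From mathcomp Require Import all_boot all_order all_algebra.
From mathcomp Require Import all_classical all_reals all_analysis.

Set Implicit Arguments.
Unset Strict Implicit.
Unset Printing Implicit Defensive.

Import Order.TTheory GRing.Theory Num.Theory.
Import numFieldNormedType.Exports.

Local Open Scope classical_set_scope.
Local Open Scope ring_scope.

#[short(type="topMeasurableType")]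
HB.structure Definition TopMeasurable (d : measure_display) :=
  {T of Topological T & Measurable d T}.

HB.mixin Record isBorel (d : measure_display) T & TopMeasurable d T := {
  borel_measurableE : @measurable d T = <<s @open T >>
}.

#[short(type="borelMetricType")]
HB.structure Definition BorelMetric (d : measure_display) (R : numDomainType) :=
  {T of Metric R T & TopMeasurable d T & isBorel d T}.

(* Equips a product of two borelMetricTypes with the product topology and the
   product sigma-algebra. *)
HB.saturate prod.

Section lipschitz.
Context {R : realType}.

(* On a one-point space both suprema are over the empty set, i.e. -oo. *)
Definition Lip {Y Z : metricType R} (phi : Y -> Z) : \bar R :=
  ereal_sup [set r | exists x y : Y, x <> y /\
    r = (mdist (phi x) (phi y) / mdist x y)%:E].

Definition holder {Y Z : metricType R} (q : R) (phi : Y -> Z) : \bar R :=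
  ereal_sup [set r | exists x y : Y, x <> y /\
    r = (mdist (phi x) (phi y) / mdist x y `^ q)%:E].

End lipschitz.

Section smooth.
Context {R : realType} {n : nat} {W : normedModType R}.

Fixpoint Ck (k : nat) (V : set 'rV[R]_n) (F : 'rV[R]_n -> W) : Prop :=
  match k with
  | 0%N => forall y, V y -> {for y, continuous F}
  | k'.+1 => (forall y, V y -> differentiable F y) /\
             (forall v : 'rV[R]_n, Ck k' V (fun y => 'D_v F y))
  end.

Definition Cinfty (V : set 'rV[R]_n) (F : 'rV[R]_n -> W) : Prop :=
  forall k, Ck k V F.

(* On a set S that is not open (a relatively open subset of a half-space, the
   coordinate image of a closed set), h is C^k at y when it agrees on S, near
   y, with a C^k map F defined on a full neighbourhood V of y. *)
Definition extends_near (S : set 'rV[R]_n) (h : 'rV[R]_n -> W) (y : 'rV[R]_n)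
    (V : set 'rV[R]_n) (F : 'rV[R]_n -> W) : Prop :=
  [/\ open V, V y & forall z, V z -> S z -> F z = h z].

End smooth.

(* {y | 0 <= y_0}, and the one-point space when n = 0. *)
Definition half_space (R : realType) (n : nat) : set 'rV[R]_n :=
  [set y | forall i : 'I_n, i = 0%N :> nat -> 0 <= y 0 i].

(* Smooth manifold with boundary on the carrier M with a smooth Riemannian
   metric: [gram c x] is the Gram matrix of the metric at x in the chart c.
   Tangent vectors are row vectors, so 'J F acts on them from the right. *)
Record riemannianAtlas (R : realType) (n : nat) (M : metricType R) := {
  chart : Type;
  chart_dom : chart -> set M;
  chart_map : chart -> M -> 'rV[R]_n;
  chart_inv : chart -> 'rV[R]_n -> M;
  gram : chart -> M -> 'M[R]_n;
  chart_dom_open : forall c, open (chart_dom c);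
  chart_cover : forall x, exists c, chart_dom c x;
  chart_mapK : forall c x, chart_dom c x -> chart_inv c (chart_map c x) = x;
  chart_image : forall c, exists V : set 'rV[R]_n,
    open V /\ chart_map c @` chart_dom c = V `&` @half_space R n;
  chart_map_continuous : forall c, {within chart_dom c, continuous (chart_map c)};
  chart_inv_continuous : forall c,
    {within chart_map c @` chart_dom c, continuous (chart_inv c)};
  gram_sym : forall c x, chart_dom c x -> (gram c x)^T = gram c x;
  gram_pos : forall c x, chart_dom c x -> forall v : 'rV[R]_n, v != 0 ->
    0 < (v *m gram c x *m v^T) 0 0;
  gram_smooth : forall c x, chart_dom c x -> exists V F,
    extends_near (chart_map c @` chart_dom c) (fun y => gram c (chart_inv c y))
      (chart_map c x) V F /\ Cinfty V F;
  chart_transition : forall c c' x, chart_dom c x -> chart_dom c' x -> exists V F,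
    [/\ extends_near (chart_map c @` (chart_dom c `&` chart_dom c'))
          (fun y => chart_map c' (chart_inv c y)) (chart_map c x) V F,
        Cinfty V F &
        gram c x = 'J F (chart_map c x) *m gram c' x *m ('J F (chart_map c x))^T]
}.

Section distance.
Context {R : realType} {n : nat} {M : metricType R} (G : riemannianAtlas n M).

(* l is the length of a C^1 curve from x to y inside the domain of c, given by
   its coordinate expression gam on [0, 1]. *)
Definition chart_curve (c : chart G) (x y : M) (l : R) : Prop :=
  exists gam : R -> 'rV[R]_n,
    [/\ (forall t, derivable gam t 1) /\ continuous (derive1 gam),
        forall t, 0 <= t <= 1 -> (chart_map c @` chart_dom c) (gam t),
        [/\ chart_dom c x, chart_dom c y, gam 0 = chart_map c x & gam 1 = chart_map c y] &
        l = \int[lebesgue_measure]_(t in `[0, 1])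
              Num.sqrt ((derive1 gam t *m gram c (chart_inv c (gam t))
                           *m (derive1 gam t)^T) 0 0)].

(* Piecewise C^1 curves, cut into pieces that each lie in one chart. *)
Inductive curve_length : M -> M -> R -> Prop :=
| curve_nil x : curve_length x x 0
| curve_cons c x y z l l' : chart_curve c x y l -> curve_length y z l' ->
    curve_length x z (l + l').

(* Since [mdist] is finite, this makes M connected. *)
Definition riemannian_distance : Prop :=
  forall x y, (mdist x y)%:E = ereal_inf (EFin @` curve_length x y).

End distance.

Record riemannianManifold (R : realType) (n : nat) (M : metricType R) := {
  atlas :> riemannianAtlas n M;
  mdist_riemannian : riemannian_distance atlas
}.

Section volume.
Context {R : realType} {n : nat}.

Definition euclidean := g_sigma_algebraType (@open 'rV[R]_n).

Definition is_lebesgue (lam : {measure set euclidean -> \bar R}) : Prop :=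
  forall a b : 'rV[R]_n, (forall i, a 0 i <= b 0 i) ->
    lam [set y : 'rV[R]_n | forall i, a 0 i < y 0 i <= b 0 i] =
    (\prod_(i < n) (b 0 i - a 0 i))%:E.

(* dm = sqrt (det gram) dLeb in every chart. *)
Definition riemannian_volume {d : measure_display} {M : borelMetricType d R}
    (G : riemannianManifold n M) (m : set M -> \bar R) : Prop :=
  exists lam : {measure set euclidean -> \bar R}, is_lebesgue lam /\
    forall (c : chart G) (A : set M), measurable A -> A `<=` chart_dom c ->
      m A = (\int[lam]_(y in chart_map c @` A)
               (Num.sqrt (\det (gram c (chart_inv c y))))%:E)%E.

End volume.

Section differential.
Context {R : realType} {n : nat} {M : metricType R}
  (G : riemannianManifold n M).
Variables (E : set M) (h : M -> M).

Definition local_C1 (c c' : chart G) (x : M) (V : set 'rV[R]_n)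
    (F : 'rV[R]_n -> 'rV[R]_n) : Prop :=
  extends_near (chart_map c @` (E `&` chart_dom c `&` h @^-1` chart_dom c'))
    (fun y => chart_map c' (h (chart_inv c y))) (chart_map c x) V F /\ Ck 1 V F.

Definition C1_on : Prop :=
  {within E, continuous h} /\
  forall x, E x -> forall c c' : chart G, chart_dom c x -> chart_dom c' (h x) ->
    exists V F, local_C1 c c' x V F.

(* |det Dh(x)| with respect to the Riemannian metrics at x and h x.  When E is
   the closure of an open set and h is C^1 on E, the value does not depend on
   the charts nor on the extension F. *)
Definition is_abs_det (x : M) (J : R) : Prop :=
  exists (c c' : chart G) V F,
    [/\ chart_dom c x, chart_dom c' (h x), local_C1 c c' x V F &
        J = `|\det ('J F (chart_map c x))| * Num.sqrt (\det (gram c' (h x)))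
              / Num.sqrt (\det (gram c x))].

Definition abs_det (x : M) : R := xget 0 [set J | is_abs_det x J].

End differential.

Section wasserstein.
Context {R : realType} {d : measure_display} {X : borelMetricType d R}.

Definition coupling (P Q : probability X R) (pi : probability (X * X)%type R)
    : Prop :=
  forall A : set X, measurable A ->
    pi (A `*` setT) = P A /\ pi (setT `*` A) = Q A.

Definition W1 (P Q : probability X R) : \bar R :=
  ereal_inf [set r | exists pi, coupling P Q pi /\
    r = (\int[pi]_z (mdist z.1 z.2)%:E)%E].

Definition W1_open (U : set (probability X R)) : Prop :=
  forall P, U P -> exists e : R, 0 < e /\
    forall Q, (W1 P Q < e%:E)%E -> U Q.

(* Borel measurability of a map into the metric space (M_1(X), W_1). *)
Definition W1_measurable {d' : measure_display} {Y : measurableType d'}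
    (nu : Y -> probability X R) : Prop :=
  forall U, W1_open U -> measurable (nu @^-1` U).

End wasserstein.

Section physical.
Context {R : realType} {d : measure_display} {M : topMeasurableType d}.

Definition weak_star_cvg (mus : nat -> {measure set M -> \bar R})
    (zeta : {measure set M -> \bar R}) : Prop :=
  forall phi : M -> R, continuous phi ->
    (\int[mus j]_x phi x) @[j --> \oo] --> \int[zeta]_x phi x.

Definition empirical (S : M -> M) (x : M) (j : nat)
    : {measure set M -> \bar R} :=
  mscale (j%:R^-1)%:nng (msum (fun i => \d_(iter i S x)) j).

Definition basin (S : M -> M) (zeta : probability M R) : set M :=
  [set x | weak_star_cvg (empirical S x) zeta].

Definition invariant_measure (S : M -> M) (zeta : probability M R) : Prop :=
  forall A, measurable A -> zeta (S @^-1` A) = zeta A.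

(* [vol] is the Riemannian volume of M.  For a product of two manifolds (which
   has corners when both have a boundary) with the product Riemannian
   structure, it is the product of the two Riemannian volumes. *)
Definition physical (vol : set M -> \bar R) (S : M -> M)
    (zeta : probability M R) : Prop :=
  invariant_measure S zeta /\ (0 < vol (basin S zeta))%E.

(* A MathComp-Analysis measure also takes (irrelevant) values on
   non-measurable sets, so equality of measures is tested on measurable sets. *)
Definition unique_physical (vol : set M -> \bar R) (S : M -> M) : Prop :=
  exists2 zeta, physical vol S zeta &
    forall zeta', physical vol S zeta' ->
      forall A, measurable A -> zeta' A = zeta A.

End physical.

Section dynamics.
Context {R : realType} {dO dX : measure_display}
  {Omega : borelMetricType dO R} {X : borelMetricType dX R} {n N : nat}.
Variables (G : riemannianManifold n Omega) (m : {measure set Omega -> \bar R})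
  (f : Omega -> Omega) (g : Omega -> X -> X)
  (D : 'I_N -> set Omega) (fbar theta : 'I_N -> Omega -> Omega)
  (eta : probability Omega R) (rho : Omega -> R).

Definition skew_product (z : Omega * X) : Omega * X := (f z.1, g z.1 z.2).

Definition bounded_fiber_Lip : Prop :=
  exists2 L : R, 0 < L &
    forall w, (L^-1%:E <= Lip (g w))%E /\ (Lip (g w) <= L%:E)%E.

(* [fbar i] is only relevant on the closure of [D i], where it is the extension
   of f restricted to [D i]; [theta i] is its inverse. *)
Definition full_branches : Prop :=
  [/\ forall i, open (D i),
      trivIset setT D,
      m (~` \bigcup_i D i) = 0%E,
      forall i, [/\ forall w, D i w -> fbar i w = f w,
                    C1_on G (closure (D i)) (fbar i) &
                    set_bij (closure (D i)) setT (fbar i)] &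
      forall i, [/\ forall w, closure (D i) (theta i w),
                    forall w, fbar i (theta i w) = w &
                    (Lip (theta i) <= 1)%E]].

Definition equivalent_with_density : Prop :=
  [/\ eta `<< m, m `<< eta, measurable_fun setT rho,
      forall w, 0 <= rho w &
      forall A, measurable A -> eta A = (\int[m]_(w in A) (rho w)%:E)%E].

Definition branch_weight (i : 'I_N) (w : Omega) : R :=
  rho (theta i w) /
    (abs_det G (closure (D i)) (fbar i) (theta i w) * rho w).

Variable p : 'I_N -> Omega -> R.

Definition mean_contraction : Prop :=
  exists2 lambda : R, lambda < 0 &
    {ae eta, forall w,
      \sum_(i < N) p i w * ln (fine (Lip (g (theta i w)))) <= lambda}.

Definition branch_regularity : Prop :=
  exists q L : R, [/\ 0 < q < 1, 0 < L &
    forall i, (holder q (p i : Omega -> R^o) <= L%:E)%E /\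
      forall x, (Lip (fun w => g (theta i w) x) <= L%:E)%E].

Definition sectional_transfer (nu : Omega -> probability X R) (w : Omega)
    (A : set X) : \bar R :=
  (\sum_(i < N) (p i w)%:E * pushforward (nu (theta i w)) (g (theta i w)) A)%E.

Definition sectional_fixed_point (nu : Omega -> probability X R) : Prop :=
  W1_measurable nu /\
  {ae eta, forall w, forall A, measurable A ->
    sectional_transfer nu w A = nu w A}.

Definition disintegration (nu : Omega -> probability X R)
    (mu : probability (Omega * X)%type R) : Prop :=
  forall A, measurable A -> mu A = (\int[eta]_w nu w (xsection A w))%E.

End dynamics.

(* Main.v *)
From HB Require Import structures.
Require Import Defs.
From mathcomp Require Import all_boot all_order all_algebra all_fingroup.
From mathcomp Require Import all_classical all_reals all_analysis measurable_realfun.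
From mathcomp Require Import ring lra zify.

Set Implicit Arguments.
Unset Strict Implicit.
Unset Printing Implicit Defensive.

Import Order.TTheory GRing.Theory Num.Theory.
Import numFieldNormedType.Exports.

Local Open Scope classical_set_scope.
Local Open Scope ring_scope.

(** Write [T] for the skew product. Taking the marginal on [Omega] sends the
    physical measures of [T] to physical measures of [f]. The theorem says that
    this is a bijection under which [mu] corresponds to [eta]; it rests on the
    fact that the basins involved are full cylinders: if [mu'] is [T]-invariant,
    with a marginal [zeta] that is bounded by a multiple of [eta], then
    [basin T mu' = basin f zeta `*` setT] ([basin_lift]).

    To see this, let [a_k w] be the product of the constants [Lip (g (f^j w))]
    over [j < k]. The mean contraction hypothesis, applied once per step, makes
    the integral of [a_k ^ alpha] against [eta] decay exponentially for small
    [alpha] ([power_contraction], [integral_power_decay]). So the [k]-th iterate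
    of [T] squeezes the fiber over most base points to a small diameter, and a
    continuous function along the orbit of [(w, x)] is close on average to a
    function of the base orbit only. This function, and the diameter itself, are
    continuous outside a closed null set, so the orbit of any [w] in
    [basin f zeta] samples them correctly, whatever [x] is ([generic_lift]).

    A physical measure [zeta] of [f] has a basin [B] of positive [eta]-measure,
    because [eta] and the volume have the same null sets. As [B] is invariant,
    so is [eta] conditioned on [B]; integrating time averages over [B] shows that
    it equals [zeta] ([basin_conditional]). Thus [zeta] is bounded by a multiple
    of [eta], and [mu] conditioned on [B `*` setT] is a [T]-invariant lift of it,
    which is physical because its basin is a cylinder over [B]
    ([physical_lift_exists]). Any physical measure of [T] with marginal [zeta]
    has basin points over [B], hence in the basin of that lift, and so coincides
    with it ([unique_physical_lift_iff]).

    The analytic input is that the weights [p i] are the Jacobians with respect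
    to [eta] of the inverse branches: [eta (D i `&` f @^-1` B)] is the integral
    of [p i] over [B] ([branch_measureE]). The differential of [f] gives one
    inequality only, by comparing [f] with its linear part on small cubes
    ([cube_expansion], [expands_det], [C1_expansion], [local_volume_stretch],
    [integral_branch_weight_le]); summing over the branches turns it into an
    equality, since by the fixed point equation the weights sum to 1. The
    resulting duality [integral_transfer] gives both the invariance of [mu]
    ([invariant_lift]) and the exponential decay above. *)

(** * Regularity of Borel measures *)

Lemma cvge_near_lt {R : realFieldType} {T : Type} {F : set_system T} {FF : Filter F}
    (u : T -> \bar R) (l y : \bar R) :
  u @ F --> l -> (l < y)%E -> \forall x \near F, (u x < y)%E.
Proof.
by move=> ul ly; apply: (ul [set z | (z < y)%E]); apply: open_nbhs_nbhs; split => //; exact: open_ereal_lt_ereal.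
Qed.

(* Row vectors get the join of the pointed and the pseudometric structures. *)
HB.saturate matrix.

Section regularity.
Context {R : realType} {T : pseudoPMetricType R}.
Notation bT := (g_sigma_algebraType (@open T)).

(** Remove ever smaller neighbourhoods of the complement. *)
Lemma open_bigcup_closed (O : set T) : open O ->
  exists C : nat -> set T, [/\ forall k, closed (C k),
    forall k, C k `<=` C k.+1 & \bigcup_k C k = O].
Proof.
move=> oO.
pose V k := \bigcup_(y in ~` O) (ball y (k.+1%:R^-1 : R))°.
have VO k : ~` O `<=` V k.
  by move=> y yO; exists y => //; apply: nbhsx_ballx; rewrite invr_gt0.
exists (fun k => ~` V k); split.
- by move=> k; apply: open_closedC; apply: bigcup_open => y _; exact: open_interior.
- move=> k; apply: subsetC => x [y yO yx]; exists y => //.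
  apply: interiorS yx; apply: le_ball.
  by rewrite lef_pV2 ?posrE// ler_nat.
- rewrite eqEsubset; split => x.
    by move=> [k _ Vx]; apply: contrapT => /VO - /(_ k).
  move=> Ox; have /nbhs_ballP[_/posnumP[e] eO] := open_nbhs_nbhs (conj oO Ox).
  have [k] := @ltr_add_invr R 0 e%:num (gt0 e); rewrite add0r => ke.
  exists k => // -[y yO /interior_subset /ball_sym xy]; apply: yO.
  by apply: eO; apply: le_ball xy; exact: ltW.
Qed.

(** The sets squeezed in this way between closed and open sets form a
    sigma-algebra; for a countable union, finiteness of [mu] lets finitely
    many of the closed sets do. *)
Lemma finite_measure_regular (mu : {finite_measure set bT -> \bar R}) (A : set bT) :
  measurable A -> forall e : R, 0 < e -> exists O C : set T,
  [/\ open O, closed C, C `<=` A, A `<=` O & (mu (O `\` C) < e%:E)%E].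
Proof.
have mo (O : set T) : open O -> measurable (O : set bT).
  by move=> oO; apply: sub_sigma_algebra.
have mc (C : set T) : closed C -> measurable (C : set bT).
  by move=> cC; rewrite -[C]setCK; apply: measurableC; apply: mo; exact: closed_openC.
pose G := [set A : set bT | forall e : R, 0 < e -> exists O C : set T,
  [/\ open O, closed C, C `<=` A, A `<=` O & (mu (O `\` C) < e%:E)%E]].
apply: (@smallest_sub _ _ (@open T) G) => [|O oO]; last first.
  move=> e e0; have [C [cC Cinc CO]] := open_bigcup_closed oO.
  have : mu (O `\` C k) @[k --> \oo] --> mu (\bigcap_k (O `\` C k)).
    apply: nonincreasing_cvg_mu => //=.
    - rewrite ltey_eq fin_num_measure//.
      by apply: measurableD; [exact: mo|exact: mc].
    - by move=> k; apply: measurableD; [exact: mo|exact: mc].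
    - by apply: bigcap_measurable => // k _; apply: measurableD; [exact: mo|exact: mc].
    - apply/nonincreasing_seqP => k; apply/subsetPset; apply: setDS; exact: Cinc.
  have -> : \bigcap_k (O `\` C k) = set0.
    rewrite -subset0 => x Hx; have [Ox _] := Hx 0%N I.
    by move: Ox; rewrite -CO => -[k _ Ckx]; have [_ /(_ Ckx)] := Hx k I.
  rewrite measure0 => cv0.
  have : \forall k \near \oo, (mu (O `\` C k) < e%:E)%E.
    by apply: (cvge_near_lt cv0) => //=; rewrite lte_fin.
  move=> [k _ /(_ k (leqnn _)) /= Hk].
  exists O, (C k); split => //.
  by rewrite -CO => x Cx; exists k.
split.
- move=> e e0; exists set0, set0; split => //; [exact: open0|exact: closed0|].
  by rewrite set0D measure0 lte_fin.
- move=> B GB e e0; have [ O [C [oO cC CB BO mue]]] := GB e e0.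
  exists (~` C), (~` O); split.
  + exact: closed_openC.
  + exact: open_closedC.
  + by rewrite setTD; exact: subsetC.
  + by rewrite setTD; exact: subsetC.
  + by rewrite setDE setCK setIC -setDE.
- move=> F GF e e0.
  pose ek k : R := (e / 2) / (2 ^ k.+1)%:R.
  have ek0 k : 0 < ek k by rewrite !divr_gt0// ltr0n expn_gt0.
  have HOC0 : forall k, exists O : set T, exists C : set T,
    [/\ open O, closed C, C `<=` F k, F k `<=` O & (mu (O `\` C) < (ek k)%:E)%E].
    by move=> k; exact: GF.
  move/choice: HOC0 => [ O /choice [C HOC]].
  have oO k : open (O k) by have [] := HOC k.
  have cC k : closed (C k) by have [] := HOC k.
  have mD k : measurable (O k `\` C k : set bT).
    by apply: measurableD; [exact: mo|exact: mc].
  pose OO := \bigcup_k O k.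
  have moO : measurable (OO : set bT) by apply: mo; apply: bigcup_open.
  pose CK K := \big[setU/set0]_(k < K) C k.
  have cCK K : closed (CK K).
    rewrite /CK; elim/big_ind : _ => //; [exact: closed0|].
    by move=> ? ? ? ?; exact: closedU.
  have mOCK K : measurable (OO `\` CK K : set bT).
    by apply: measurableD => //; exact: mc.
  have cvK : mu (OO `\` CK K) @[K --> \oo] --> mu (\bigcap_K (OO `\` CK K)).
    apply: nonincreasing_cvg_mu => //=.
    - by rewrite ltey_eq fin_num_measure.
    - exact: bigcap_measurable.
    - apply/nonincreasing_seqP => k; apply/subsetPset; apply: setDS.
      by rewrite /CK big_ord_recr/=; exact: subsetUl.
  have le2 : (mu (\bigcap_K (OO `\` CK K)) <= (e / 2)%:E)%E.
    apply: (@le_trans _ _ (\big[+%E/0%R]_(0 <= k <oo) mu (O k `\` C k))%E).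
      apply: measure_sigma_subadditive => //.
        by apply: bigcap_measurable.
      move=> x Hx; have [[k _ Okx] _] := Hx 0%N I.
      exists k => //; split => // Ckx.
      have [_] := Hx k.+1 I; apply; rewrite /CK big_ord_recr/=; by right.
    apply: (@le_trans _ _ (\big[+%E/0%R]_(0 <= k <oo) (ek k)%:E)%E).
      by apply: lee_nneseries => // k _; apply/ltW; have [] := HOC k.
    by apply: epsilon_trick0; rewrite divr_ge0// ltW.
  have : \forall K \near \oo, (mu (OO `\` CK K) < e%:E)%E.
    apply: (cvge_near_lt cvK) => //; apply: le_lt_trans le2 _.
    by rewrite lte_fin gtr_pMr// invf_lt1// ltr1n.
  move=> [K _ /(_ K (leqnn _)) /= HK].
  exists OO, (CK K); split => //.
  + exact: bigcup_open.
  + move=> x; rewrite /CK -bigcup_mkord => -[k /= kK Ckx]; exists k => //.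
    by have [_ _ + _ _] := HOC k; apply.
  + move=> x [k _ Fkx]; exists k => //.
    by have [_ _ _ + _] := HOC k; apply.
Qed.

(** Lebesgue measure is only locally finite, so regularity is applied to its
    restriction to a neighbourhood of the set. *)
Lemma outer_regular (mu : {measure set bT -> \bar R}) (V A : set bT) :
  @open T V -> (mu V < +oo)%E -> measurable A -> A `<=` V ->
  forall e : R, 0 < e -> exists O : set T,
  [/\ open O, A `<=` O, O `<=` V & (mu O <= mu A + e%:E)%E].
Proof.
move=> oV muV mA AV e e0.
have mo (O : set T) : open O -> measurable (O : set bT).
  by move=> oO; apply: sub_sigma_algebra.
have mV : measurable V := mo _ oV.
have [ O [C [oO cC CA AO]]] := finite_measure_regular
   (mfrestr mV muV : {finite_measure set bT -> \bar R}) mA e0.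
rewrite /= /mfrestr /mrestr => Oe.
have mC : measurable (C : set bT).
  by rewrite -[C]setCK; apply: measurableC; apply: mo; exact: closed_openC.
exists (O `&` V); split.
- exact: openI.
- by move=> x Ax; split; [exact: AO|exact: AV].
- exact: subIsetr.
- have mOV : measurable (O `&` V : set bT) by apply: mo; exact: openI.
  apply: (@le_trans _ _ (mu (A `|` ((O `\` C) `&` V)))).
    apply: le_measure; rewrite ?inE//.
      by apply: measurableU => //; apply: measurableI => //; apply: measurableD => //; exact: mo.
    move=> x [Ox Vx]; have [Ax|nAx] := pselect (A x); first by left.
    by right; split => //; split => // /CA.
  apply: le_trans (measureU2 _ _ _) _ => //.
    by apply: measurableI => //; apply: measurableD => //; exact: mo.
  by apply: leeD => //; exact: ltW.
Qed.

End regularity.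

(** Preimages of open sets are traces on [D] of open sets, and the sets whose
    preimage has a Borel trace on [D] form a sigma-algebra. *)
Lemma within_borel_preimage {T U : ptopologicalType} (D : set T) (h : T -> U) (A : set U) :
  <<s @open T >> D -> {within D, continuous h} -> <<s @open U >> A ->
  <<s @open T >> (D `&` h @^-1` A).
Proof.
move=> mD ch; pose G := [set A : set U | <<s @open T >> (D `&` h @^-1` A)].
have mG (B : set T) : <<s @open T >> B <-> measurable (B : set (g_sigma_algebraType (@open T))) by [].
apply: (@smallest_sub _ _ (@open U) G) => [|V oV].
  split; rewrite /G/=.
  - by rewrite preimage_set0 setI0; exact: (@measurable0 _ (g_sigma_algebraType (@open T))).
  - move=> B GB; rewrite setTD preimage_setC -setDE.
    have -> : D `\` h @^-1` B = D `\` (D `&` h @^-1` B) by rewrite setDIr setDv set0U.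
    by apply/mG; apply: measurableD.
  - move=> F GF; rewrite preimage_bigcup setI_bigcupr; apply/mG.
    by apply: bigcup_measurable => k _; exact: GF.
move/continuousP/(_ _ oV): ch => /open_subspaceP[W oW WE]; rewrite /G/= setIC -WE setIC.
by apply/mG; apply: measurableI => //; apply/mG; exact: sub_sigma_algebra.
Qed.

(** * Covering open sets by dyadic cubes *)

Section cubes.
Context {R : realType} {n : nat}.
Implicit Types (a b y : 'rV[R]_n) (U V : set 'rV[R]_n).

(** Half-open, so that the dyadic cubes of a given size tile the space. *)
Definition box a b : set 'rV[R]_n := [set y | forall i, a 0 i < y 0 i <= b 0 i].
Definition cube a (s : R) : set 'rV[R]_n := box a (a + const_mx s).

Lemma measurable_open_rV V : open V -> measurable (V : set (@euclidean R n)).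
Proof. exact: sub_sigma_algebra. Qed.

Lemma measurable_closed_rV V : closed V -> measurable (V : set (@euclidean R n)).
Proof.
by move=> cV; rewrite -[V]setCK; apply: measurableC; apply: measurable_open_rV; exact: closed_openC.
Qed.

Lemma measurable_box a b : measurable (box a b : set (@euclidean R n)).
Proof.
have -> : box a b = \bigcap_(i in [set: 'I_n])
    ([set y : 'rV[R]_n | a 0 i < y 0 i] `&` [set y | y 0 i <= b 0 i]).
  rewrite eqEsubset; split => y.
    by move=> yab i _; have /andP[] := yab i.
  by move=> yab i; have [|-> ->] := yab i.
apply: fin_bigcap_measurable => // i _; apply: measurableI.
  apply: measurable_open_rV.
  apply: (@open_comp _ _ (fun y : 'rV[R]_n => y 0 i) [set z | a 0 i < z]).
    by move=> y _; exact: coord_continuous.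
  exact: open_gt.
apply: measurable_closed_rV.
apply: (@closed_comp _ _ (fun y : 'rV[R]_n => y 0 i) [set z | z <= b 0 i]).
  by move=> y _; exact: coord_continuous.
exact: closed_le.
Qed.

Definition dyadic (kz : nat * 'rV[int]_n) : set 'rV[R]_n :=
  cube (\row_i ((kz.2 0 i)%:~R / 2 ^+ kz.1)) (2 ^+ kz.1)^-1.

Lemma dyadicP kz y : dyadic kz y <->
  forall i, (kz.2 0 i)%:~R < y 0 i * 2 ^+ kz.1 <= (kz.2 0 i + 1)%:~R.
Proof.
have p0 : 0 < 2 ^+ kz.1 :> R by rewrite exprn_gt0.
split=> H i; have := H i; rewrite !mxE intrD.
  rewrite -[X in _ <= _ + X]mul1r -mulrDl.
  by rewrite ltr_pdivrMr// ler_pdivlMr.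
by move=> h; rewrite -[X in _ <= _ + X]mul1r -mulrDl ltr_pdivrMr// ler_pdivlMr.
Qed.

Lemma dyadic_nested k d z z' y : dyadic (k, z) y -> dyadic ((k + d)%N, z') y ->
  dyadic ((k + d)%N, z') `<=` dyadic (k, z).
Proof.
move=> /dyadicP/= H /dyadicP/= H' w /dyadicP/= Hw; apply/dyadicP => i /=.
have p0 : 0 < 2 ^+ d :> R by rewrite exprn_gt0.
have e2 : (2 ^+ d : R) = (2 ^+ d : int)%:~R by rewrite rmorphXn.
have /andP[h1 h2] : (z 0 i * 2 ^+ d)%:~R < y 0 i * 2 ^+ (k + d)
    <= ((z 0 i + 1) * 2 ^+ d)%:~R.
  by rewrite exprD mulrA !intrM -e2 ltr_pM2r// ler_pM2r//; exact: H.
have /andP[h3 h4] := H' i; have /andP[h5 h6] := Hw i.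
rewrite -(ltr_pM2r p0) -(ler_pM2r p0) -mulrA -exprD e2 -!intrM.
have l1 : (z 0 i * 2 ^+ d <= z' 0 i)%R.
  by rewrite -ltzD1 -(@ltr_int R); exact: lt_le_trans h1 h4.
have l2 : (z' 0 i + 1 <= (z 0 i + 1) * 2 ^+ d)%R.
  by rewrite lezD1 -(@ltr_int R); exact: lt_le_trans h3 h2.
apply/andP; split.
  by apply: le_lt_trans h5; rewrite ler_int.
by apply: le_trans h6 _; rewrite ler_int.
Qed.

Lemma dyadic_level k z z' y : dyadic (k, z) y -> dyadic (k, z') y -> z = z'.
Proof.
move=> /dyadicP/= H /dyadicP/= H'; apply/rowP => i.
have /andP[h1 h2] := H i; have /andP[h3 h4] := H' i.
apply/eqP; rewrite eq_le -!ltzD1 -!(@ltr_int R).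
by rewrite (lt_le_trans h1 h4) (lt_le_trans h3 h2).
Qed.

Lemma dyadic_exists k y : exists z, dyadic (k, z) y.
Proof.
exists (\row_i (Num.ceil (y 0 i * 2 ^+ k) - 1)); apply/dyadicP => i /=.
by rewrite mxE subrK; exact: ceil_itv.
Qed.

(** When [U] is open these cubes partition it, by [maximal_dyadic_disjoint] and
    [maximal_dyadic_cover]. *)
Definition maximal_dyadic U (kz : nat * 'rV[int]_n) : Prop :=
  dyadic kz `<=` U /\
  forall j z, (j < kz.1)%N -> dyadic kz `<=` dyadic (j, z) -> ~ dyadic (j, z) `<=` U.

Lemma maximal_dyadic_disjoint U kz kz' y :
  maximal_dyadic U kz -> maximal_dyadic U kz' ->
  dyadic kz y -> dyadic kz' y -> kz = kz'.
Proof.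
wlog kk : kz kz' / (kz.1 <= kz'.1)%N.
  move=> H h1 h2 h3 h4; have [kk|/ltnW kk] := leqP kz.1 kz'.1; first exact: H.
  by apply/esym; exact: H.
case: kz kz' kk => [k z] [k' z'] /= kk [DU _] [DU' max] yz yz'.
move: kk; rewrite leq_eqVlt => /orP[/eqP kk|kk].
  by rewrite -kk in yz' *; rewrite (dyadic_level yz yz').
exfalso; apply: (max k z kk _ DU).
have e : k' = (k + (k' - k))%N by rewrite subnKC// ltnW.
by rewrite e in yz' *; exact: dyadic_nested yz yz'.
Qed.

Lemma maximal_dyadic_cover U y : open U -> U y ->
  exists2 kz, maximal_dyadic U kz & dyadic kz y.
Proof.
move=> oU Uy.
have ex : exists k, `[< exists2 z, dyadic (k, z) y & dyadic (k, z) `<=` U >].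
  have /nbhs_ballP[_/posnumP[e] eU] := open_nbhs_nbhs (conj oU Uy).
  pose k := Num.bound e%:num^-1; exists k; apply/asboolP.
  have [z zy] := dyadic_exists k y; exists z => // w /dyadicP wz.
  have /= yz := iffLR (dyadicP _ _) zy.
  apply: eU; split => // i j; rewrite !ord1 /ball/= {i}.
  have p0 : 0 < 2 ^+ k :> R by rewrite exprn_gt0.
  rewrite -(ltr_pM2r p0) -[X in _ * X](gtr0_norm p0) -normrM mulrBl.
  have l1 : `|y 0 j * 2 ^+ k - w 0 j * 2 ^+ k| < 1.
    have := wz j; have := yz j; rewrite /= intrD.
    by move=> /andP[? ?] /andP[? ?]; rewrite ltr_norml; lra.
  apply: lt_trans l1 _; rewrite mulrC -ltr_pdivrMr// mul1r.
  exact: (upper_nthrootP (leqnn _)).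
case: (ex_minnP ex) => k /asboolP[z zy zU] kmin; exists (k, z) => //.
split => // j z' /= jk sub sub'.
have : (k <= j)%N by apply: kmin; apply/asboolP; exists z' => //; exact: sub.
by rewrite leqNgt jk.
Qed.

End cubes.

Section cover.
Context {R : realType} {n : nat}.
Variable lam : {measure set (@euclidean R n) -> \bar R}.

(** A map that inflates small cubes by at most a factor [C] inflates every
    Borel set by at most [C]: approximate the set from outside by an open set
    and split that into its maximal dyadic cubes. *)
Lemma cube_expansion (V : set 'rV[R]_n) (F : 'rV[R]_n -> 'rV[R]_n) (C : R) :
  open V -> (lam V < +oo)%E -> 0 <= C ->
  (forall a s, 0 < s -> cube a s `<=` V -> exists W : set (@euclidean R n),
     [/\ measurable W, F @` cube a s `<=` W & (lam W <= C%:E * lam (cube a s))%E]) ->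
  forall B S : set (@euclidean R n), measurable B -> measurable S -> B `<=` V ->
  S `<=` F @` B -> (lam S <= C%:E * lam B)%E.
Proof.
move=> oV lamV C0 HC B S mB mS BV SB.
have openC U : open U -> U `<=` V -> S `<=` F @` U -> (lam S <= C%:E * lam U)%E.
  move=> oU UV SU.
  pose kz j := pickle_inv j : option (nat * 'rV[int]_n).
  pose Q j : set (@euclidean R n) := if kz j is Some q then
    (if `[< maximal_dyadic U q >] then dyadic q else set0) else set0.
  have mQ j : measurable (Q j).
    by rewrite /Q; case: (kz j) => [q|//]; case: ifP => // _; exact: measurable_box.
  have QU : \bigcup_j Q j `<=` U.
    move=> y [j _]; rewrite /Q; case: (kz j) => [q|//].
    by case: ifP => // /asboolP [h _]; exact: h.
  have tQ : trivIset setT Q.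
    apply/trivIsetP => i j _ _ ij; rewrite -subset0 => y []; rewrite /Q /kz.
    case Ei: (pickle_inv i) => [q|//]; case: ifP => // /asboolP mq yq.
    case Ej: (pickle_inv j) => [q'|//]; case: ifP => // /asboolP mq' yq'.
    have qq := maximal_dyadic_disjoint mq mq' yq yq'.
    move/eqP: ij; apply.
    have := @pickle_invK (nat * 'rV[int]_n)%type i.
    have := @pickle_invK (nat * 'rV[int]_n)%type j.
    by rewrite Ei Ej qq /= => -> ->.
  have HW0 : forall j, exists W : set (@euclidean R n),
      [/\ measurable W, F @` Q j `<=` W & (lam W <= C%:E * lam (Q j))%E].
    move=> j; rewrite /Q; case: (kz j) => [q|]; last first.
      by exists set0; split => //; rewrite ?image_set0// !measure0 mule0.
    case: ifP => [/asboolP[qU _]|_]; last first.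
      by exists set0; split => //; rewrite ?image_set0// !measure0 mule0.
    by apply: HC => [|y /qU /UV//]; rewrite invr_gt0 exprn_gt0.
  move/choice: HW0 => [W HW].
  have mW j : measurable (W j) by have [] := HW j.
  apply: (@le_trans _ _ (\big[+%E/0%R]_(0 <= j <oo) lam (W j))%E).
    apply: measure_sigma_subadditive => // y /SU [x Ux <-].
    have [q mq xq] := maximal_dyadic_cover oU Ux.
    exists (pickle q) => //; have [_ + _] := HW (pickle q); apply.
    by exists x => //; rewrite /Q /kz pickleK_inv asboolT.
  apply: (@le_trans _ _ (\big[+%E/0%R]_(0 <= j <oo) (C%:E * lam (Q j)))%E).
    by apply: lee_nneseries => // j _; have [] := HW j.
  rewrite nneseriesZl// -measure_semi_bigcup//; last exact: bigcup_measurable.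
  apply: lee_wpmul2l; rewrite ?lee_fin//; apply: le_measure; rewrite ?inE//.
    exact: bigcup_measurable.
  exact: measurable_open_rV.
have lamB : lam B \is a fin_num.
  rewrite ge0_fin_numE//; apply: le_lt_trans lamV.
  by apply: le_measure; rewrite ?inE//; exact: measurable_open_rV.
apply/lee_addgt0Pr => e e0.
have e0' : 0 < e / (C + 1) by rewrite divr_gt0// ltr_wpDl.
have [U [oU BU UV lamU]] := @outer_regular R 'rV[R]_n lam V B oV lamV mB BV _ e0'.
apply: (@le_trans _ _ (C%:E * lam U)%E).
  by apply: openC => // y /SB [x /BU Ux <-]; exists x.
apply: (@le_trans _ _ (C%:E * (lam B + (e / (C + 1))%:E))%E).
  by apply: lee_wpmul2l; rewrite ?lee_fin.
rewrite -(fineK lamB) -EFinD -!EFinM -EFinD lee_fin mulrDr lerD2l.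
by rewrite mulrA ler_pdivrMr ?ltr_wpDl// mulrC ler_pM2l// lerDl.
Qed.

End cover.

(** * Volume under linear maps *)

Lemma lee_at_right0 {R : realType} (x : \bar R) (h : R -> R) : {for 0, continuous h} ->
  (forall u, 0 < u -> (x <= (h u)%:E)%E) -> (x <= (h 0)%:E)%E.
Proof.
move=> ch xh; apply/lee_addgt0Pr => e e0; rewrite -EFinD.
have /nbhs_ballP[d /= d0 dh] : \forall u \near (0 : R), h u < h 0 + e.
  by apply: (cvgr_lt _ ch); rewrite ltrDl.
apply: le_trans (xh (d / 2) _) _; first by rewrite divr_gt0.
rewrite lee_fin ltW//; apply: dh; rewrite /ball/= sub0r normrN gtr0_norm ?divr_gt0//.
by rewrite ltr_pdivrMr// ltr_pMr// ltr1n.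
Qed.

Section rowvec_norm.
Context {R : realType} {n : nat}.
Implicit Types (v : 'rV[R]_n) (K : 'M[R]_n).

Lemma rV_norm_le v (c : R) : 0 <= c -> (`|v| <= c <-> forall i, `|v 0 i| <= c).
Proof.
move=> c0; rewrite [X in X <= _]mx_normrE; split.
  by move=> /bigmax_leP[_ H] i; exact: (H (ord0, i)).
by move=> H; apply/bigmax_leP; split => // -[i j] _; rewrite /= ord1.
Qed.

Lemma rV_coord_le v i : `|v 0 i| <= `|v|.
Proof. by have /rV_norm_le := lexx `|v|; apply. Qed.

Lemma mulmx_norm_le K : exists2 k : R, 0 < k & forall v, `|v *m K| <= k * `|v|.
Proof.
pose k := \sum_i \sum_j `|K i j|.
have k0 : 0 <= k by apply: sumr_ge0 => i _; apply: sumr_ge0.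
exists (k + 1); first by rewrite ltr_wpDl.
move=> v; apply: (@le_trans _ _ (k * `|v|)); last by rewrite ler_wpM2r// lerDl.
apply/rV_norm_le; first by rewrite mulr_ge0.
move=> j; rewrite mxE; apply: le_trans (ler_norm_sum _ _ _) _.
rewrite mulr_suml; apply: ler_sum => i _; rewrite normrM mulrC.
apply: ler_pM => //; last exact: rV_coord_le.
by rewrite (bigD1 j)//= lerDl sumr_ge0.
Qed.

Lemma mulmx_continuous K : continuous (fun v => v *m K).
Proof.
have [k k0 Hk] := mulmx_norm_le K.
move=> v U /nbhs_ballP[e /= e0 eU]; apply/nbhs_ballP.
exists (e / k); first by rewrite /= divr_gt0.
move=> w; rewrite mx_norm_ball /ball_/= => vw; apply: eU.
rewrite mx_norm_ball /ball_/= -mulmxBl; apply: le_lt_trans (Hk _) _.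
by rewrite mulrC -ltr_pdivlMr.
Qed.

Lemma measurable_image_mulmx K (B : set (@euclidean R n)) : K \in unitmx ->
  measurable B -> measurable ([set y *m K | y in B] : set (@euclidean R n)).
Proof.
move=> uK mB.
have -> : [set y *m K | y in B] = setT `&` (fun y => y *m invmx K) @^-1` B.
  rewrite setTI eqEsubset; split => y.
    by move=> [x Bx <-]; rewrite /= -mulmxA mulmxV// mulmx1.
  by move=> By; exists (y *m invmx K) => //; rewrite -mulmxA mulVmx// mulmx1.
apply: (@within_borel_preimage 'rV[R]_n 'rV[R]_n) => //.
  exact: (@measurableT _ (@euclidean R n)).
by apply: continuous_subspaceT; exact: mulmx_continuous.
Qed.

End rowvec_norm.

Section linear.
Context {R : realType} {n : nat}.
Variable lam : {measure set (@euclidean R n) -> \bar R}.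
Hypothesis hlam : is_lebesgue lam.
Implicit Types (L M : 'M[R]_n).

Lemma lam_box (a b : 'rV[R]_n) : (forall i, a 0 i <= b 0 i) ->
  lam (box a b) = (\prod_(i < n) (b 0 i - a 0 i))%:E.
Proof. exact: hlam. Qed.

Lemma lam_cube (a : 'rV[R]_n) s : 0 <= s -> lam (cube a s) = (s ^+ n)%:E.
Proof.
move=> s0; rewrite lam_box => [|i]; last by rewrite !mxE lerDl.
congr EFin; under eq_bigr do rewrite !mxE addrAC subrr add0r.
by rewrite prodr_const card_ord.
Qed.

Lemma ball0_box (r : R) : 0 < r -> ball (0 : 'rV[R]_n) r `<=` box (const_mx (- r)) (const_mx r).
Proof.
move=> r0 y [_ yr] i; rewrite !mxE; have := yr 0 i; rewrite /ball/= mxE sub0r normrN.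
by rewrite ltr_norml => /andP[-> /ltW].
Qed.

Lemma lam_ball0 (r : R) : 0 < r -> (lam (ball (0 : 'rV[R]_n)%R r) < +oo)%E.
Proof.
move=> r0; apply: (@le_lt_trans _ _ (lam (box (const_mx (- r)) (const_mx r)))).
  apply: le_measure; rewrite ?inE//; last exact: ball0_box.
    by apply: measurable_open_rV; exact: ball_open.
  exact: measurable_box.
rewrite lam_box ?ltry// => i; rewrite !mxE.
by rewrite (le_trans _ (ltW r0))// oppr_le0 ltW.
Qed.

(** An upper bound for the volume expansion of [y |-> y *m L], tested on cubes;
    [expands_image] extends it to bounded Borel sets. *)
Definition expands L (c : R) := forall a s (S : set (@euclidean R n)), 0 < s ->
  measurable S -> S `<=` [set y *m L | y in cube a s] -> (lam S <= (c * s ^+ n)%:E)%E.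

Lemma expands_lim L (c : R -> R) : {for 0, continuous c} ->
  (forall u, 0 < u -> expands L (c u)) -> expands L (c 0).
Proof.
move=> cc H a s S s0 mS SL.
apply: (@lee_at_right0 _ _ (fun u => c u * s ^+ n)); last by move=> u u0; exact: H SL.
by apply: cvgMl; exact: cc.
Qed.

(** The image of a cube lies in the box whose sides are the column sums of the
    absolute values; the half-open box is enlarged by [u] on its open side. *)
Lemma expands_colsum L : expands L (\prod_j \sum_i `|L i j|).
Proof.
pose c u := \prod_j (\sum_i `|L i j| + u).
have -> : \prod_j \sum_i `|L i j| = c 0 by apply: eq_bigr => j _; rewrite addr0.
apply: (expands_lim (c := c)).
  apply: continuous_big => [|j _]; first exact: mul_continuous.
  by move=> u; apply: cvgD; [exact: cvg_cst|exact: cvg_id].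
move=> u u0 a s S s0 mS SL.
pose l : 'rV[R]_n := \row_j ((a *m L) 0 j + s * (\sum_i Num.min 0 (L i j) - u)).
pose h : 'rV[R]_n := \row_j ((a *m L) 0 j + s * \sum_i Num.max 0 (L i j)).
have hl j : h 0 j - l 0 j = s * (\sum_i `|L i j| + u).
  have -> : \sum_i `|L i j| = \sum_i Num.max 0 (L i j) - \sum_i Num.min 0 (L i j).
    rewrite -sumrB; apply: eq_bigr => i _.
    by case: (lerP 0 (L i j)) => Lij; rewrite ?subr0 ?sub0r ?(ger0_norm Lij) ?(ltr0_norm Lij).
  by rewrite !mxE; ring.
apply: (@le_trans _ _ (lam (box l h))).
  apply: le_measure; rewrite ?inE//; first exact: measurable_box.
  move=> _ /SL [y ya <-] j.
  have -> : (y *m L) 0 j = (a *m L) 0 j + \sum_i (y 0 i - a 0 i) * L i j.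
    by rewrite !mxE -big_split/=; apply: eq_bigr => i _; rewrite -mulrDl addrC subrK.
  rewrite !mxE ltrD2l lerD2l; apply/andP; split.
    rewrite mulrBr; apply: (@lt_le_trans _ _ (s * \sum_i Num.min 0 (L i j))).
      by rewrite gtrBl mulr_gt0.
    rewrite mulr_sumr; apply: ler_sum => i _; have := ya i; rewrite !mxE => /andP[y1 y2].
    have ? : 0 <= y 0 i - a 0 i <= s by apply/andP; split; lra.
    by case: (lerP 0 (L i j)) => Lij; nra.
  rewrite mulr_sumr; apply: ler_sum => i _; have := ya i; rewrite !mxE => /andP[y1 y2].
  have ? : 0 <= y 0 i - a 0 i <= s by apply/andP; split; lra.
  by case: (lerP 0 (L i j)) => Lij; nra.
rewrite lam_box => [|j]; last first.
  by rewrite -subr_ge0 hl mulr_ge0 ?(ltW s0)// addr_ge0 ?(ltW u0)// sumr_ge0.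
rewrite lee_fin; under eq_bigr do rewrite hl.
by rewrite big_split/= prodr_const card_ord mulrC.
Qed.

Lemma expands_image L c (B S : set (@euclidean R n)) (r : R) : L \in unitmx -> expands L c -> 0 <= c ->
  measurable B -> measurable S -> 0 < r -> B `<=` ball (0 : 'rV[R]_n) r ->
  S `<=` [set y *m L | y in B] -> (lam S <= c%:E * lam B)%E.
Proof.
move=> uL Lc c0 mB mS r0 Br SB.
apply: (@cube_expansion _ _ lam (ball (0 : 'rV[R]_n) r) (fun y => y *m L)) => //.
- exact: ball_open.
- exact: lam_ball0.
- move=> a s s0 _; exists [set y *m L | y in cube a s].
  have mW : measurable ([set y *m L | y in cube a s] : set (@euclidean R n)).
    by apply: measurable_image_mulmx => //; exact: measurable_box.
  by split => //; rewrite (lam_cube _ (ltW s0)) -EFinM; exact: (Lc a s).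
Qed.

(** The image of a cube under [L] is no longer a cube, hence the use of
    [expands_image] for [M]. *)
Lemma expands_mul L M c d : L \in unitmx -> M \in unitmx -> 0 <= c -> 0 <= d ->
  expands L c -> expands M d -> expands (L *m M) (c * d).
Proof.
move=> uL uM c0 d0 Lc Md a s S s0 mS SLM.
pose B : set (@euclidean R n) := [set y *m L | y in cube a s].
have mB : measurable B.
  by apply: measurable_image_mulmx => //; exact: measurable_box.
have [k k0 kL] := mulmx_norm_le L.
pose r := k * (`|a| + s) + 1.
have r0 : 0 < r by rewrite ltr_wpDl// mulr_ge0 ?ltW// ltr_wpDl.
have Br : B `<=` ball (0 : 'rV[R]_n) r.
  move=> _ [y ya <-]; rewrite mx_norm_ball /ball_/= sub0r normrN.
  apply: le_lt_trans (kL _) _; rewrite ltr_pwDr// ler_wpM2l ?(ltW k0)//.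
  apply/rV_norm_le; first by rewrite addr_ge0// ltW.
  move=> i; have := ya i; have := rV_coord_le a i; rewrite !mxE ler_norml.
  by move=> /andP[? ?] /andP[? ?]; rewrite ler_norml; lra.
apply: (@le_trans _ _ (d%:E * lam B)%E).
  apply: (expands_image uM Md d0 mB mS r0 Br).
  by move=> y /SLM [x xa <-]; exists (x *m L); [exists x|rewrite mulmxA].
rewrite (mulrC c) -mulrA EFinM; apply: lee_wpmul2l; rewrite ?lee_fin//.
exact: (Lc a s).
Qed.

End linear.

Section determinant.
Context {R : realType} {n : nat}.
Variable lam : {measure set (@euclidean R n) -> \bar R}.
Hypothesis hlam : is_lebesgue lam.
Implicit Types (L M T : 'M[R]_n).

Lemma expands_diag (d : 'rV[R]_n) : expands lam (diag_mx d) (\prod_j `|d 0 j|).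
Proof.
have -> : \prod_j `|d 0 j| = \prod_j \sum_i `|diag_mx d i j|.
  apply: eq_bigr => j _; rewrite (bigD1 j)//= big1 => [|i ij].
    by rewrite addr0 mxE eqxx mulr1n.
  by rewrite mxE (negbTE ij) mulr0n normr0.
exact: expands_colsum.
Qed.

Lemma diag_unit (d : 'rV[R]_n) : (forall i, d 0 i != 0) -> diag_mx d \in unitmx.
Proof.
by move=> d0; rewrite unitmxE det_diag unitfE; apply/prodf_neq0 => i _.
Qed.

(** Conjugating by the diagonal matrix of entries [u ^ w i] multiplies the
    off-diagonal entries by positive powers of [u]; it does not change the
    expansion factor, and as [u] tends to 0 only the diagonal is left. *)
Lemma expands_triangular (w : 'I_n -> nat) T : T \in unitmx ->
  (forall i j, i != j -> T i j != 0 -> (w j < w i)%N) ->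
  expands lam T (\prod_j `|T j j|).
Proof.
move=> uT wT.
pose c (u : R) := \prod_j \sum_i `|T i j| * u ^+ (w i - w j).
have -> : \prod_j `|T j j| = c 0.
  apply: eq_bigr => j _; rewrite (bigD1 j)//= subnn expr0 mulr1 big1 ?addr0// => i ij.
  have [->|Tij] := eqVneq (T i j) 0; first by rewrite normr0 mul0r.
  by rewrite expr0n subn_eq0 leqNgt wT// mulr0.
apply: (expands_lim (c := c)).
  apply: continuous_big => [|j _]; first exact: mul_continuous.
  apply: continuous_big => [|i _]; first exact: add_continuous.
  by move=> u; apply: cvgMr; exact: exprn_continuous.
move=> u u0.
pose E : 'M[R]_n := diag_mx (\row_i u ^+ w i).
pose E' : 'M[R]_n := diag_mx (\row_i (u ^+ w i)^-1).
have uw i : u ^+ w i != 0 by rewrite expf_neq0// gt_eqF.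
have uE : E \in unitmx by apply: diag_unit => i; rewrite mxE.
have uE' : E' \in unitmx by apply: diag_unit => i; rewrite mxE invr_eq0.
have E'E : E' *m E = 1%:M.
  apply/matrixP => i j; rewrite mul_diag_mx !mxE.
  by case: eqP => [->|_]; rewrite ?mulr1n ?mulVf// mulr0n mulr0.
have -> : T = E' *m (E *m T *m E') *m E.
  by rewrite !mulmxA E'E mul1mx -mulmxA E'E mulmx1.
have -> : c u = (\prod_j (u ^+ w j)^-1) * c u * \prod_j u ^+ w j.
  rewrite [RHS]mulrAC -big_split/=.
  by rewrite [X in _ = X * _]big1 ?mul1r// => j _; rewrite mulVf.
have up j : 0 <= u ^+ w j by rewrite exprn_ge0// ltW.
have c0 : 0 <= c u.
  apply: prodr_ge0 => j _; apply: sumr_ge0 => i _.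
  by rewrite mulr_ge0 ?normr_ge0 ?exprn_ge0 ?(ltW u0).
have uT' : E *m T *m E' \in unitmx by rewrite !unitmx_mul uE uT uE'.
have p1 : 0 <= \prod_j (u ^+ w j)^-1 by apply: prodr_ge0 => j _; rewrite invr_ge0.
apply: expands_mul => //.
- by rewrite unitmx_mul uE' uT'.
- by rewrite mulr_ge0.
- by apply: prodr_ge0.
- apply: expands_mul => //.
    have -> : \prod_j (u ^+ w j)^-1 = \prod_j `|(\row_i (u ^+ w i)^-1 : 'rV[R]_n) 0 j|.
      by apply: eq_bigr => j _; rewrite mxE ger0_norm// invr_ge0.
    exact: expands_diag.
  have -> : c u = \prod_j \sum_i `|(E *m T *m E') i j|.
    apply: eq_bigr => j _; apply: eq_bigr => i _.
    rewrite mul_mx_diag mxE mul_diag_mx !mxE.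
    have [->|Tij] := eqVneq (T i j) 0; first by rewrite mulr0 mul0r normr0 mul0r.
    rewrite mulrAC normrM mulrC; congr (_ * _).
    have wij : (w j <= w i)%N.
      by have [->//|ij] := eqVneq i j; rewrite ltnW// wT.
    by rewrite ger0_norm ?mulr_ge0 ?invr_ge0// -{2}(subnK wij) exprD mulfK.
  exact: expands_colsum.
- have -> : \prod_j u ^+ w j = \prod_j `|(\row_i u ^+ w i : 'rV[R]_n) 0 j|.
    by apply: eq_bigr => j _; rewrite mxE ger0_norm.
  exact: expands_diag.
Qed.

Lemma expands_perm (s : 'S_n) : expands lam (perm_mx s) 1.
Proof.
have {1}-> : 1 = \prod_j \sum_i `|(perm_mx s : 'M[R]_n) i j|.
  rewrite big1// => j _; rewrite (bigD1 (s^-1 j)%g)//= big1 => [|i ij].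
    by rewrite addr0 !mxE permKV eqxx normr1.
  rewrite !mxE; case: eqP => [sij|_]; last by rewrite normr0.
  by move: ij; rewrite -sij permK eqxx.
exact: expands_colsum.
Qed.

End determinant.

(** By the LUP decomposition, permutations and triangular matrices suffice. *)
Lemma expands_det {R : realType} {n : nat} (lam : {measure set (@euclidean R n) -> \bar R})
    (L : 'M[R]_n) : is_lebesgue lam -> L \in unitmx -> expands lam L `|\det L|.
Proof.
case: n lam L => [|n] lam L hlam uL.
  rewrite det_mx00 normr1.
  by have := @expands_colsum R 0 lam hlam L; rewrite big_ord0.
have := cormen_lup_correct L; have := cormen_lup_detL L.
have := cormen_lup_perm L; have := @cormen_lup_lower _ _ L; have := @cormen_lup_upper _ _ L.
case: (cormen_lup L) => [[P A] U] /= upU loA /is_perm_mxP[s Ps] detA PLU0.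
have PLU : P *m L = A *m U := PLU0.
have uP : P \in unitmx by rewrite Ps unitmx_perm.
have uA : A \in unitmx by rewrite unitmxE detA unitr1.
have uU : U \in unitmx.
  have : A *m U \in unitmx by rewrite -PLU unitmx_mul uP.
  by rewrite unitmx_mul uA.
have LE : L = perm_mx s^-1 *m A *m U.
  rewrite -mulmxA -PLU.
  by rewrite Ps mulmxA -perm_mxM mulVg perm_mx1 mul1mx.
have tA : is_trig_mx A.
  apply/is_trig_mxP => i j ij; rewrite (loA _ _ (ltnW ij)).
  by case: eqP ij => // ->; rewrite ltnn.
have tU : is_trig_mx U^T.
  by apply/is_trig_mxP => i j ij; rewrite mxE upU.
have dU : \det U = \prod_j U j j.
  by rewrite -det_tr det_trig//; apply: eq_bigr => j _; rewrite mxE.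
have -> : `|\det L| = 1 * (\prod_j `|A j j|) * (\prod_j `|U j j|).
  rewrite LE !det_mulmx det_perm !normrM normr_sign; congr (_ * _ * _).
    by rewrite det_trig// normr_prod.
  by rewrite dU normr_prod.
rewrite LE; apply: expands_mul => //.
- by rewrite unitmx_mul unitmx_perm.
- by rewrite mul1r prodr_ge0.
- by rewrite prodr_ge0.
- apply: expands_mul => //; [exact: unitmx_perm|exact: prodr_ge0|exact: expands_perm|].
  apply: (expands_triangular hlam (w := fun i => i)) => // i j ij.
  by apply: contra_neqT; rewrite -leqNgt => ij'; rewrite loA// (negbTE ij).
- apply: (expands_triangular hlam (w := fun i => (n - i)%N)) => // i j ij.
  apply: contra_neqT; rewrite -leqNgt => ij'; apply: upU.
  have := ltn_ord i; have := ltn_ord j.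
  by move: ij ij'; rewrite -val_eqE /= => /eqP; lia.
Qed.

(** * Volume under C^1 maps *)

Section C1.
Context {R : realType} {n : nat}.
Implicit Types (F : 'rV[R]_n -> 'rV[R]_n) (V : set 'rV[R]_n).

Lemma derive_along F (z v : 'rV[R]_n) j (t : R) : differentiable F (t *: v + z) ->
  is_derive t (1 : R) (fun t => F (t *: v + z) 0 j) (('D_v F (t *: v + z)) 0 j).
Proof.
move=> dF.
have H : (fun h : R => h^-1 *: (((fun t => F (t *: v + z) 0 j) \o shift t) (h *: 1)
   - F (t *: v + z) 0 j)) @ 0^' --> ('D_v F (t *: v + z)) 0 j.
  have dv : derivable F (t *: v + z) v by exact: diff_derivable.
  have -> : (fun h : R => h^-1 *: (((fun t => F (t *: v + z) 0 j) \o shift t) (h *: 1)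
     - F (t *: v + z) 0 j)) = (fun w : 'rV[R]_n => w 0 j) \o
     (fun h : R => h^-1 *: ((F \o shift (t *: v + z)) (h *: v) - F (t *: v + z))).
    apply/funext => h /=; rewrite !mxE/=; congr (_ * (F _ 0 j - _)).
    by rewrite -[h *: 1]/(h * 1) mulr1 scalerDl addrA.
  exact: (continuous_cvg _ (@coord_continuous R 1 n 0 j _) dv).
apply: DeriveDef; first exact: cvgP H.
exact: cvg_lim H.
Qed.

(** Mean value theorem on the segment from [z] to [y], one coordinate at a
    time, with partial derivatives close to those at [y0] on a small ball. *)
Lemma strictly_differentiable V F (y0 : 'rV[R]_n) (d : R) : open V -> V y0 -> Ck 1 V F -> 0 < d ->
  exists2 r, 0 < r & ball y0 r `<=` V /\ forall y z, ball y0 r y -> ball y0 r z ->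
    `|F y - F z - (y - z) *m 'J F y0| <= d * `|y - z|.
Proof.
move=> oV Vy0 [dF cF] d0.
have n0 : 0 < n.+1%:R :> R by [].
pose e := d / n.+1%:R; have e0 : 0 < e by rewrite divr_gt0.
have near0 i : \forall y \near y0, `|'D_(delta_mx 0 i) F y0 - 'D_(delta_mx 0 i) F y| < e.
  have /nbhs_ballP[s /= s0 sy] := cF (delta_mx 0 i) y0 Vy0 _ (nbhsx_ballx _ _ e0).
  by apply/nbhs_ballP; exists s => // y /sy; rewrite /= mx_norm_ball.
have : \forall y \near y0, V y /\ forall i, `|'D_(delta_mx 0 i) F y0 - 'D_(delta_mx 0 i) F y| < e.
  apply: filterI; first exact: open_nbhs_nbhs.
  exact: (filter_forall (nbhs_filter y0) near0).
move=> /nbhs_ballP[r /= r0 Hr]; exists r => //; split; first by move=> y /Hr [].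
move=> y z yr zr; pose v := y - z.
apply/rV_norm_le; first by rewrite mulr_ge0 ?normr_ge0 ?(ltW d0).
move=> j.
have pr (t : R) : 0 <= t <= 1 -> ball y0 r (t *: v + z).
  move=> /andP[t0 t1]; rewrite mx_norm_ball /ball_/= in yr zr *.
  have -> : y0 - (t *: v + z) = t *: (y0 - y) + (1 - t) *: (y0 - z).
    by apply/rowP => k; rewrite !mxE; ring.
  apply: le_lt_trans (ler_normD _ _) _; rewrite !normrZ ger0_norm// ger0_norm ?subr_ge0//.
  have [AB|BA] := leP `|y0 - y| `|y0 - z|.
    by apply: le_lt_trans zr; nra.
  by apply: le_lt_trans yr; nra.
have dph (t : R) : 0 <= t <= 1 -> is_derive t (1 : R) (fun t => F (t *: v + z) 0 j)
    (('D_v F (t *: v + z)) 0 j).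
  by move=> t01; apply: derive_along; apply: dF; have [] := Hr _ (pr _ t01).
have [c c01 Hc] : exists2 c, c \in `]0, 1[%R &
    F (1 *: v + z) 0 j - F (0 *: v + z) 0 j = ('D_v F (c *: v + z)) 0 j * (1 - 0).
  apply: (@MVT _ (fun t => F (t *: v + z) 0 j)) => //.
    by move=> x /[!in_itv]/= /andP[x0 x1]; apply: dph; rewrite !ltW.
  apply: derivable_within_continuous => x /[!in_itv]/= x01.
  by have [] := dph x x01.
have c01' : 0 <= c <= 1 by move: c01 => /[!in_itv]/= /andP[? ?]; rewrite !ltW.
rewrite subr0 mulr1 scale1r scale0r add0r subrK in Hc.
have -> : (F y - F z - (y - z) *m 'J F y0) 0 j =
    ('D_v F (c *: v + z)) 0 j - ('D_v F y0) 0 j.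
  by rewrite -Hc (deriveEjacobian _ (dF _ Vy0)) !mxE.
have DE p : V p -> 'D_v F p = \sum_i v 0 i *: 'D_(delta_mx 0 i) F p.
  move=> Vp; rewrite deriveE; last exact: dF.
  rewrite [in LHS](row_sum_delta v) linear_sum/=; apply: eq_bigr => i _.
  by rewrite linearZ/= deriveE//; exact: dF.
have Vp : V (c *: v + z) by have [] := Hr _ (pr _ c01').
rewrite !DE// !summxE -sumrB; apply: le_trans (ler_norm_sum _ _ _) _.
apply: (@le_trans _ _ (\sum_(i < n) `|v| * e)).
  apply: ler_sum => i _; rewrite !mxE -mulrBr normrM; apply: ler_pM => //.
    by have := rV_coord_le v i; rewrite !mxE.
  have [_ /(_ i) /ltW H] := Hr _ (pr _ c01'); rewrite distrC.
  apply: le_trans H; have := rV_coord_le ('D_(delta_mx 0 i) F y0 - 'D_(delta_mx 0 i) F (c *: v + z)) j.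
  by rewrite !mxE.
have en : e * n%:R <= d.
  by rewrite /e mulrAC ler_pdivrMr// ler_wpM2l ?(ltW d0)// ler_nat.
by rewrite sumr_const card_ord -mulr_natr -mulrA mulrC ler_wpM2r.
Qed.

(** Composing with the inverse of the derivative gives a map close to the
    identity, which sends a cube into a slightly larger one. *)
Lemma C1_expansion (lam : {measure set (@euclidean R n) -> \bar R}) V F (y0 : 'rV[R]_n) (e : R) :
  is_lebesgue lam -> open V -> V y0 -> Ck 1 V F -> 'J F y0 \in unitmx -> 0 < e ->
  exists V0 : set 'rV[R]_n, [/\ open V0, V0 y0, V0 `<=` V &
   forall B S : set (@euclidean R n), measurable B -> measurable S -> B `<=` V0 ->
     S `<=` F @` B -> (lam S <= ((1 + e) * `|\det ('J F y0)|)%:E * lam B)%E].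
Proof.
move=> hlam oV Vy0 CF uJ e0; pose J := 'J F y0.
have [k k0 Hk] := mulmx_norm_le (invmx J).
(* The side of the image cube is multiplied by [1 + 2 * k * d]. *)
have [d d0 Hd] : exists2 d : R, 0 < d & (1 + 2 * (k * d)) ^+ n <= 1 + e.
  have /nbhs_ballP[s /= s0 Hs] : \forall t \near (0 : R), (1 + 2 * (k * t)) ^+ n < 1 + e.
    have c : {for 0, continuous (fun t : R => (1 + 2 * (k * t)) ^+ n)}.
      apply: (@continuous_comp _ _ _ (fun t : R => 1 + 2 * (k * t)) (fun t => t ^+ n)).
        by apply: cvgD; [exact: cvg_cst|apply: cvgMr; apply: cvgMr; exact: cvg_id].
      exact: exprn_continuous.
    by apply: (cvgr_lt _ c); rewrite !mulr0 addr0 expr1n ltrDl.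
  exists (s / 2); first by rewrite divr_gt0.
  apply/ltW/Hs; rewrite /ball/= sub0r normrN gtr0_norm ?divr_gt0//.
  by rewrite ltr_pdivrMr// ltr_pMr// ltr1n.
have [r0 r00 [rV Hr0]] := strictly_differentiable oV Vy0 CF d0.
exists (ball y0 r0); split; [exact: ball_open|exact: ballxx|exact: rV|].
move=> B S mB mS BV SB.
pose s' := 1 + 2 * (k * d).
have s'0 : 0 < s' by rewrite ltr_wpDr// !mulr_ge0// ltW.
apply: (@cube_expansion _ _ lam (ball y0 r0) F) => //.
- exact: ball_open.
- have [r1 r10 Hr1] : exists2 r1 : R, 0 < r1 & ball y0 r0 `<=` ball (0 : 'rV[R]_n) r1.
    exists (`|y0| + r0); first by rewrite ltr_wpDl.
    move=> y; rewrite !mx_norm_ball /ball_/= sub0r normrN => yr.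
    have -> : y = y0 - (y0 - y) by rewrite subKr.
    by apply: le_lt_trans (ler_normB _ _) _; rewrite ltrD2l.
  apply: le_lt_trans (lam_ball0 hlam r10).
  by apply: le_measure; rewrite ?inE//; apply: measurable_open_rV; exact: ball_open.
- by rewrite mulr_ge0// addr_ge0// ltW.
- move=> a s s0 sub.
  pose z := a + const_mx s.
  have zc : cube a s z by move=> i; rewrite !mxE lexx andbT ltrDl.
  pose b : 'rV[R]_n := F z *m invmx J - const_mx (s + k * d * s).
  have FW : F @` cube a s `<=` [set y *m J | y in cube b (s' * s)].
    move=> _ [y yc <-]; exists (F y *m invmx J); last by rewrite -mulmxA mulVmx// mulmx1.
    have := Hr0 y z (sub _ yc) (sub _ zc).
    rewrite -/J => H.
    have yzs : `|y - z| <= s.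
      apply/rV_norm_le; first exact: ltW.
      move=> i; have := yc i; rewrite !mxE => /andP[? ?]; rewrite ler_norml; lra.
    have : `|(F y - F z - (y - z) *m J) *m invmx J| <= k * d * s.
      apply: le_trans (Hk _) _; rewrite -mulrA ler_wpM2l ?(ltW k0)//.
      by apply: le_trans H _; rewrite ler_wpM2l ?(ltW d0).
    rewrite mulmxBl -mulmxA mulmxV// mulmx1 mulmxBl => H' i.
    have := rV_coord_le (F y *m invmx J - F z *m invmx J - (y - z)) i.
    move=> /le_trans/(_ H'); have := yc i; rewrite /b /z /s' !mxE.
    set u := \sum_j _; set u' := \sum_j _ => /andP[y1 y2]; rewrite ler_norml => /andP[h1 h2].
    by apply/andP; split; lra.
  exists [set y *m J | y in cube b (s' * s)]; split => //.
    by apply: measurable_image_mulmx => //; exact: measurable_box.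
  have ss : 0 < s' * s by rewrite mulr_gt0.
  apply: (@le_trans _ _ (`|\det J| * (s' * s) ^+ n)%:E).
    apply: (expands_det hlam uJ (a := b) ss) => //.
    by apply: measurable_image_mulmx => //; exact: measurable_box.
  rewrite (lam_cube hlam _ (ltW s0)) -EFinM lee_fin exprMn mulrA ler_wpM2r//.
    by rewrite exprn_ge0// ltW.
  by rewrite mulrC ler_wpM2r.
Qed.

End C1.

(** * Riemannian volume in charts *)

Section integral_monotone.
Context {d : measure_display} {T : measurableType d} {R : realType}.
Variable mu : {measure set T -> \bar R}.

(** The integral of a nonnegative function is a supremum over the simple
    functions below it, hence monotone even on nonmeasurable functions. *)
Lemma ge0_integral_monotone (D : set T) (f1 f2 : T -> \bar R) :
  (forall x, D x -> (0 <= f1 x)%E) -> (forall x, D x -> (f1 x <= f2 x)%E) ->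
  (\int[mu]_(x in D) f1 x <= \int[mu]_(x in D) f2 x)%E.
Proof.
move=> f10 f12; have f20 x : D x -> (0 <= f2 x)%E.
  by move=> Dx; apply: le_trans (f12 _ Dx); exact: f10.
rewrite !ge0_integralE//; apply: ge_ereal_sup => _ [h /= hf <-].
apply: ereal_sup_ubound; exists h => //= x.
apply: le_trans (hf x) _; rewrite /patch; case: ifPn => // /set_mem; exact: f12.
Qed.

Lemma integral_ge_cst (D : set T) (w : T -> \bar R) (c : R) : measurable D -> 0 <= c ->
  (forall x, D x -> (c%:E <= w x)%E) -> (c%:E * mu D <= \int[mu]_(x in D) w x)%E.
Proof.
by move=> mD c0 cw; rewrite -integral_cst//; apply: ge0_integral_monotone.
Qed.

Lemma integral_le_cst (D : set T) (w : T -> \bar R) (c : R) : measurable D ->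
  (forall x, D x -> (0 <= w x)%E) -> (forall x, D x -> (w x <= c%:E)%E) ->
  (\int[mu]_(x in D) w x <= c%:E * mu D)%E.
Proof.
by move=> mD w0 cw; rewrite -integral_cst//; apply: ge0_integral_monotone.
Qed.

End integral_monotone.

Lemma det_continuous {R : realType} {n : nat} : continuous (fun A : 'M[R]_n => \det A).
Proof.
rewrite /determinant; apply: continuous_big => [|s _]; first exact: add_continuous.
have cs : continuous (fun A : 'M[R]_n => \prod_i A i (s i)).
  apply: continuous_big => [|i _]; first exact: mul_continuous.
  exact: coord_continuous.
by move=> A; apply: cvgMr; [exact: (nbhs_filter A)|exact: cs].
Qed.

Section charts.
Context {R : realType} {n : nat} {d : measure_display} {M : borelMetricType d R}.
Variable G : riemannianAtlas n M.

Lemma borel_metric_open (O : set M) : open O -> measurable O.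
Proof. by move=> oO; rewrite borel_measurableE; exact: sub_sigma_algebra. Qed.

Lemma borel_metric_closed (C : set M) : closed C -> measurable C.
Proof.
by move=> cC; rewrite -[C]setCK; apply: measurableC; apply: borel_metric_open; exact: closed_openC.
Qed.

Lemma half_space_closed : closed (@half_space R n).
Proof.
have -> : @half_space R n = \bigcap_(i in [set i : 'I_n | i = 0%N :> nat]) [set y | 0 <= y 0 i].
  by rewrite eqEsubset; split => y yP i; exact: yP.
apply: closed_bigI => i _.
apply: (@closed_comp _ _ (fun y : 'rV[R]_n => y 0 i) [set z | 0 <= z]).
  by move=> y _; exact: coord_continuous.
exact: closed_ge.
Qed.

Lemma measurable_chart_image (c : chart G) (A : set M) : measurable A -> A `<=` chart_dom c ->
  measurable (chart_map c @` A : set (@euclidean R n)).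
Proof.
move=> mA Ac.
have -> : chart_map c @` A = (chart_map c @` chart_dom c) `&` (chart_inv c) @^-1` A.
  rewrite eqEsubset; split => y.
    move=> [x Ax <-]; split; first by exists x => //; exact: Ac.
    by rewrite /= chart_mapK//; exact: Ac.
  move=> [[x cx <-]]; rewrite /= chart_mapK// => Ax.
  by exists x.
apply: (@within_borel_preimage 'rV[R]_n M).
- have [V [oV ->]] := chart_image c.
  apply: (@measurableI _ (@euclidean R n)); first exact: measurable_open_rV.
  by apply: measurable_closed_rV; exact: half_space_closed.
- exact: chart_inv_continuous.
- by rewrite -borel_measurableE.
Qed.

Lemma chart_preimage_open (c : chart G) (O : set 'rV[R]_n) : open O ->
  open (chart_dom c `&` chart_map c @^-1` O).
Proof.
move=> oO; have oc := chart_dom_open c.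
by apply: (iffLR (continuous_inP _ oc)) => //; rewrite -continuous_open_subspace//;
  exact: chart_map_continuous.
Qed.

(** The coordinate expression of the Riemannian volume density. *)
Definition density (c : chart G) (y : 'rV[R]_n) : R :=
  Num.sqrt (\det (gram c (chart_inv c y))).

(** On the image of the chart, the density agrees near [x] with a continuous
    function defined on a full neighbourhood, also at boundary points. *)
Lemma density_near (c : chart G) (x : M) (P : set R) : chart_dom c x ->
  nbhs (density c (chart_map c x)) P ->
  exists V : set 'rV[R]_n, [/\ open V, V (chart_map c x) &
    forall y, V y -> (chart_map c @` chart_dom c) y -> P (density c y)].
Proof.
move=> cx nP.
have [V [F [[oV Vx VF] CF]]] := gram_smooth cx.
pose D y := Num.sqrt (\det (F y)).
have imx : (chart_map c @` chart_dom c) (chart_map c x) by exists x.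
have Dx : D (chart_map c x) = density c (chart_map c x).
  by rewrite /D (VF _ Vx imx).
have cD : {for (chart_map c x), continuous D}.
  apply: (@continuous_comp _ _ _ (fun y => \det (F y)) Num.sqrt); last exact: sqrt_continuous.
  apply: (@continuous_comp _ _ _ F (fun A => \det A)); last exact: det_continuous.
  exact: (CF 0%N).
have : nbhs (chart_map c x) (V `&` D @^-1` P).
  apply: filterI; first exact: open_nbhs_nbhs.
  by apply: cD; rewrite Dx.
move=> /nbhs_ballP[r /= r0 Hr]; exists (ball (chart_map c x) r); split.
- exact: ball_open.
- exact: ballxx.
- by move=> y /Hr [Vy Py] yim; rewrite /density -(VF _ Vy yim).
Qed.

End charts.

Section local_jacobian.
Context {R : realType} {n : nat} {d : measure_display} {M : borelMetricType d R}.
Variables (G : riemannianManifold n M) (m : {measure set M -> \bar R}).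
Hypothesis vol : riemannian_volume G m.
Variables (E : set M) (h th : M -> M).
Hypothesis th_cont : continuous th.
Hypothesis thE : forall w, E (th w).
Hypothesis hth : forall w, h (th w) = w.
Hypothesis mth : forall A, measurable A -> measurable (th @` A).

(** Near a point where the Jacobian [J] of [h] does not vanish, [h] stretches
    volume by a factor close to [J]. The three factors [k] come from the
    differential of [h] and from the volume densities at the two ends. *)
Lemma local_volume_stretch (w0 : M) (J k : R) : is_abs_det G E h (th w0) J -> J != 0 -> 1 < k ->
  exists U, [/\ open U, U w0 & forall A, measurable A -> A `<=` U ->
    (m A <= (k ^+ 3 * J)%:E * m (th @` A))%E].
Proof.
move=> [c [c' [V [F [cx c'x [[oV Vx VF] CF] JE]]]]] J0 k1.
have k0 : 0 < k by exact: lt_trans k1.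
rewrite hth in c'x JE.
have [lam [hlam volE]] := vol.
set x0 := th w0 in cx Vx JE *; set y0 := chart_map c x0 in Vx JE *.
set w1 := Num.sqrt (\det (gram c x0)) in JE; set w2 := Num.sqrt (\det (gram c' w0)) in JE.
have w1E : density c y0 = w1 by rewrite /density chart_mapK.
have w2E : density c' (chart_map c' w0) = w2 by rewrite /density chart_mapK.
have [uJ w10 w20] : [/\ 'J F y0 \in unitmx, 0 < w1 & 0 < w2].
  move: J0; rewrite JE !mulf_eq0 !negb_or invr_eq0 normr_eq0 => /andP[/andP[dJ n2] n1].
  by rewrite unitmxE unitfE dJ !lt_neqAle !sqrtr_ge0 !(eq_sym 0) n1 n2.
have k10 : 0 < k - 1 by rewrite subr_gt0.
have [V0 [oV0 V0y V0V]] := C1_expansion hlam oV Vx CF uJ k10.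
rewrite (addrC 1) subrK => HV0.
have [V1 [oV1 V1y HV1]] : exists V1 : set 'rV[R]_n, [/\ open V1, V1 y0 &
    forall y, V1 y -> (chart_map c @` chart_dom c) y -> w1 / k < density c y].
  apply: (density_near (P := [set t | w1 / k < t])) => //.
  apply: open_nbhs_nbhs; split; first exact: open_gt.
  by rewrite /= -/y0 w1E ltr_pdivrMr// ltr_pMr.
have [V2 [oV2 V2y HV2]] : exists V2 : set 'rV[R]_n, [/\ open V2, V2 (chart_map c' w0) &
    forall y, V2 y -> (chart_map c' @` chart_dom c') y -> density c' y < k * w2].
  apply: (density_near (P := [set t | t < k * w2])) => //.
  apply: open_nbhs_nbhs; split; first exact: open_lt.
  by rewrite /= w2E ltr_pMl.
exists (th @^-1` (chart_dom c `&` chart_map c @^-1` (V0 `&` V1)) `&`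
  (chart_dom c' `&` chart_map c' @^-1` V2)); split => //.
  apply: openI; last exact: chart_preimage_open.
  apply: open_comp; first by move=> w _; exact: th_cont.
  by apply: chart_preimage_open; exact: openI.
move=> A mA AU; set B := th @` A.
have mB : measurable B := mth mA.
have Bc : B `<=` chart_dom c by move=> _ [w /AU [[cw _] _] <-].
have Ac' : A `<=` chart_dom c' by move=> w /AU [_ [cw _]].
have mcB := measurable_chart_image mB Bc.
have mcA := measurable_chart_image mA Ac'.
have lowB : ((w1 / k)%:E * lam (chart_map c @` B) <= m B)%E.
  rewrite (volE c)//; apply: integral_ge_cst => //; first by rewrite divr_ge0 ?ltW.
  move=> _ [_ [w Aw <-] <-]; rewrite lee_fin ltW//; apply: HV1.
    by have [[_ []]] := AU _ Aw.
  by exists (th w) => //; have [[]] := AU _ Aw.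
have upA : (m A <= (k * w2)%:E * lam (chart_map c' @` A))%E.
  rewrite (volE c')//; apply: integral_le_cst => // _ [w Aw <-].
  rewrite lee_fin ltW//; apply: HV2; first by have [_ []] := AU _ Aw.
  by exists w => //; exact: Ac'.
have stretch : (lam (chart_map c' @` A) <=
    (k * `|\det ('J F y0)|)%:E * lam (chart_map c @` B))%E.
  apply: HV0 => // [_ [_ [w Aw <-] <-]|_ [w Aw <-]].
    by have [[_ []]] := AU _ Aw.
  have [[cw [V0w _]] _] := AU _ Aw.
  exists (chart_map c (th w)); first by exists (th w) => //; exists w.
  rewrite VF; [by rewrite chart_mapK// hth|exact: V0V|].
  exists (th w) => //; split; [by split|].
  by rewrite /= hth; exact: Ac'.
apply: le_trans upA _.
apply: (@le_trans _ _ ((k * w2)%:E * ((k * `|\det ('J F y0)|)%:E * lam (chart_map c @` B)))%E).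
  by apply: lee_wpmul2l => //; rewrite lee_fin mulr_ge0 ?ltW.
have -> : ((k * w2)%:E * ((k * `|\det ('J F y0)|)%:E * lam (chart_map c @` B)) =
    (k ^+ 3 * J)%:E * ((w1 / k)%:E * lam (chart_map c @` B)))%E.
  rewrite !muleA -!EFinM; congr (_%:E * _)%E; rewrite JE; field.
  by rewrite !gt_eqF.
apply: lee_wpmul2l => //; rewrite lee_fin mulr_ge0 ?exprn_ge0 ?(ltW k0)//.
by rewrite JE divr_ge0 ?(ltW w10)// mulr_ge0 ?(ltW w20).
Qed.

End local_jacobian.

(** The segment from the identity to a positive definite matrix avoids the
    singular matrices, so the determinant keeps its sign along it. *)
Lemma posdef_det_gt0 {R : realType} {n : nat} (A : 'M[R]_n) :
  (forall v : 'rV[R]_n, v != 0 -> 0 < (v *m A *m v^T) 0 0) -> 0 < \det A.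
Proof.
move=> A0; pose h (t : R) := \det (1%:M + t *: (A - 1%:M)).
have h0 t : 0 <= t <= 1 -> h t != 0.
  move=> /andP[t0 t1]; apply/negP => /det0P[v v0 /(congr1 (fun w => (w *m v^T) 0 0))].
  rewrite mulmxDr mulmx1 -scalemxAr mulmxBr mulmx1 mul0mx !mulmxDl -scalemxAl mulmxBl !mxE.
  have := A0 v v0; rewrite [X in 0 < X]mxE.
  have vv : 0 < \sum_j v 0 j * v^T j 0.
    have [j vj] : exists j, v 0 j != 0.
      apply/existsP; apply: contraNT v0; rewrite negb_exists => /forallP v0.
      by apply/eqP/rowP => j; rewrite mxE; apply/eqP; have := v0 j; rewrite negbK.
    rewrite (bigD1 j)//= ltr_wpDr//.
      by apply: sumr_ge0 => i _; rewrite mxE -expr2 sqr_ge0.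
    by rewrite mxE -expr2 exprn_even_gt0.
  set a := \sum_j _; set b := \sum_j _; rewrite -/b in vv => a0 ab.
  have : 0 < (1 - t) * b + t * a by nra.
  rewrite (_ : (1 - t) * b + t * a = b + t * (a - b)); last by ring. by rewrite ab ltxx.
have h1 : h 1 = \det A by rewrite /h scale1r addrC subrK.
have hz : h 0 = 1 by rewrite /h scale0r addr0 det1.
rewrite ltNge; apply/negP => dA.
have ch : continuous h.
  have cg : continuous (fun t : R => 1%:M + t *: (A - 1%:M) : 'M[R]_n).
    by move=> t; apply: cvgD; [exact: cvg_cst|exact: cvgZr_tmp].
  by move=> t; exact: (continuous_comp (cg t) (@det_continuous R n _)).
have [|c c01 hc] := @IVT R h 0 1 0 ler01 (continuous_subspaceT ch).
  by rewrite hz h1 ge_min le_max dA ler01 orbT.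
by have := h0 c; rewrite in_itv/= in c01; rewrite hc eqxx => /(_ c01).
Qed.

(** Every chart image contains a cube on which the density is bounded below. *)
Lemma riemannian_volume_gt0 {R : realType} {n : nat} {d : measure_display}
    {M : borelMetricType d R} (G : riemannianManifold n M) (m : {measure set M -> \bar R}) :
  riemannian_volume G m -> (0 < m setT)%E.
Proof.
move=> [lam [hlam volE]]; have [c cx] := chart_cover (atlas G) point.
set x := (point : M) in cx *; set y0 := chart_map c x.
have w0 : 0 < density c y0.
  by rewrite /density chart_mapK// sqrtr_gt0 posdef_det_gt0//; exact: gram_pos.
have w20 : 0 < density c y0 / 2 by rewrite divr_gt0.
have [V1 [oV1 V1y HV1]] : exists V1 : set 'rV[R]_n, [/\ open V1, V1 y0 &
    forall y, V1 y -> (chart_map c @` chart_dom c) y -> density c y0 / 2 < density c y].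
  apply: (density_near (P := [set t | density c y0 / 2 < t])) => //.
  by apply: lt_nbhsr; rewrite ltr_pdivrMr// ltr_pMr// ltr1n.
have [V [oV imV]] := chart_image c.
have [Vy Hy] : (V `&` @half_space R n) y0 by rewrite -imV; exists x.
have := @filterI _ (nbhs y0) (nbhs_filter y0) _ _ (open_nbhs_nbhs (conj oV Vy))
  (open_nbhs_nbhs (conj oV1 V1y)).
move=> /nbhs_ballP[e /= e0 He].
pose A := chart_dom c `&` chart_map c @^-1` V1.
have mA : measurable A by apply: borel_metric_open; exact: chart_preimage_open.
have Ac : A `<=` chart_dom c by move=> ? [].
(* The corner of the cube is [y0], so that the cube stays in the half-space. *)
have boxA : cube y0 (e / 2) `<=` chart_map c @` A.
  move=> y Hyb.
  have [Vy1 V1y1] : (V `&` V1) y.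
    apply: He; rewrite -ball_normE/=; apply: (@le_lt_trans _ _ (e / 2)); last by lra.
    apply/rV_norm_le; first lra.
    by move=> i; have /andP[] := Hyb i; rewrite !mxE ler_norml; lra.
  have : (chart_map c @` chart_dom c) y.
    rewrite imV; split => // i i0; have /andP[] := Hyb i; have := Hy i i0; rewrite !mxE; lra.
  by move=> [z cz zy]; exists z => //; split=> //; rewrite /= zy.
apply: (@lt_le_trans _ _ (m A)); last by apply: le_measure; rewrite ?inE.
have mim := measurable_chart_image mA Ac.
rewrite (volE c)//; apply: (@lt_le_trans _ _ ((density c y0 / 2)%:E * lam (chart_map c @` A))%E).
  apply: mule_gt0; first by rewrite lte_fin.
  apply: (@lt_le_trans _ _ (lam (cube y0 (e / 2)))).
    by rewrite lam_cube ?lte_fin ?exprn_gt0//; lra.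
  by apply: le_measure => //; rewrite inE//; exact: measurable_box.
apply: integral_ge_cst => //; first exact: ltW.
by move=> _ [z [cz V1z] <-]; rewrite lee_fin ltW//; apply: HV1 => //; exists z.
Qed.

(** * Countable covers and logarithmic scales *)

Lemma second_countable_sequence (T : topologicalType) : @second_countable T ->
  exists b : nat -> set T, (forall k, open (b k)) /\
    forall (U : set T) x, open U -> U x -> exists2 k, b k x & b k `<=` U.
Proof.
move=> [B /countable_injP[e einj] [oB nB]].
pose b k := \bigcup_(G in [set G | B G /\ e G = k]) G.
exists b; split.
  by move=> k; apply: bigcup_open => G [BG _]; exact: oB.
move=> U x oU Ux; have [G [BG Gx] GU] := nB x U (open_nbhs_nbhs (conj oU Ux)).
have bG : b (e G) = G.
  rewrite eqEsubset; split => y; last by move=> Gy; exists G.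
  by move=> [G' [BG' /einj eG]]; rewrite eG// inE.
by exists (e G); rewrite bG.
Qed.

Section countable_cover.
Context {d : measure_display} {T : measurableType d} {R : realType}.
Variables (mu beta : {measure set T -> \bar R}) (w : T -> \bar R).

(** The set is cut into countably many disjoint pieces, each of them inside one
    of the sets where the comparison is known. *)
Lemma countable_cover_integral_le (I : countType) (U : I -> set T) (S : set T) :
  (forall i, measurable (U i)) -> measurable S -> measurable_fun S w ->
  (forall x, S x -> (0 <= w x)%E) ->
  (forall x, S x -> exists2 i, U i x & forall A, measurable A -> A `<=` U i `&` S ->
     (\int[mu]_(x in A) w x <= beta A)%E) ->
  (\int[mu]_(x in S) w x <= beta S)%E.
Proof.
move=> mU mS mw w0 HU.
pose good i := forall A, measurable A -> A `<=` U i `&` S ->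
     (\int[mu]_(x in A) w x <= beta A)%E.
pose V k : set T := if pickle_inv k is Some i then
   (if `[< good i >] then U i `&` S else set0) else set0.
have mV k : measurable (V k).
  rewrite /V; case: (pickle_inv k) => [i|//]; case: ifP => // _; exact: measurableI.
have VS : S = \bigcup_k seqDU V k.
  rewrite -seqDU_bigcup_eq eqEsubset; split => x.
    move=> Sx; have [i Ux gi] := HU x Sx; exists (pickle i) => //.
    by rewrite /V pickleK_inv asboolT.
  by move=> [k _]; rewrite /V; case: (pickle_inv k) => [i|//]; case: ifP => // _ [].
have mD k : measurable (seqDU V k) by exact: measurableD _ (bigsetU_measurable _ _).
have DS k : seqDU V k `<=` S by rewrite [X in _ `<=` X]VS; exact: bigcup_sup.
have tD : trivIset setT (seqDU V) by exact: trivIset_seqDU.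
have mwV : measurable_fun (\bigcup_k seqDU V k) w by rewrite -VS.
have wV0 x : (\bigcup_k seqDU V k) x -> (0 <= w x)%E by rewrite -VS; exact: w0.
have mDV : measurable (\bigcup_k seqDU V k) by rewrite -VS.
rewrite [in leLHS]VS ge0_integral_bigcup// [in leRHS]VS measure_semi_bigcup//.
apply: lee_nneseries => [k _|k _].
  by move=> _; apply: integral_ge0 => x /DS; exact: w0.
have [->|/set0P[x Dx]] := eqVneq (seqDU V k) set0.
  by rewrite integral_set0 measure0.
have : V k x by case: Dx.
rewrite {1}/V; case Ek: (pickle_inv k) => [i|//]; case: ifP => // /asboolP gi _.
apply: gi => //; apply: subset_trans (@subDsetl _ _ _) _.
by rewrite /V Ek; case: ifP => _; [exact: subset_refl|exact: sub0set].
Qed.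

End countable_cover.

Section levels.
Context {R : realType}.

Definition log_level (t : R) (a : int) : set R :=
  [set x | expR (a%:~R * t) <= x < expR ((a + 1)%:~R * t)].

Lemma log_level_exists (t x : R) : 0 < t -> 0 < x -> exists a, log_level t a x.
Proof.
move=> t0 x0; exists (Num.floor (ln x / t)).
have /andP[h1 h2] := floor_itv (ln x / t).
rewrite /log_level/= -[in X in _ <= X](lnK x0) -[in X in X < _](lnK x0) ler_expR ltr_expR.
by rewrite -ler_pdivlMr// -ltr_pdivrMr// h1 h2.
Qed.

Lemma measurable_log_level t a : measurable (log_level t a).
Proof.
have -> : log_level t a = `[expR (a%:~R * t), expR ((a + 1)%:~R * t)[%classic.
  by apply/seteqP; split => x; rewrite /= in_itv.
exact: measurable_itv.
Qed.

End levels.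

(** * Inverse branches *)

Section push_measure.
Context {d d' : measure_display} {T : measurableType d} {U : measurableType d'} {R : realType}.
Variables (f : T -> U) (mf : measurable_fun setT f) (mu : {measure set T -> \bar R}).

Definition push_measure : {measure set U -> \bar R} :=
  @measure_function_pushforward__canonical__measure_function_Measure d d' T U R mu f mf.

Lemma push_measureE A : push_measure A = mu (f @^-1` A). Proof. by []. Qed.

Lemma integral_push_measure (h : U -> \bar R) : measurable_fun setT h ->
  (forall y, (0 <= h y)%E) ->
  (\int[push_measure]_y h y = \int[mu]_x h (f x))%E.
Proof. by move=> mh h0; rewrite ge0_integral_pushforward. Qed.

End push_measure.

Section lipschitz_facts.
Context {R : realType} {Y Z : metricType R}.
Implicit Types (phi : Y -> Z).

Lemma Lip_le phi (L : R) : (Lip phi <= L%:E)%E ->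
  forall x y, mdist (phi x) (phi y) <= L * mdist x y.
Proof.
move=> HL x y; have [->|/eqP xy] := eqVneq x y.
  by rewrite !mdistxx mulr0.
have xy0 : 0 < mdist x y by rewrite mdist_gt0; exact/eqP.
rewrite -ler_pdivrMr// -lee_fin; apply: le_trans HL.
by apply: ereal_sup_ubound; exists x, y.
Qed.

Lemma metric_nbhs (x : Y) (P : set Y) :
  nbhs x P <-> exists2 e : R, 0 < e & forall y, mdist x y < e -> P y.
Proof.
split=> [/nbhs_ballP[e e0 eP]|[e e0 eP]].
  by exists e => // y xy; apply: eP; rewrite ballEmdist.
by apply/nbhs_ballP; exists e => // y; rewrite ballEmdist; exact: eP.
Qed.

Lemma Lip_continuous phi (L : R) : (Lip phi <= L%:E)%E -> continuous phi.
Proof.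
move=> HL x P /nbhs_ballP[e /= e0 eP]; apply/metric_nbhs.
have k0 : 0 < `|L| + 1 by rewrite ltr_wpDl.
exists (e / (`|L| + 1)); first by rewrite divr_gt0.
move=> y xy; apply: eP; rewrite ballEmdist/=.
apply: le_lt_trans (Lip_le HL _ _) _.
rewrite ltr_pdivlMr// in xy; apply: le_lt_trans xy.
rewrite mulrC ler_wpM2l ?mdist_ge0//.
by apply: le_trans (ler_norm _) _; rewrite lerDl.
Qed.

Lemma holder_continuous phi (q L : R) : 0 < q -> (holder q phi <= L%:E)%E -> continuous phi.
Proof.
move=> q0 HL x P /nbhs_ballP[e /= e0 eP]; apply/metric_nbhs.
have k0 : 0 < `|L| + 1 by rewrite ltr_wpDl.
have ek0 : 0 < e / (`|L| + 1) by rewrite divr_gt0.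
exists ((e / (`|L| + 1)) `^ q^-1); first by rewrite powR_gt0.
move=> y xy; apply: eP; rewrite ballEmdist/=.
have [->|/eqP nxy] := eqVneq x y; first by rewrite mdistxx.
have xy0 : 0 < mdist x y by rewrite mdist_gt0; exact/eqP.
have xyq : mdist x y `^ q < e / (`|L| + 1).
  have <- : ((e / (`|L| + 1)) `^ q^-1) `^ q = e / (`|L| + 1).
    by rewrite -powRrM mulVf ?gt_eqF// powRr1// ltW.
  by apply: gt0_ltr_powR => //; rewrite nnegrE ?powR_ge0// ltW.
have h : mdist (phi x) (phi y) / mdist x y `^ q <= L.
  rewrite -lee_fin; apply: le_trans HL.
  by apply: ereal_sup_ubound; exists x, y.
rewrite ler_pdivrMr ?powR_gt0// in h; apply: le_lt_trans h _.
rewrite ltr_pdivlMr// in xyq; apply: le_lt_trans xyq.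
rewrite mulrC ler_wpM2l ?powR_ge0//.
by apply: le_trans (ler_norm _) _; rewrite lerDl.
Qed.

End lipschitz_facts.

Lemma borel_metric_measurable_fun {R : realType} {d d' : measure_display}
    {Y : borelMetricType d R} {Z : borelMetricType d' R} (h : Y -> Z) :
  continuous h -> measurable_fun setT h.
Proof.
move=> ch _ B mB; rewrite borel_measurableE.
apply: (@within_borel_preimage Y Z) => //; last by rewrite -borel_measurableE.
- by rewrite -borel_measurableE.
- exact: continuous_subspaceT.
Qed.

Lemma continuous_measurable_realfun {R : realType} {d : measure_display}
    {Y : topMeasurableType d} (h : Y -> R) :
  (forall O : set Y, open O -> measurable O) -> continuous h -> measurable_fun setT h.
Proof.
move=> oY /continuousP ch; apply: (measurability _ (RGenOpens.measurableE R)).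
by move=> _ [_ [a [b ->] <-]]; rewrite setTI; apply/oY/ch/interval_open.
Qed.

Section branch.
Context {R : realType} {n N : nat} {d : measure_display} {Omega : borelMetricType d R}.
Variables (G : riemannianManifold n Omega) (m : {measure set Omega -> \bar R})
  (f : Omega -> Omega) (D : 'I_N -> set Omega) (fbar theta : 'I_N -> Omega -> Omega)
  (eta : probability Omega R) (rho : Omega -> R).
Hypothesis cpt : compact [set: Omega].
Hypothesis vol : riemannian_volume G m.
Hypothesis mf : measurable_fun setT f.
Hypothesis fb : full_branches G m f D fbar theta.
Hypothesis dens : equivalent_with_density m eta rho.

Let p := branch_weight G D fbar theta rho.

Lemma branch_weight_ge0 i w : 0 <= p i w.
Proof.
have [_ _ _ rho0 _] := dens.
rewrite /p /branch_weight divr_ge0// mulr_ge0// /abs_det.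
case: xgetP => // J _ [c [c' [V [F [_ _ _ ->]]]]].
by rewrite divr_ge0// mulr_ge0.
Qed.

Lemma theta_continuous i : continuous (theta i).
Proof. by have [_ _ _ _ /(_ i) [_ _ /Lip_continuous]] := fb. Qed.

Lemma theta_measurable i : measurable_fun setT (theta i).
Proof. by apply: borel_metric_measurable_fun; exact: theta_continuous. Qed.

Lemma measurable_branch i : measurable (D i).
Proof. by have [oD _ _ _ _] := fb; exact: borel_metric_open. Qed.

Lemma theta_fbar i w : closure (D i) w -> theta i (fbar i w) = w.
Proof.
have [_ _ _ /(_ i) [_ _ [_ inj _]] /(_ i) [tD ft _]] := fb.
move=> Dw; apply: inj; rewrite ?inE//.
Qed.

Lemma theta_f i w : D i w -> theta i (f w) = w.
Proof.
move=> Dw; have [_ _ _ /(_ i) [fE _ _] _] := fb.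
by rewrite -fE// theta_fbar//; exact: subset_closure.
Qed.

Lemma image_theta i A : theta i @` A = closure (D i) `&` fbar i @^-1` A.
Proof.
have [_ _ _ _ /(_ i) [tD ft _]] := fb.
rewrite eqEsubset; split => w.
  by move=> [v Av <-]; split => //=; rewrite ft.
by move=> [Dw Aw]; exists (fbar i w) => //; rewrite theta_fbar.
Qed.

Lemma measurable_image_theta i A : measurable A -> measurable (theta i @` A).
Proof.
move=> mA; rewrite image_theta borel_measurableE.
have [_ _ _ /(_ i) [_ [cf _] _] _] := fb.
apply: (@within_borel_preimage Omega Omega) => //; last by rewrite -borel_measurableE.
by rewrite -borel_measurableE; apply: borel_metric_closed; exact: closed_closure.
Qed.

Lemma measurable_fpre i A : measurable A -> measurable (D i `&` f @^-1` A).
Proof.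
move=> mA; apply: measurableI; first exact: measurable_branch.
by rewrite -[X in measurable X]setTI; exact: mf.
Qed.

Lemma measurable_branches : measurable (\bigcup_i D i).
Proof. by apply: fin_bigcup_measurable => // i _; exact: measurable_branch. Qed.

Lemma eta_branches : eta (~` \bigcup_i D i) = 0%E.
Proof.
have [em _ _ _ _] := dens; have [oD _ mD0 _ _] := fb.
have /null_content_dominatesP := em; apply => //.
by apply: measurableC; exact: measurable_branches.
Qed.

(** The closure of a branch adds only points outside of all branches. *)
Lemma eta_image_theta i A : measurable A -> eta (theta i @` A) = eta (D i `&` f @^-1` A).
Proof.
move=> mA; have [oD tD _ /(_ i) [fE _ _] /(_ i) [_ ft _]] := fb.
have mDA := measurable_fpre i mA.
apply/eqP; rewrite eq_le; apply/andP; split; last first.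
  apply: le_measure; rewrite ?inE//; first exact: measurable_image_theta.
  by move=> w [Dw Aw]; exists (f w) => //; exact: theta_f.
have mU := measurableC measurable_branches.
rewrite -[leRHS]adde0 -eta_branches; apply: le_trans (measureU2 _ mDA mU).
apply: le_measure; rewrite ?inE//; [exact: measurable_image_theta|exact: measurableU|].
move=> w wA; have [[j _ Dj]|nD] := pselect ((\bigcup_i D i) w); last by right.
have [clw Aw] : closure (D i) w /\ A (fbar i w) by rewrite image_theta in wA.
have [v [Div Djv]] := clw _ (open_nbhs_nbhs (conj (oD j) Dj)).
have ij : i = j by apply: (tD i j) => //; exists v.
by left; split; [rewrite ij|rewrite /= -fE// ij].
Qed.

(** On a small set where [p i], [rho] and [rho \o theta i] are constant up to a
    factor [expR t], the stretching estimate for [f] on the branch and the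
    formula for [p i] match up to a factor [expR (6 * t)]. *)
Lemma integral_branch_weight_le i B : measurable_fun setT (p i) -> measurable B ->
  (\int[eta]_(w in B) (p i w)%:E <= eta (D i `&` f @^-1` B))%E.
Proof.
move=> mp mB; have [_ _ mrho rho0 etaE] := dens.
have mth := theta_measurable i.
have [_ _ _ /(_ i) [_ [_ _] _] /(_ i) [tD ft _]] := fb.
suff H (t : R) : 0 < t -> (\int[eta]_(w in B) (p i w)%:E <=
    (expR (6 * t) * fine (eta (D i `&` f @^-1` B)))%:E)%E.
  have := @lee_at_right0 R (\int[eta]_(w in B) (p i w)%:E)
    (fun t => expR (6 * t) * fine (eta (D i `&` f @^-1` B))).
  rewrite mulr0 expR0 mul1r fineK ?fin_num_measure//; last exact: measurable_fpre.
  apply => //; apply: cvgMl.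
  have ce : {for (0 : R), continuous (expR \o (fun u : R => 6 * u))}.
    apply: continuous_comp; last exact: continuous_expR.
    by apply: cvgMr; exact: cvg_id.
  exact: ce.
move=> t0.
have mDf := measurable_branch i.
pose kap := push_measure mf (mrestr eta mDf).
have e6 : 0 <= expR (6 * t) by exact: expR_ge0.
pose beta := mscale (NngNum e6) kap.
have betaE A : measurable A -> beta A = ((expR (6 * t))%:E * eta (theta i @` A))%E.
  by move=> mA; rewrite eta_image_theta// /beta /mscale/= /pushforward /mrestr setIC.
have -> : ((expR (6 * t) * fine (eta (D i `&` f @^-1` B)))%:E = beta B)%E.
  rewrite betaE// eta_image_theta// EFinM fineK// fin_num_measure//.
  exact: measurable_fpre.
have [b [ob bb]] := second_countable_sequence
  (@compact_second_countable R (Omega : pseudoPMetricType R) cpt).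
pose U (x : option (nat * int * int * int)) : set Omega :=
  if x is Some (j, a1, a2, a3) then b j `&` (p i @^-1` log_level t a1 `&`
    (rho @^-1` log_level t a2 `&` (rho \o theta i) @^-1` log_level t a3))
  else p i @^-1` [set 0].
have mrt : measurable_fun setT (rho \o theta i) by exact: measurableT_comp.
apply: (@countable_cover_integral_le _ _ _ _ _ _ _ U) => //.
- move=> [[[[j a1] a2] a3]|]; rewrite /U; last first.
    by rewrite -[X in measurable X]setTI; exact: mp.
  apply: measurableI; first exact: borel_metric_open.
  have ml := @measurable_log_level R t.
  apply: measurableI; first by rewrite -[X in measurable X]setTI; exact: mp.
  by apply: measurableI; rewrite -[X in measurable X]setTI; [exact: mrho|exact: mrt].
- by apply/measurable_EFinP; exact: measurable_funTS.
- by move=> w _; rewrite lee_fin; exact: branch_weight_ge0.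
move=> w0 Bw0; have [p0|p0] := eqVneq (p i w0) 0.
  exists None => // A mA AU; rewrite integral0_eq ?measure_ge0// => w /AU [pw _].
  by rewrite pw.
pose J := abs_det G (closure (D i)) (fbar i) (theta i w0).
have pE : p i w0 = rho (theta i w0) / (J * rho w0) by [].
have [r1 J0 r0] : [/\ rho (theta i w0) != 0, J != 0 & rho w0 != 0].
  by move: p0; rewrite pE mulf_eq0 invr_eq0 mulf_eq0 !negb_or => /andP[? /andP[? ?]].
have JD : is_abs_det G (closure (D i)) (fbar i) (theta i w0) J.
  by rewrite /J /abs_det in J0 *; case: xgetP J0 => // _; rewrite eqxx.
have k1 : 1 < expR t by rewrite expR_gt1.
have [V [oV Vw HV]] := local_volume_stretch vol (@theta_continuous i) tD ft
  (@measurable_image_theta i) JD J0 k1.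
have pp : 0 < p i w0 by rewrite lt_neqAle eq_sym p0 branch_weight_ge0.
have rp : 0 < rho w0 by rewrite lt_neqAle eq_sym r0 rho0.
have r1p : 0 < rho (theta i w0) by rewrite lt_neqAle eq_sym r1 rho0.
have [j bw bV] := bb V w0 oV Vw.
have [a1 h1] := log_level_exists t0 pp.
have [a2 h2] := log_level_exists t0 rp.
have [a3 h3] := log_level_exists t0 r1p.
exists (Some (j, a1, a2, a3)) => // A mA AU.
have mthA := measurable_image_theta i mA.
rewrite -[leRHS]/(beta A) betaE//.
pose E (x : R) : R := expR (x * t).
have E0 x : 0 < E x by exact: expR_gt0.
have stretch : (m A <= (expR t ^+ 3 * J)%:E * m (theta i @` A))%E.
  by apply: HV => // w /AU [[/bV]].
have JE : J = rho (theta i w0) / (p i w0 * rho w0).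
  rewrite pE; field; rewrite J0 r0 /=.
  by rewrite r1.
have le1 : (\int[eta]_(w in A) (p i w)%:E <= (E (a1 + 1)%:~R)%:E * eta A)%E.
  apply: integral_le_cst => // w Aw; rewrite lee_fin; first exact: branch_weight_ge0.
  by have [[_ [/andP[_ /ltW]]]] := AU _ Aw.
have le2 : (eta A <= (E (a2 + 1)%:~R)%:E * m A)%E.
  rewrite etaE//; apply: integral_le_cst => // w Aw; rewrite lee_fin//.
  by have [[_ [_ [/andP[_ /ltW]]]]] := AU _ Aw.
have le3 : ((E a3%:~R)%:E * m (theta i @` A) <= eta (theta i @` A))%E.
  rewrite etaE//; apply: integral_ge_cst => //; first exact: ltW.
  move=> _ [w Aw <-]; rewrite lee_fin.
  by have [[_ [_ [_ /andP[]]]]] := AU _ Aw.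
have JU : J <= E (a3 + 1)%:~R / (E a1%:~R * E a2%:~R).
  move: h1 h2 h3; rewrite /log_level/= => /andP[h1 _] /andP[h2 _] /andP[_ h3].
  have prp : 0 < p i w0 * rho w0 by exact: mulr_gt0.
  have E12 : 0 < E a1%:~R * E a2%:~R by exact: mulr_gt0.
  rewrite JE; apply: ler_pM; [exact: ltW|by rewrite invr_ge0 ltW|exact: ltW|].
  rewrite lef_pV2 ?posrE//.
  by apply: ler_pM => //; exact: ltW.
apply: (le_trans le1).
apply: (@le_trans _ _ ((E (a1 + 1)%:~R * E (a2 + 1)%:~R * (expR t ^+ 3 * J))%:E * m (theta i @` A))%E).
  rewrite EFinM (EFinM (E _)) -!muleA; apply: lee_wpmul2l; first by rewrite lee_fin ltW.
  apply: le_trans le2 _; apply: lee_wpmul2l; first by rewrite lee_fin ltW.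
  exact: stretch.
apply: (@le_trans _ _ ((expR (6 * t) * E a3%:~R)%:E * m (theta i @` A))%E); last first.
  by rewrite EFinM -muleA; apply: lee_wpmul2l; rewrite ?lee_fin.
apply: lee_wpmul2r => //; rewrite lee_fin.
apply: (@le_trans _ _ (E (a1 + 1)%:~R * E (a2 + 1)%:~R *
   (expR t ^+ 3 * (E (a3 + 1)%:~R / (E a1%:~R * E a2%:~R))))).
  by rewrite !ler_wpM2l ?exprn_ge0 ?mulr_ge0 ?expR_ge0.
rewrite /E -expRM_natl -(expRD (a1%:~R * t)) -expRN -!expRD ler_expR !intrD.
lra.
Qed.

End branch.

(** * The transfer duality *)

Section integral_density.
Context {d : measure_display} {T : measurableType d} {R : realType}.
Variables (mu kap : {measure set T -> \bar R}) (w : T -> R).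
Hypothesis mw : measurable_fun setT w.
Hypothesis w0 : forall x, 0 <= w x.
Hypothesis kapE : forall A, measurable A -> kap A = (\int[mu]_(x in A) (w x)%:E)%E.

Import HBNNSimple.

Lemma integral_density_nnsfun (h : {nnsfun T >-> R}) :
  (\int[kap]_x (h x)%:E = \int[mu]_x ((h x)%:E * (w x)%:E))%E.
Proof.
rewrite integralT_nnsfun sintegralE.
have mA k : measurable (h @^-1` [set k]) by [].
transitivity (\sum_(k \in range h) \int[mu]_x ((k * \1_(h @^-1` [set k]) x)%:E * (w x)%:E))%E.
  apply: eq_fsbigr => k /[!inE] -[x _ hx].
  have k0 : 0 <= k by rewrite -hx.
  under eq_integral do rewrite EFinM -muleA.
  rewrite ge0_integralZl_EFin//; last 2 first.
  - by move=> y _; apply: mule_ge0 => //; rewrite lee_fin.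
  - by apply: emeasurable_funM => //; apply/measurable_EFinP.
  rewrite kapE// [in LHS]integral_mkcond; congr (_ * _)%E; apply: eq_integral => y _.
  by rewrite /patch indicE; case: ifP => _; rewrite ?mul1e ?mul0e.
have mEw : measurable_fun setT (EFin \o w) by exact/measurable_EFinP.
rewrite -ge0_integral_fsum//; last 2 first.
- move=> k; apply: emeasurable_funM => //; apply/measurable_EFinP.
  exact: measurable_funM.
- by move=> k x _; apply: mule_ge0; [exact: nnfun_muleindic_ge0|rewrite lee_fin].
apply: eq_integral => x _; rewrite -ge0_mule_fsuml; last first.
  by move=> k; exact: nnfun_muleindic_ge0.
by rewrite fsumEFin// -fimfunE.
Qed.

Lemma integral_density (h : T -> \bar R) : measurable_fun setT h -> (forall x, (0 <= h x)%E) ->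
  (\int[kap]_x h x = \int[mu]_x (h x * (w x)%:E))%E.
Proof.
move=> mh h0; pose f_ := nnsfun_approx measurableT mh.
transitivity (limn (fun n => \int[kap]_x (f_ n x)%:E))%E.
  rewrite -monotone_convergence//.
  - apply: eq_integral => y _; apply/esym/cvg_lim => //.
    by apply: cvg_nnsfun_approx => // *; exact: h0.
  - by move=> n; exact/measurable_EFinP/measurable_funP.
  - by move=> n y _; rewrite lee_fin.
  - by move=> y _ a b ab; rewrite lee_fin; exact/lefP/nd_nnsfun_approx.
rewrite (_ : (fun n => \int[kap]_x (f_ n x)%:E)%E =
    (fun n => \int[mu]_x ((f_ n x)%:E * (w x)%:E))%E); last first.
  by apply/funext => n; rewrite integral_density_nnsfun.
rewrite -monotone_convergence//.
- apply: eq_integral => y _; apply/cvg_lim => //.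
  apply: cvgeZr => //.
  by apply: cvg_nnsfun_approx => // *; exact: h0.
- move=> n; apply: emeasurable_funM; apply/measurable_EFinP => //.
- by move=> n y _; rewrite -EFinM lee_fin mulr_ge0.
- move=> y _ a b ab; rewrite -!EFinM lee_fin ler_wpM2r//.
  exact/lefP/nd_nnsfun_approx.
Qed.

End integral_density.

Lemma measure_mod_null {d : measure_display} {T : measurableType d} {R : realType}
    (mu : {measure set T -> \bar R}) (A B N : set T) :
  measurable A -> measurable B -> measurable N -> A `<=` B -> B `<=` A `|` N ->
  mu N = 0%E -> mu A = mu B.
Proof.
move=> mA mB mN AB BAN N0; apply/eqP; rewrite eq_le; apply/andP; split.
  by apply: le_measure; rewrite ?inE.
rewrite -[leRHS]adde0 -N0; apply: le_trans (measureU2 _ mA mN).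
by apply: le_measure; rewrite ?inE//; exact: measurableU.
Qed.

Section transfer.
Context {R : realType} {n N : nat} {d : measure_display} {Omega : borelMetricType d R}.
Variables (G : riemannianManifold n Omega) (m : {measure set Omega -> \bar R})
  (f : Omega -> Omega) (D : 'I_N -> set Omega) (fbar theta : 'I_N -> Omega -> Omega)
  (eta : probability Omega R) (rho : Omega -> R).
Hypothesis cpt : compact [set: Omega].
Hypothesis vol : riemannian_volume G m.
Hypothesis mf : measurable_fun setT f.
Hypothesis fb : full_branches G m f D fbar theta.
Hypothesis dens : equivalent_with_density m eta rho.
Hypothesis inv : invariant_measure f eta.

Let p := branch_weight G D fbar theta rho.
Hypothesis mp : forall i, measurable_fun setT (p i).
Hypothesis sum_p : {ae eta, forall w, \sum_(i < N) p i w = 1}.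

(** Summed over the branches, both sides give [eta B], so the inequalities
    between them are equalities. *)
Lemma branch_measureE i B : measurable B ->
  eta (D i `&` f @^-1` B) = (\int[eta]_(w in B) (p i w)%:E)%E.
Proof.
move=> mB.
have le j : (\int[eta]_(w in B) (p j w)%:E <= eta (D j `&` f @^-1` B))%E.
  exact: (integral_branch_weight_le cpt vol mf fb dens).
have p0 j w : 0 <= p j w by apply: branch_weight_ge0; exact: dens.
have mD j := measurable_fpre mf fb j mB.
have mU := measurable_branches fb.
have [oD tD _ _ _] := fb.
have tDB : trivIset setT (fun j => D j `&` f @^-1` B).
  exact: trivIset_setIr.
have sum1 : (\sum_(j < N) \int[eta]_(w in B) (p j w)%:E = eta B)%E.
  rewrite -ge0_integral_sum//; last 2 first.
  - by move=> j; apply/measurable_EFinP; exact: measurable_funTS.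
  - by move=> j w _; rewrite lee_fin.
  rewrite -[RHS]mul1e -integral_cst//.
  apply: ae_eq_integral => //.
  - apply: emeasurable_sum => j; apply/measurable_EFinP; exact: measurable_funTS.
  - by apply: filterS sum_p => w pw Bw; rewrite sumEFin pw.
have sum2 : (\sum_(j < N) eta (D j `&` f @^-1` B) = eta B)%E.
  rewrite -measure_bigsetU_ord// -bigcup_seq -(inv mB).
  have mDB : measurable (\bigcup_(j in [set` index_enum 'I_N]) (D j `&` f @^-1` B)).
    by apply: fin_bigcup_measurable => // j _; exact: mD.
  have mfB : measurable (f @^-1` B) by rewrite -[X in measurable X]setTI; exact: mf.
  apply: (measure_mod_null mDB mfB (measurableC mU)) => //.
  - by move=> w [j _ []].
  - move=> w fw; have [[j _ Dw]|nD] := pselect ((\bigcup_j D j) w); last by right.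
    by left; exists j => //=; exact: mem_index_enum.
  - exact: (eta_branches fb dens).
apply/eqP; rewrite eq_le le andbT leNgt; apply/negP => lt.
have : (\sum_(j < N) \int[eta]_(w in B) (p j w)%:E < \sum_(j < N) eta (D j `&` f @^-1` B))%E.
  rewrite (bigD1 i)//= [X in (_ < X)%E](bigD1 i)//=.
  apply: lte_leD => //; last by apply: lee_sum => j _; exact: le.
  apply/sum_fin_numP => j _ _.
  rewrite ge0_fin_numE; last by apply: integral_ge0 => w _; rewrite lee_fin.
  by apply: le_lt_trans (le j) _; rewrite ltey_eq fin_num_measure.
by rewrite sum1 sum2 ltxx.
Qed.

(** By [branch_measureE] the image under [f] of [eta] restricted to [D i] has
    density [p i]. Here [u i] is [F \o theta i] wherever [theta i] takes its
    value in [D i], and the rest is a null set. *)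
Lemma integral_transfer (F : Omega -> \bar R) (u : 'I_N -> Omega -> \bar R) :
  measurable_fun setT F -> (forall i, measurable_fun setT (u i)) ->
  (forall w, (0 <= F w)%E) -> (forall i w, (0 <= u i w)%E) ->
  (forall i w, D i w -> F w = u i (f w)) ->
  (\int[eta]_w F w = \int[eta]_w \sum_(i < N) (p i w)%:E * u i w)%E.
Proof.
move=> mF mu F0 u0 Fu.
have p0 j w : 0 <= p j w by apply: branch_weight_ge0; exact: dens.
have mD i := measurable_branch fb i.
have tr i : (\int[eta]_w ((p i w)%:E * u i w) = \int[eta]_w (u i (f w) * (\1_(D i) w)%:E))%E.
  rewrite -(@integral_density _ _ _ eta (mrestr eta (mD i)))//; last 2 first.
  - move=> A mA; rewrite /mrestr/= integral_indic//; congr (eta _); exact: setIC.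
  - by apply: (measurableT_comp (mu i)).
  rewrite -(integral_push_measure mf)//.
  rewrite (@integral_density _ _ _ eta _ (p i))//.
    by apply: eq_integral => w _; rewrite muleC.
  by move=> A mA; rewrite -branch_measureE// push_measureE/= /mrestr setIC.
rewrite ge0_integral_sum//; last 2 first.
- move=> i; apply: emeasurable_funM => //; exact/measurable_EFinP.
- by move=> i w _; apply: mule_ge0 => //; rewrite lee_fin.
under eq_bigr do rewrite tr.
have mI i : measurable_fun setT (fun w => (u i (f w) * (\1_(D i) w)%:E)%E).
  apply: emeasurable_funM; first exact: (measurableT_comp (mu i)).
  exact/measurable_EFinP.
rewrite -ge0_integral_sum//; last first.
  by move=> i w _; apply: mule_ge0 => //; rewrite lee_fin.
apply: ae_eq_integral => //; first by apply: emeasurable_sum.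
exists (~` \bigcup_i D i); split.
- by apply: measurableC; exact: (measurable_branches fb).
- exact: (eta_branches fb dens).
- apply: subsetC => w [i _ Dw] _.
  have [_ tD _ _ _] := fb.
  rewrite (bigD1 i)//= indicE mem_set// mule1 -Fu// big1 ?adde0// => j ji.
  rewrite indicE memNset ?mule0// => Djw; move/eqP: ji; apply.
  by apply: (tD j i) => //; exists w.
Qed.

End transfer.

(** * Cut-off functions and Wasserstein kernels *)

Section cutoff.
Context {R : realType} {Y : metricType R}.
Variable U : set Y.

(** Lipschitz approximations from below of the indicator of an open set; the
    added 1 bounds them and covers the case of the full space. *)
Definition cutoff (k : nat) (x : Y) : R :=
  inf ([set 1] `|` [set k%:R * mdist x y | y in ~` U]).

Let vals k x := [set 1] `|` [set k%:R * mdist x y | y in ~` U].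

Let vals0 k x : vals k x !=set0. Proof. by exists 1; left. Qed.

Let vals_lb k x : lbound (vals k x) 0.
Proof. by move=> _ [->//|[y _ <-]]; rewrite mulr_ge0// mdist_ge0. Qed.

Let has_lb k x : has_lbound (vals k x). Proof. by exists 0; exact: vals_lb. Qed.

Lemma cutoff_ge0 k x : 0 <= cutoff k x.
Proof. exact: (lb_le_inf (vals0 k x) (@vals_lb k x)). Qed.

Lemma cutoff_le1 k x : cutoff k x <= 1.
Proof. by apply: (ge_inf (has_lb k x)); left. Qed.

Lemma cutoff_out k x : ~ U x -> cutoff k x = 0.
Proof.
move=> Ux; apply/eqP; rewrite eq_le cutoff_ge0 andbT.
by apply: (ge_inf (has_lb k x)); right; exists x => //; rewrite mdistxx mulr0.
Qed.

Lemma cutoff_lip k x y : cutoff k x <= cutoff k y + k%:R * mdist x y.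
Proof.
rewrite -lerBlDr; apply: (lb_le_inf (vals0 k y)) => _ [->|[z Uz <-]]; rewrite lerBlDr.
  by rewrite (le_trans (cutoff_le1 k x))// lerDl mulr_ge0// mdist_ge0.
apply: (@le_trans _ _ (k%:R * mdist x z)).
  by apply: (ge_inf (has_lb k x)); right; exists z.
by rewrite -mulrDr ler_wpM2l// addrC metric_triangle.
Qed.

Lemma cutoff_nd x : {homo cutoff ^~ x : k l / (k <= l)%N >-> k <= l}.
Proof.
move=> k l kl; apply: (lb_le_inf (vals0 l x)) => _ [->|[z Uz <-]].
  exact: cutoff_le1.
apply: (@le_trans _ _ (k%:R * mdist x z)).
  by apply: (ge_inf (has_lb k x)); right; exists z.
by rewrite ler_wpM2r ?mdist_ge0// ler_nat.
Qed.

Lemma cutoff_eventually x : open U -> U x -> exists k0, forall k, (k0 <= k)%N -> cutoff k x = 1.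
Proof.
move=> oU Ux.
have /metric_nbhs[e e0 eU] := open_nbhs_nbhs (conj oU Ux).
exists (Num.bound e^-1) => k kk; apply/eqP; rewrite eq_le cutoff_le1/=.
apply: (lb_le_inf (vals0 k x)) => _ [->//|[z Uz <-]].
have xz : e <= mdist x z by rewrite leNgt; apply/negP => /eU.
apply: (@le_trans _ _ (k%:R * e)); last by rewrite ler_wpM2l.
rewrite -ler_pdivrMr// mul1r; apply: le_trans (ltW (archi_boundP _)) _.
  by rewrite invr_ge0 ltW.
by rewrite ler_nat.
Qed.

Lemma cutoff_cvg x : open U -> cutoff k x @[k --> \oo] --> (\1_U x : R).
Proof.
move=> oU; have [Ux|Ux] := pselect (U x); last first.
  rewrite indicE memNset//=.
  under eq_fun do rewrite cutoff_out//; exact: cvg_cst.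
have [k0 Hk] := cutoff_eventually oU Ux.
rewrite indicE mem_set//=; apply: cvg_near_cst.
by exists k0 => // k /= kk; rewrite Hk.
Qed.

Lemma cutoff_continuous k : continuous (cutoff k).
Proof.
move=> x P /nbhs_ballP[e /= e0 eP]; apply/metric_nbhs.
have k0 : 0 < k%:R + 1 :> R by rewrite ltr_wpDl.
exists (e / (k%:R + 1)); first by rewrite divr_gt0.
move=> y; rewrite ltr_pdivlMr// => xy; apply: eP; rewrite /ball/=.
have h : mdist x y * k%:R < e.
  by apply: le_lt_trans xy; rewrite ler_wpM2l ?mdist_ge0// lerDl.
have := cutoff_lip k x y; have := cutoff_lip k y x.
by rewrite (metric_sym y x) ltr_norml; lra.
Qed.

End cutoff.

(** Compact metric spaces are second countable, so an open set of the product
    is a countable union of open rectangles. *)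
Lemma open_prod_measurable {R : realType} {d d' : measure_display}
    {Y : borelMetricType d R} {Z : borelMetricType d' R} :
  compact [set: Y] -> compact [set: Z] ->
  forall O : set (Y * Z), open O -> measurable O.
Proof.
move=> cY cZ O oO.
have [b [ob bb]] := second_countable_sequence
  (@compact_second_countable R (Y : pseudoPMetricType R) cY).
have [c [oc cc]] := second_countable_sequence
  (@compact_second_countable R (Z : pseudoPMetricType R) cZ).
have -> : O = \bigcup_j \bigcup_k
    (if `[< b j `*` c k `<=` O >] then b j `*` c k else set0).
  rewrite eqEsubset; split => [[y z] Oyz|[y z] [j _ [k _]]]; last first.
    by case: ifPn => // /asboolP; apply.
  have [[A B] /= [nA nB] AB] := open_nbhs_nbhs (conj oO Oyz).
  have [j bj bA] := bb _ _ (open_interior A) nA.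
  have [k ck cB] := cc _ _ (open_interior B) nB.
  exists j => //; exists k => //; rewrite asboolT//.
  move=> [u v] [/= /bA uA /cB vB]; apply: AB; split => /=; exact: interior_subset.
apply: bigcupT_measurable => j; apply: bigcupT_measurable => k.
case: ifP => // _; apply: measurableX; exact: borel_metric_open.
Qed.

Lemma mdist_continuous {R : realType} {Y : metricType R} :
  continuous (fun z : Y * Y => mdist z.1 z.2).
Proof.
move=> [x y] P /nbhs_ballP[e /= e0 eP].
exists ([set x' | mdist x x' < e / 2], [set y' | mdist y y' < e / 2]) => /=.
  by split; apply/metric_nbhs; exists (e / 2) => //; rewrite divr_gt0.
move=> [x' y'] [/= xx yy]; apply: eP; rewrite /ball/=.
have := metric_triangle x x' y; have := metric_triangle x' y' y.
have := metric_triangle x' x y'; have := metric_triangle x y y'.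
rewrite (metric_sym x' x) (metric_sym y' y) ltr_norml => ? ? ? ?.
by apply/andP; split; lra.
Qed.

Section borel_metric_integrals.
Context {R : realType} {d : measure_display} {Y : borelMetricType d R}.

Lemma integral_cutoff_cvg (P : {measure set Y -> \bar R}) (U : set Y) : open U ->
  (\int[P]_x (cutoff U k x)%:E)%E @[k --> \oo] --> P U.
Proof.
move=> oU.
have mU := borel_metric_open oU.
rewrite -[P U](_ : (\int[P]_x (\1_U x)%:E = _)%E); last by rewrite integral_indic// setIT.
have -> : (\int[P]_x (\1_U x)%:E)%E = (\int[P]_x limn (fun k => (cutoff U k x)%:E))%E.
  apply: eq_integral => x _; apply/esym/cvg_lim => //.
  by apply: cvg_EFin; [exact: nearW|exact: cutoff_cvg].
apply: cvg_monotone_convergence => //.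
- move=> k; apply/measurable_EFinP; apply: continuous_measurable_realfun.
    exact: borel_metric_open.
  exact: cutoff_continuous.
- by move=> k x _; rewrite lee_fin cutoff_ge0.
- by move=> x _ k l kl; rewrite lee_fin cutoff_nd.
Qed.

Lemma measurable_cutoff U k : measurable_fun setT (fun x : Y => (cutoff U k x)%:E).
Proof.
apply/measurable_EFinP; apply: continuous_measurable_realfun.
  exact: borel_metric_open.
exact: cutoff_continuous.
Qed.

(** Lipschitz functions have [W1]-continuous integrals, and the measure of an
    open set is a supremum of such integrals. *)
Lemma W1_open_gt (U : set Y) (a : R) : compact [set: Y] -> open U ->
  W1_open [set P : probability Y R | (a%:E < P U)%E].
Proof.
move=> cY oU P /= aP.
have mU := borel_metric_open oU.
have [k ak] : exists k, (a%:E < \int[P]_x (cutoff U k x)%:E)%E.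
  have nb : nbhs (P U) [set z | (a%:E < z)%E].
    by apply: open_nbhs_nbhs; split => //; exact: open_ereal_gt_ereal.
  by have [k _ /(_ k (leqnn _))] := integral_cutoff_cvg oU nb; exists k.
have cle (Q : probability Y R) : (\int[Q]_x (cutoff U k x)%:E <= Q U)%E.
  rewrite -[leRHS](_ : (\int[Q]_x (\1_U x)%:E = _)%E); last by rewrite integral_indic// setIT.
  apply: ge0_integral_monotone => x _; rewrite lee_fin ?cutoff_ge0// indicE.
  have [Ux|Ux] := pselect (U x); first by rewrite mem_set// cutoff_le1.
  by rewrite memNset// cutoff_out.
have fin : (\int[P]_x (cutoff U k x)%:E)%E \is a fin_num.
  rewrite ge0_fin_numE; last by apply: integral_ge0 => x _; rewrite lee_fin cutoff_ge0.
  by apply: le_lt_trans (cle P) _; rewrite ltey_eq fin_num_measure.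
set I := (\int[P]_x _)%E in ak fin.
have k0 : 0 < k%:R + 1 :> R by rewrite ltr_wpDl.
rewrite -(fineK fin) lte_fin in ak.
exists ((fine I - a) / (k%:R + 1)); split; first by rewrite divr_gt0// subr_gt0.
move=> Q /ereal_inf_lt [_ [pi [cpl ->]]] piI.
have m1 : measurable_fun setT (fst : Y * Y -> Y) := measurable_fst.
have m2 : measurable_fun setT (snd : Y * Y -> Y) := measurable_snd.
have mc := measurable_cutoff U k.
have md : measurable_fun setT (fun z : Y * Y => (mdist z.1 z.2)%:E).
  apply/measurable_EFinP; apply: continuous_measurable_realfun; last exact: mdist_continuous.
  exact: open_prod_measurable.
have c0 (x : Y) : (0 <= (cutoff U k x)%:E)%E by rewrite lee_fin cutoff_ge0.
have IE : I = (\int[pi]_z (cutoff U k z.1)%:E)%E.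
  rewrite -(integral_push_measure m1 pi mc c0).
  apply: eq_measure_integral => A mA _; have [h _] := cpl A mA.
  change (P A = pi (fst @^-1` A)); rewrite -h; congr (pi _).
  by apply/seteqP; split => [z []|z].
have JE : (\int[Q]_x (cutoff U k x)%:E = \int[pi]_z (cutoff U k z.2)%:E)%E.
  rewrite -(integral_push_measure m2 pi mc c0).
  apply: eq_measure_integral => A mA _; have [_ h] := cpl A mA.
  change (Q A = pi (snd @^-1` A)); rewrite -h; congr (pi _).
  by apply/seteqP; split => [z []|z].
have le1 : (I <= \int[Q]_x (cutoff U k x)%:E + k%:R%:E * \int[pi]_z (mdist z.1 z.2)%:E)%E.
  rewrite IE JE -ge0_integralZl_EFin//; last by move=> z _; rewrite lee_fin mdist_ge0.
  have mc2 : measurable_fun setT (fun z : Y * Y => (cutoff U k z.2)%:E) by exact: (measurableT_comp mc m2).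
  have mkd : measurable_fun setT (fun z : Y * Y => (k%:R%:E * (mdist z.1 z.2)%:E)%E).
    exact: measurable_funeM.
  have kd0 (z : Y * Y) : setT z -> (0 <= k%:R%:E * (mdist z.1 z.2)%:E)%E.
    by rewrite -EFinM lee_fin mulr_ge0// mdist_ge0.
  rewrite -ge0_integralD//.
  apply: ge0_integral_monotone => z _ //.
  by rewrite -EFinM -EFinD lee_fin cutoff_lip.
rewrite /=; apply: lt_le_trans (cle Q).
have finQ : (\int[Q]_x (cutoff U k x)%:E)%E \is a fin_num.
  rewrite ge0_fin_numE; last by apply: integral_ge0 => x _; rewrite lee_fin cutoff_ge0.
  by apply: le_lt_trans (cle Q) _; rewrite ltey_eq fin_num_measure.
have d0 : (0 <= \int[pi]_z (mdist z.1 z.2)%:E)%E.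
  by apply: integral_ge0 => z _; rewrite lee_fin mdist_ge0.
have fpi : (\int[pi]_z (mdist z.1 z.2)%:E)%E \is a fin_num.
  by rewrite ge0_fin_numE//; apply: lt_trans piI (ltry _).
move: le1 piI d0; rewrite -(fineK fin) -(fineK finQ) -(fineK fpi) -EFinM -EFinD.
rewrite !lee_fin !lte_fin ltr_pdivlMr//.
set u := fine _; set v := fine (\int[pi]_z _)%E => h1 /= h2 h3; nra.
Qed.

End borel_metric_integrals.

Section kernel_of_W1.
Context {R : realType} {dO dX : measure_display}
  {Omega : borelMetricType dO R} {X : borelMetricType dX R}.
Variable nu : Omega -> probability X R.
Hypothesis cX : compact [set: X].
Hypothesis mnu : W1_measurable nu.

(** [W1_open_gt] settles open sets, and Dynkin's theorem the other Borel sets. *)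
Lemma W1_measurable_kernel (A : set X) : measurable A ->
  measurable_fun setT (fun w => nu w A).
Proof.
rewrite borel_measurableE; move: A; apply: (@dynkin_induction _ X (@open X) (fun A => measurable_fun setT (fun w => nu w A))).
- exact: borel_measurableE.
- by move=> A B; exact: openI.
- rewrite (_ : (fun w => nu w setT) = cst 1%E)//.
  by apply/funext => w; rewrite probability_setT.
- move=> U oU; apply: (measurability _ (ErealGenOInfty.measurableE R)).
  move=> _ [_ [a ->] <-]; rewrite setTI.
  have := mnu (W1_open_gt (a := a) cX oU).
  congr measurable; apply/seteqP; split => w /=; rewrite in_itv/= andbT//.
- move=> S mS HS; rewrite (_ : (fun w => nu w (~` S)) = (fun w => 1 - nu w S)%E); last first.
    by apply/funext => w; rewrite probability_setC.
  exact: emeasurable_funB.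
- move=> F mF tF HF.
  rewrite (_ : (fun w => nu w (\bigcup_k F k)) = (fun w => \sum_(0 <= k <oo) nu w (F k))%E).
    by apply: ge0_emeasurable_sum.
  by apply/funext => w; rewrite measure_semi_bigcup//; exact: bigcup_measurable.
Qed.

Lemma measurable_kernel_xsection (B : set (Omega * X)) : measurable B ->
  measurable_fun setT (fun w => nu w (xsection B w)).
Proof.
pose C := [set A `*` B | A in @measurable _ Omega & B in @measurable _ X].
rewrite measurable_prod_measurableType; move: B; apply: (@dynkin_induction _ (Omega * X)%type C
  (fun B => measurable_fun setT (fun w => nu w (xsection B w)))).
- exact: measurable_prod_measurableType.
- move=> _ _ [A1 mA1 [B1 mB1 <-]] [A2 mA2 [B2 mB2 <-]].
  by exists (A1 `&` A2); [exact: measurableI|exists (B1 `&` B2); [exact: measurableI|rewrite setXI]].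
- rewrite (_ : (fun w => _) = cst 1%E)//.
  by apply/funext => w; rewrite xsectionE preimage_setT probability_setT.
- move=> _ [A mA [B mB <-]].
  rewrite (_ : (fun w => _) = (fun w => (\1_A w)%:E * nu w B)%E).
    by apply: emeasurable_funM; [exact/measurable_EFinP|exact: W1_measurable_kernel].
  apply/funext => w; rewrite indicE; have [Aw|Aw] := pselect (A w).
    by rewrite mem_set// in_xsectionX ?mem_set// mul1e.
  by rewrite memNset// notin_xsectionX ?memNset// measure0 mul0e.
- move=> S mS HS; rewrite (_ : (fun w => _) = (fun w => 1 - nu w (xsection S w))%E).
    exact: emeasurable_funB.
  apply/funext => w; rewrite -probability_setC; last exact: measurable_xsection.
  by rewrite !xsectionE preimage_setC.
- move=> F mF tF HF.
  rewrite (_ : (fun w => _) = (fun w => \sum_(0 <= k <oo) nu w (xsection (F k) w))%E).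
    by apply: ge0_emeasurable_sum.
  apply/funext => w; rewrite xsection_bigcup measure_semi_bigcup//.
  - by move=> k; exact: measurable_xsection.
  - exact: trivIset_xsection.
  - by apply: bigcup_measurable => k _; exact: measurable_xsection.
Qed.

End kernel_of_W1.

(** * Time averages *)

Section compact_functions.
Context {R : realType} {Y : pseudoMetricType R}.
Hypothesis cY : compact [set: Y].

Lemma compact_uniform_continuity (phi : Y -> R) (e : R) : continuous phi -> 0 < e ->
  exists2 dl : R, 0 < dl & forall x y, ball x dl y -> `|phi x - phi y| < e.
Proof.
move=> cphi e0.
have /compact_near_coveringP cov := cY.
have H : \forall dl \near (0 : R)^'+, [set: Y] `<=` (fun x => forall y, ball x dl y -> `|phi x - phi y| < e).
  apply: (cov _ _ (fun dl x => forall y, ball x dl y -> `|phi x - phi y| < e)) => x _.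
  have e20 : 0 < e / 2 by rewrite divr_gt0.
  have /nbhs_ballP[r /= r0 Hr] := cphi x _ (nbhsx_ballx (phi x) (e / 2) e20).
  have r20 : 0 < r / 2 by rewrite divr_gt0.
  exists (ball x (r / 2), [set dl : R | dl < r / 2]).
    split => /=; first exact: nbhsx_ballx.
    exact: nbhs_right_lt.
  move=> [x' dl] [/= xx' dlr] y x'y.
  have h1 : `|phi x - phi x'| < e / 2.
    by apply: Hr; apply: le_ball xx'; lra.
  have h2 : `|phi x - phi y| < e / 2.
    apply: Hr; rewrite (splitr r); apply: ball_triangle xx' _.
    by apply: le_ball x'y; exact: ltW.
  rewrite (_ : phi x' - phi y = (phi x - phi y) - (phi x - phi x')); last by ring.
  by apply: le_lt_trans (ler_normB _ _) _; rewrite (splitr e) ltrD.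
have [dl [dl0 Hdl]] : exists dl : R, 0 < dl /\ [set: Y] `<=` (fun x => forall y, ball x dl y -> `|phi x - phi y| < e).
  near (0 : R)^'+ => dl; exists dl; split => //.
  by near: dl.
by exists dl => // x y; exact: Hdl.
Unshelve. all: by end_near. Qed.

Lemma compact_continuous_bounded (phi : Y -> R) : continuous phi ->
  exists2 K : R, 0 < K & forall x, `|phi x| <= K.
Proof.
move=> cphi.
have : bounded_set (phi @` [set: Y]).
  apply: compact_bounded; apply: continuous_compact => //.
  exact: continuous_subspaceT.
move=> [K [_ HK]]; exists (Num.max K 0 + 1); first by rewrite ltr_wpDl// le_max lexx orbT.
move=> x; apply: (HK (Num.max K 0 + 1)); last by exists x.
by rewrite (le_lt_trans (y := Num.max K 0))// ?ltrDl// le_max lexx.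
Qed.

End compact_functions.

Section averages.
Context {R : realType}.
Implicit Types u v e : nat -> R.

Definition avg u (n : nat) : R := n%:R^-1 * \sum_(i < n) u i.

Lemma avgD u v n : avg (fun i => u i + v i) n = avg u n + avg v n.
Proof. by rewrite /avg big_split/= mulrDr. Qed.

Lemma avgN u n : avg (fun i => - u i) n = - avg u n.
Proof. by rewrite /avg sumrN mulrN. Qed.

Lemma avg_le u v n : (forall i, u i <= v i) -> avg u n <= avg v n.
Proof. by move=> uv; rewrite /avg ler_wpM2l ?invr_ge0// ler_sum. Qed.

Lemma avg_norm_le u e n : (forall i, `|u i| <= e i) -> `|avg u n| <= avg e n.
Proof.
move=> ue; rewrite ler_norml -avgN; apply/andP; split; apply: avg_le => i;
  by have := ue i; rewrite ler_norml => /andP[].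
Qed.

Lemma avg_cst (c : R) n : avg (fun=> c) n.+1 = c.
Proof.
by rewrite /avg sumr_const card_ord -[c *+ _]mulr_natl mulrA mulVf ?mul1r// pnatr_eq0.
Qed.

Lemma avg_cst_cvg (c : R) : avg (fun=> c) n @[n --> \oo] --> c.
Proof.
apply: cvg_near_cst; exists 1%N => // n /= n1.
by rewrite -(prednK n1) avg_cst.
Qed.

(** A shift by one changes the average by [(u n - u 0) / n]. *)
Lemma avg_shift_cvg u K k : (forall i, `|u i| <= K) ->
  (avg (fun i => u (i + k)%N) n - avg u n) @[n --> \oo] --> (0 : R).
Proof.
elim: k u => [|k IH] u uK.
  under eq_fun do (under [X in avg X]eq_fun do rewrite addn0); under eq_fun do rewrite subrr.
  exact: cvg_cst.
have c1 : (avg (fun i => u i.+1) n - avg u n) @[n --> \oo] --> (0 : R).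
  have -> : (fun n => avg (fun i => u i.+1) n - avg u n) = (fun n => n%:R^-1 * (u n - u 0%N)).
    apply/funext => n; rewrite /avg -mulrBr; congr (_ * _).
    elim: n => [|n IHn]; first by rewrite !big_ord0 !subrr.
    rewrite !big_ord_recr/= (_ : _ - _ = (\sum_(i < n) u i.+1 - \sum_(i < n) u i) + (u n.+1 - u n)).
      by rewrite IHn; ring.
    by ring.
  apply/cvgrPdist_le => e e0.
  have K0 : 0 <= K by apply: le_trans (uK 0%N).
  exists (Num.bound (2 * K / e)) => // n /= nb.
  rewrite sub0r normrN normrM normfV.
  have [->|n0] := eqVneq n 0%N; first by rewrite mulr0n normr0 invr0 mul0r ltW.
  have np : 0 < n%:R :> R by rewrite ltr0n lt0n.
  rewrite (gtr0_norm np) mulrC ler_pdivrMr//.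
  have h : `|u n - u 0%N| <= 2 * K.
    by apply: le_trans (ler_normB _ _) _; have := uK n; have := uK 0%N; lra.
  apply: le_trans h _; rewrite [leRHS]mulrC -ler_pdivrMr//.
  apply: le_trans (ltW (archi_boundP _)) _; first by rewrite divr_ge0 ?mulr_ge0// ltW.
  by rewrite ler_nat.
have c2 := IH (fun i => u i.+1) (fun i => uK i.+1).
rewrite -(addr0 (0 : R)).
have -> : (fun n => avg (fun i => u (i + k.+1)%N) n - avg u n) =
    (fun n => (avg (fun i => u (i + k).+1) n - avg (fun i => u i.+1) n) +
              (avg (fun i => u i.+1) n - avg u n)).
  apply/funext => n; rewrite addrA subrK; congr (avg _ n - _).
  by apply/funext => i; rewrite addnS.
exact: cvgD c2 c1.
Qed.

(** Averages of [u] may be computed from those of a sequence [v] that is close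
    to a shift of [u] on average. *)
Lemma avg_approx u (K I : R) : (forall i, `|u i| <= K) ->
  (forall eps : R, 0 < eps -> exists (k : nat) (v e : nat -> R) (lv le : R),
    [/\ forall i, `|u (i + k)%N - v i| <= e i, avg v n @[n --> \oo] --> lv,
        avg e n @[n --> \oo] --> le, `|lv - I| <= eps & le <= eps]) ->
  avg u n @[n --> \oo] --> I.
Proof.
move=> uK H; apply/cvgrPdist_le => e0 e00.
have e50 : 0 < e0 / 5 by rewrite divr_gt0.
have [k [v [e [lv [le [uv cv ce lvI lee]]]]]] := H _ e50.
have c1 := @avg_shift_cvg u K k uK.
near=> n.
have h1 : `|0 - (avg (fun i => u (i + k)%N) n - avg u n)| <= e0 / 5.
  by near: n; move/cvgrPdist_le : c1; apply.
have h2 : `|lv - avg v n| <= e0 / 5 by near: n; move/cvgrPdist_le : cv; apply.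
have h3 : `|le - avg e n| <= e0 / 5 by near: n; move/cvgrPdist_le : ce; apply.
have h4 : `|avg (fun i => u (i + k)%N) n - avg v n| <= avg e n.
  by rewrite -avgN -avgD; apply: avg_norm_le.
move: h1 h2 h3 h4 lvI; rewrite !ler_norml => /andP[? ?] /andP[? ?] /andP[? ?] /andP[? ?] /andP[? ?].
by apply/andP; split; lra.
Unshelve. all: by end_near. Qed.

End averages.

(** * Bounded test functions and empirical measures *)

Definition bounded_measurable {d : measure_display} {T : measurableType d} {R : realType}
    (h : T -> R) : Prop :=
  measurable_fun setT h /\ exists K : R, forall x, `|h x| <= K.

Section bounded_measurable.
Context {d : measure_display} {T : measurableType d} {R : realType}.
Implicit Types (P : probability T R) (h k e : T -> R).

Lemma bounded_measurable_integrable P h (A : set T) : measurable A -> bounded_measurable h ->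
  P.-integrable A (EFin \o h).
Proof.
move=> mA [mh [K hK]]; apply: measurable_bounded_integrable => //.
- by rewrite ltey_eq fin_num_measure.
- exact: measurable_funTS.
- exists K; split => [|M KM x _ /=]; first exact: num_real.
  by apply: le_trans (hK x) _; exact: ltW.
Qed.

Lemma bounded_measurable_cst (c : R) : bounded_measurable (fun _ : T => c).
Proof. by split => //; exists `|c|. Qed.

Lemma bounded_measurableD h k : bounded_measurable h -> bounded_measurable k ->
  bounded_measurable (fun x => h x + k x).
Proof.
move=> [mh [K hK]] [mk [L kL]]; split; first exact: measurable_funD.
by exists (K + L) => x; apply: le_trans (ler_normD _ _) _; rewrite lerD.
Qed.

Lemma bounded_measurableM h k : bounded_measurable h -> bounded_measurable k ->
  bounded_measurable (fun x => h x * k x).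
Proof.
move=> [mh [K hK]] [mk [L kL]]; split; first exact: measurable_funM.
by exists (K * L) => x; rewrite normrM ler_pM.
Qed.

Lemma bounded_measurableN h : bounded_measurable h -> bounded_measurable (fun x => - h x).
Proof.
move=> [mh [K hK]]; split; last by exists K => x; rewrite normrN.
exact: measurableT_comp.
Qed.

Lemma bounded_measurableB h k : bounded_measurable h -> bounded_measurable k ->
  bounded_measurable (fun x => h x - k x).
Proof. by move=> bh bk; apply: bounded_measurableD => //; exact: bounded_measurableN. Qed.

Lemma bounded_measurable_sum (I : Type) (s : seq I) (h : I -> T -> R) :
  (forall i, bounded_measurable (h i)) -> bounded_measurable (fun x => \sum_(i <- s) h i x).
Proof.
move=> bh; elim: s => [|i s IH].
  rewrite (_ : (fun x => _) = (fun=> 0)); first exact: bounded_measurable_cst.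
  by apply/funext => x; rewrite big_nil.
rewrite (_ : (fun x => _) = (fun x => h i x + \sum_(i <- s) h i x)).
  exact: bounded_measurableD.
by apply/funext => x; rewrite big_cons.
Qed.

Lemma bounded_measurable_comp {d' : measure_display} {T' : measurableType d'} h (S : T' -> T) :
  bounded_measurable h -> measurable_fun setT S -> bounded_measurable (h \o S).
Proof. by move=> [mh [K hK]] mS; split; [exact: measurableT_comp|exists K => x /=]. Qed.

Lemma Rintegral_close P h k e : bounded_measurable h -> bounded_measurable k ->
  bounded_measurable e -> (forall x, `|h x - k x| <= e x) ->
  `|\int[P]_x h x - \int[P]_x k x| <= \int[P]_x e x.
Proof.
move=> bh bk be hke; have int := fun g bg => @bounded_measurable_integrable P g setT measurableT bg.
have bhk := bounded_measurableB bh bk.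
rewrite -RintegralB//; [|exact: int|exact: int].
apply: le_trans (le_normr_Rintegral _ (int _ bhk)) _ => //.
apply: le_Rintegral => //; [|exact: int].
apply: int; have [m1 [K HK]] := bhk; split; last by exists K => x; rewrite normr_id.
exact: measurableT_comp.
Qed.

Lemma Rintegral_prob_cst P (c : R) : \int[P]_x c = c.
Proof. by rewrite Rintegral_cst// -[X in c * fine X]/(P setT) probability_setT mulr1. Qed.

End bounded_measurable.

Lemma Rintegral_invariant {d d' : measure_display} {T : measurableType d}
    {T' : measurableType d'} {R : realType} (P : probability T R)
    (P' : probability T' R) (S : T -> T') (h : T' -> R) : measurable_fun setT S ->
  (forall A, measurable A -> P' A = P (S @^-1` A)) -> bounded_measurable h ->
  \int[P']_x h x = \int[P]_x h (S x).
Proof.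
move=> mS PP' bh; rewrite /Rintegral; congr fine.
have bhS := bounded_measurable_comp bh mS.
have mh : measurable_fun setT (EFin \o h) by apply/measurable_EFinP; case: bh.
have intS : P.-integrable (S @^-1` setT) ((EFin \o h) \o S).
  by rewrite preimage_setT; exact: (bounded_measurable_integrable P measurableT bhS).
have := integral_pushforward mS mh intS measurableT; rewrite preimage_setT /= => <-.
by apply: eq_measure_integral => A mA _; exact: PP'.
Qed.

Section empirical.
Context {R : realType} {d : measure_display} {M : topMeasurableType d}.
Variables (S : M -> M).

Lemma integral_empirical_ge0 x j (h : M -> \bar R) : measurable_fun setT h ->
  (forall y, (0 <= h y)%E) ->
  (\int[empirical S x j]_y h y = (j%:R^-1)%:E * \sum_(i < j) h (iter i S x))%E.
Proof.
move=> mh h0; rewrite ge0_integral_mscale// ge0_integral_measure_sum//.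
by congr (_ * _)%E; apply: eq_bigr => i _; rewrite integral_dirac// diracT mul1e.
Qed.

Lemma integral_empirical x j (h : M -> R) : measurable_fun setT h ->
  \int[empirical S x j]_y h y = avg (fun i => h (iter i S x)) j.
Proof.
move=> mh; rewrite /Rintegral integralE.
have mE : measurable_fun setT (EFin \o h) by exact/measurable_EFinP.
rewrite !integral_empirical_ge0//; [|exact: measurable_funeneg|exact: measurable_funepos].
rewrite (eq_bigr (fun i : 'I_j => (Num.max (h (iter i S x)) 0)%:E)); last first.
  by move=> i _; rewrite funeposE/= EFin_max.
rewrite [X in (_ - _ * X)%E](eq_bigr (fun i : 'I_j => (Num.max (- h (iter i S x)) 0)%:E)); last first.
  by move=> i _; rewrite funenegE/= EFin_max.
rewrite !sumEFin -!EFinM -EFinB /= /avg -mulrBr -sumrB; congr (_ * _).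
apply: eq_bigr => i _; case: (leP 0 (h (iter i S x))) => hi.
  by rewrite max_r ?subr0// oppr_le0.
by rewrite max_l ?sub0r ?opprK// oppr_ge0 ltW.
Qed.

Lemma weak_star_empirical x (zeta : probability M R) :
  (forall O : set M, open O -> measurable O) ->
  basin S zeta x <-> forall phi : M -> R, continuous phi ->
    avg (fun i => phi (iter i S x)) n @[n --> \oo] --> \int[zeta]_y phi y.
Proof.
move=> oM; split=> H phi cphi; have := H phi cphi; rewrite /weak_star_cvg;
  have mphi := continuous_measurable_realfun oM cphi;
  (have -> : (fun j => \int[empirical S x j]_y phi y) = avg (fun i => phi (iter i S x))
    by apply/funext => j; rewrite integral_empirical) => //.
Qed.

End empirical.

(** * Measures determined by continuous functions *)

Section bounded_convergence.
Context {d : measure_display} {T : measurableType d} {R : realType}.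
Implicit Types (P Q : probability T R).

Lemma Rintegral_bounded_cvg P (D : set T) (h_ : nat -> T -> R) (h : T -> R) (K : R) :
  measurable D -> (forall n, measurable_fun setT (h_ n)) -> (forall n x, `|h_ n x| <= K) ->
  bounded_measurable h -> (forall x, D x -> h_ n x @[n --> \oo] --> h x) ->
  \int[P]_(x in D) h_ n x @[n --> \oo] --> \int[P]_(x in D) h x.
Proof.
move=> mD mh hK bh hh.
have mE n : measurable_fun D (EFin \o h_ n) by apply/measurable_EFinP; exact: measurable_funTS.
have mEh : measurable_fun D (EFin \o h).
  by apply/measurable_EFinP; apply: measurable_funTS; case: bh.
have iK : P.-integrable D (EFin \o fun=> K).
  by apply: bounded_measurable_integrable => //; exact: bounded_measurable_cst.
have cvD : {ae P, forall x, D x -> (EFin \o h_ n) x @[n --> \oo] --> (EFin \o h) x}.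
  apply: aeW => x Dx; apply: cvg_EFin; [exact: nearW|exact: hh].
have bD : {ae P, forall x n, D x -> (`|(EFin \o h_ n) x| <= (EFin \o fun=> K) x)%E}.
  by apply: aeW => x n _ /=; rewrite lee_fin.
have [_ _ cv] := dominated_convergence mD mE mEh cvD iK bD.
have fn : (\int[P]_(x in D) (h x)%:E)%E \is a fin_num.
  by apply: integrable_fin_num => //; exact: bounded_measurable_integrable.
apply: fine_cvg; rewrite fineK//.
Qed.

(** Bounded convergence identifies the measures on [G], and Dynkin's theorem on
    the sigma-algebra that [G] generates. *)
Lemma probability_eq_tests P Q (G : set (set T)) : @measurable _ T = <<s G >> -> setI_closed G ->
  (forall U, G U -> exists h : nat -> T -> R, [/\ forall n, measurable_fun setT (h n),
     forall n x, `|h n x| <= 1, forall x, h n x @[n --> \oo] --> (\1_U x : R) &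
     forall n, \int[P]_x h n x = \int[Q]_x h n x]) ->
  forall A, measurable A -> P A = Q A.
Proof.
move=> mG GI HG.
have GPQ U : G U -> P U = Q U.
  move=> GU; have [h [mh h1 hU hPQ]] := HG U GU.
  have mU : measurable U by rewrite mG; exact: sub_sigma_algebra.
  have bU : bounded_measurable (\1_U : T -> R).
    split; first exact: measurable_indic.
    by exists 1 => x; rewrite indicE; case: (_ \in _); rewrite ?normr1 ?normr0.
  have cP := @Rintegral_bounded_cvg P setT h \1_U 1 measurableT mh h1 bU (fun x _ => hU x).
  have cQ := @Rintegral_bounded_cvg Q setT h \1_U 1 measurableT mh h1 bU (fun x _ => hU x).
  have : \int[P]_x (\1_U x : R) = \int[Q]_x (\1_U x : R).
    have E : (fun n => \int[P]_x h n x) = (fun n => \int[Q]_x h n x) by exact/funext.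
    by rewrite E in cP; exact: (cvg_unique _ cP cQ).
  rewrite /Rintegral !integral_indic// !setIT => e.
  have fP : P U \is a fin_num by rewrite fin_num_measure.
  have fQ : Q U \is a fin_num by rewrite fin_num_measure.
  by rewrite -(fineK fP) e fineK.
rewrite mG; apply: (@dynkin_induction _ T G (fun A => P A = Q A)) => //.
- by rewrite !probability_setT.
- by move=> S mS PQ; rewrite !probability_setC// PQ.
- move=> F mF tF PQ; have mUF : measurable (\bigcup_k F k) by exact: bigcup_measurable.
  rewrite !measure_semi_bigcup//.
  by apply: eq_eseriesr => k _; exact: PQ.
Qed.

End bounded_convergence.

Section tests.
Context {R : realType} {dY dZ : measure_display}
  {Y : borelMetricType dY R} {Z : borelMetricType dZ R}.

Lemma cutoff_norm_le1 (U : set Y) k x : `|cutoff U k x| <= 1.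
Proof. by rewrite ger0_norm ?cutoff_ge0 ?cutoff_le1. Qed.

Lemma measurable_fun_cutoff (U : set Y) k : measurable_fun setT (cutoff U k).
Proof. by have /measurable_EFinP := @measurable_cutoff R dY Y U k. Qed.

Lemma probability_eq_continuous (P Q : probability Y R) :
  (forall phi : Y -> R, continuous phi -> \int[P]_x phi x = \int[Q]_x phi x) ->
  forall A, measurable A -> P A = Q A.
Proof.
move=> PQ; apply: (@probability_eq_tests _ _ _ P Q open).
- exact: borel_measurableE.
- by move=> A B; exact: openI.
- move=> U oU; exists (cutoff U); split.
  + exact: measurable_fun_cutoff.
  + exact: cutoff_norm_le1.
  + by move=> x; exact: cutoff_cvg.
  + by move=> n; apply: PQ; exact: cutoff_continuous.
Qed.

(** A function that is only continuous on an open set of full measure is tested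
    by its products with the cut-off functions of that set. *)
Lemma generic_avg_open (zeta : probability Y R) (o : nat -> Y) (U : set Y) (h : Y -> R) :
  (forall phi : Y -> R, continuous phi ->
     avg (fun i => phi (o i)) n @[n --> \oo] --> \int[zeta]_y phi y) ->
  open U -> zeta (~` U) = 0%E -> bounded_measurable h ->
  (forall x, U x -> {for x, continuous h}) ->
  avg (fun i => h (o i)) n @[n --> \oo] --> \int[zeta]_y h y.
Proof.
move=> gen oU zU bh ch; have [mh [K0 hK0]] := bh.
pose K := `|K0| + 1; have Kp : 0 < K by rewrite ltr_wpDl.
have hK x : `|h x| <= K.
  by apply: le_trans (hK0 x) _; apply: le_trans (ler_norm _) _; rewrite lerDl.
apply: (@avg_approx _ _ K) => // eps eps0.
have bc k : bounded_measurable (cutoff U k).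
  by split; [exact: measurable_fun_cutoff|exists 1 => x; exact: cutoff_norm_le1].
have bK k : bounded_measurable (fun x => K * (1 - cutoff U k x)).
  apply: bounded_measurableM; first exact: bounded_measurable_cst.
  by apply: bounded_measurableB => //; exact: bounded_measurable_cst.
have [j Hj] : exists j, \int[zeta]_y (K * (1 - cutoff U j y)) <= eps.
  have mU : measurable U := borel_metric_open oU.
  have bU : bounded_measurable (fun y => K * (1 - \1_U y)).
    apply: bounded_measurableM; first exact: bounded_measurable_cst.
    apply: bounded_measurableB; first exact: bounded_measurable_cst.
    split; first exact: measurable_indic.
    by exists 1 => x; rewrite indicE; case: (_ \in _); rewrite ?normr1 ?normr0.
  have cv : \int[zeta]_y (K * (1 - cutoff U j y)) @[j --> \oo] --> \int[zeta]_y (K * (1 - \1_U y)).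
    apply: (@Rintegral_bounded_cvg _ _ _ zeta setT _ _ K) => //.
    - by move=> k; case: (bK k).
    - move=> k x; rewrite normrM (gtr0_norm Kp) ger0_norm ?subr_ge0 ?cutoff_le1//.
      by rewrite ler_piMr ?(ltW Kp)// gerBl cutoff_ge0.
    - by move=> x _; apply: cvgMr; apply: cvgB; [exact: cvg_cst|exact: cutoff_cvg].
  have z0 : \int[zeta]_y (K * (1 - \1_U y)) = 0.
    rewrite -(Rintegral_prob_cst zeta 0) /Rintegral; congr fine.
    apply: ae_eq_integral => //; first by apply/measurable_EFinP; case: bU.
    exists (~` U); split => //; first exact: measurableC.
    apply: subsetC => y /= Uy _; rewrite indicE mem_set//= subrr mulr0//.
  rewrite z0 in cv; have := cvgr_le _ cv _ eps0.
  by move=> [j _ /(_ j (leqnn _))]; exists j.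
have chc : continuous (fun y => h y * cutoff U j y).
  move=> x; have [Ux|Ux] := pselect (U x).
    by apply: cvgM; [exact: ch|exact: cutoff_continuous].
  move=> A /nbhs_ballP[e /= e0 eA]; apply/metric_nbhs.
  have jK : 0 < j%:R * K + 1 by rewrite ltr_wpDl// mulr_ge0// ltW.
  exists (e / (j%:R * K + 1)); first by rewrite divr_gt0.
  move=> y; rewrite ltr_pdivlMr// => xy; apply: eA.
  rewrite /ball/= cutoff_out// mulr0 sub0r normrN normrM.
  apply: (@le_lt_trans _ _ (K * (j%:R * mdist x y))).
    apply: ler_pM => //; rewrite ger0_norm ?cutoff_ge0//.
    by have := cutoff_lip U j y x; rewrite (cutoff_out _ Ux) add0r metric_sym.
  apply: le_lt_trans xy; rewrite mulrA [leLHS]mulrC ler_wpM2l ?mdist_ge0//.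
  by rewrite mulrC lerDl.
exists 0%N, (fun i => h (o i) * cutoff U j (o i)), (fun i => K * (1 - cutoff U j (o i))),
  (\int[zeta]_y (h y * cutoff U j y)), (\int[zeta]_y (K * (1 - cutoff U j y))); split => //.
- move=> i; rewrite addn0 -[X in X - _]mulr1 -mulrBr normrM; apply: ler_pM => //.
  by rewrite ger0_norm// subr_ge0 cutoff_le1.
- exact: gen.
- apply: (gen (fun y => K * (1 - cutoff U j y))) => x.
  by apply: cvgMr; apply: cvgB; [exact: cvg_cst|exact: cutoff_continuous].
- apply: le_trans Hj; apply: Rintegral_close => //; first exact: bounded_measurableM.
  move=> y; rewrite -[X in _ - X]mulr1 -mulrBr normrM; apply: ler_pM => //.
  by rewrite distrC ger0_norm// subr_ge0 cutoff_le1.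
Qed.

End tests.

(** * Basins *)

Lemma mdist_continuousl {R : realType} {Y : metricType R} (y : Y) :
  continuous (fun x => mdist x y).
Proof.
move=> x P /nbhs_ballP[e /= e0 eP]; apply/metric_nbhs; exists e => // x' xx'; apply: eP.
rewrite /ball/=; have := metric_triangle x x' y; have := metric_triangle x' x y.
by rewrite (metric_sym x' x) ltr_norml; lra.
Qed.

Section test_family.
Context {R : realType} {d : measure_display} {Y : borelMetricType d R}.
Hypothesis cY : compact [set: Y].
Let y0 : Y := point.

Lemma finite_net (r : R) : 0 < r -> exists s : seq Y, forall x, exists2 y, y \in s & mdist x y < r.
Proof.
move=> r0; move: cY; rewrite compact_cover => /(_ Y [set: Y] (fun y => (ball y r)°)) [].
- by move=> y _; exact: open_interior.
- by move=> y _; exists y => //; exact: nbhsx_ballx.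
- move=> s _ cov; exists (finmap.enum_fset s) => x; have [y ys /interior_subset] := cov x I.
  by rewrite ballEmdist/= metric_sym => xy; exists y.
Qed.

(** Partitions of unity subordinate to finer and finer finite nets: countably
    many functions whose linear combinations approximate all continuous ones. *)
Lemma countable_test_family : exists Psi : nat -> nat -> Y -> R,
  (forall k j, continuous (Psi k j)) /\
  forall (phi : Y -> R) (eps : R), continuous phi -> 0 < eps ->
    exists k m (a : nat -> R), forall x, `|phi x - \sum_(j < m) a j * Psi k j x| <= eps.
Proof.
have /choice[net Hnet] : forall k : nat, exists s : seq Y,
    forall x, exists2 y, y \in s & mdist x y < k.+1%:R^-1.
  by move=> k; exact: finite_net.
pose bump (k : nat) (y x : Y) : R := Num.max 0 (2 * k.+1%:R^-1 - mdist x y).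
have bump0 k y x : 0 <= bump k y x by rewrite le_max lexx.
have cbump k y : continuous (bump k y).
  move=> x; have c : {for x, continuous (fun x => 2 * k.+1%:R^-1 - mdist x y)}.
    by apply: cvgB; [exact: cvg_cst|exact: mdist_continuousl].
  exact: (continuous_max (f := fun=> 0) (@cvg_cst _ _ _ _ _) c).
pose S (k : nat) (x : Y) : R := \sum_(y <- net k) bump k y x.
have cS k : continuous (S k).
  apply: continuous_big => [|y _]; first exact: add_continuous.
  exact: cbump.
have S0 k x : 0 < S k x.
  have [y yn xy] := Hnet k x.
  rewrite /S (big_rem y)//= ltr_wpDr ?sumr_ge0//.
  rewrite lt_max subr_gt0; apply/orP; right; apply: lt_trans xy _.
  by rewrite ltr_pMl ?ltr1n// invr_gt0.
exists (fun k j x => bump k (nth y0 (net k) j) x / S k x); split.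
  move=> k j x; apply: cvgM; first exact: cbump.
  by apply: cvgV; [rewrite gt_eqF|exact: cS].
move=> phi eps cphi eps0.
have [dl dl0 Hdl] := compact_uniform_continuity cY cphi eps0.
pose k := Num.bound (2 / dl).
have kd : 2 * k.+1%:R^-1 < dl.
  rewrite ltr_pdivrMr// mulrC -ltr_pdivrMr//.
  apply: lt_trans (archi_boundP _) _; first by rewrite divr_ge0// ltW.
  by rewrite ltr_nat.
exists k, (size (net k)), (fun j => phi (nth y0 (net k) j)) => x.
have SE : S k x = \sum_(j < size (net k)) bump k (nth y0 (net k) j) x.
  by rewrite /S (big_nth y0) big_mkord.
have -> : phi x = \sum_(j < size (net k)) phi x * (bump k (nth y0 (net k) j) x / S k x).
  by rewrite -mulr_sumr -mulr_suml -SE mulfV ?mulr1// gt_eqF.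
rewrite -sumrB; apply: le_trans (ler_norm_sum _ _ _) _.
apply: (@le_trans _ _ (\sum_(j < size (net k)) eps * (bump k (nth y0 (net k) j) x / S k x))).
  apply: ler_sum => j _; rewrite -mulrBl normrM (ger0_norm (divr_ge0 _ (ltW (S0 _ _))))//.
  have [->|b0] := eqVneq (bump k (nth y0 (net k) j) x) 0; first by rewrite mul0r !mulr0.
  rewrite ler_wpM2r ?divr_ge0 ?(ltW (S0 _ _))// ltW//; apply: Hdl.
  rewrite ballEmdist/=; apply: lt_trans kd; move: b0; rewrite /bump.
  by case: (lerP 0 (2 * k.+1%:R^-1 - mdist x (nth y0 (net k) j))) => [|_ /eqP//];
    rewrite le_eqVlt => /orP[/eqP <-|]; rewrite ?eqxx// subr_gt0.
by rewrite -mulr_sumr -mulr_suml -SE mulfV ?mulr1// gt_eqF.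
Qed.

End test_family.

Lemma measurable_cvg_set {d : measure_display} {T : measurableType d} {R : realType}
    (u : nat -> T -> R) (l : R) : (forall n, measurable_fun setT (u n)) ->
  measurable [set x | u n x @[n --> \oo] --> l].
Proof.
move=> mu.
have -> : [set x | u n x @[n --> \oo] --> l] = \bigcap_q \bigcup_N \bigcap_(n in [set n | (N <= n)%N])
    [set x | `|l - u n x| <= q.+1%:R^-1].
  apply/seteqP; split => x /=.
    move=> /cvgrPdist_le H q _.
    have [N _ HN] := H q.+1%:R^-1 (ltac:(by [])).
    by exists N => // n /= Nn; exact: HN.
  move=> H; apply/cvgrPdist_le => e e0.
  have [q] := @ltr_add_invr R 0 e e0; rewrite add0r => qe.
  have [N _ HN] := H q I; exists N => // n /= Nn.
  by apply: le_trans (ltW qe); exact: HN.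
apply: bigcapT_measurable => q; apply: bigcupT_measurable => N.
apply: bigcap_measurable; first by exists N => /=.
move=> n _; rewrite -[X in measurable X]setTI.
have mf : measurable_fun setT (fun x => `|l - u n x|).
  by apply: measurableT_comp => //; exact: measurable_funB.
have -> : [set x | `|l - u n x| <= q.+1%:R^-1] = (fun x => `|l - u n x|) @^-1` `]-oo, q.+1%:R^-1].
  by apply/seteqP; split => x /=; rewrite in_itv.
exact: mf.
Qed.

Lemma measurable_iter {d : measure_display} {T : measurableType d} (S : T -> T) i :
  measurable_fun setT S -> measurable_fun setT (iter i S).
Proof.
move=> mS; elim: i => [|i IH]; first exact: measurable_id.
by rewrite (_ : iter i.+1 S = S \o iter i S)//; exact: measurableT_comp.
Qed.

Lemma measurable_avg {d : measure_display} {T : measurableType d} {R : realType}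
    (S : T -> T) (h : T -> R) n : measurable_fun setT S -> measurable_fun setT h ->
  measurable_fun setT (fun x => avg (fun i => h (iter i S x)) n).
Proof.
move=> mS mh; apply: measurable_funM => //; apply: measurable_sum => i.
by apply: measurableT_comp => //; exact: measurable_iter.
Qed.

Lemma Rintegral_sum {d : measure_display} {T : measurableType d} {R : realType}
    (P : probability T R) m (h : nat -> T -> R) : (forall j, bounded_measurable (h j)) ->
  \int[P]_x (\sum_(j < m) h j x) = \sum_(j < m) \int[P]_x h j x.
Proof.
move=> bh; elim: m => [|m IH].
  rewrite big_ord0 -[RHS](Rintegral_prob_cst P 0).
  by apply: eq_Rintegral => x _; rewrite big_ord0.
rewrite big_ord_recr/= -IH -RintegralD//.
- by apply: eq_Rintegral => x _; rewrite big_ord_recr.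
- apply: bounded_measurable_integrable => //.
  exact: (bounded_measurable_sum _ (fun j : 'I_m => bh j)).
- exact: bounded_measurable_integrable.
Qed.

Section basin_measurable.
Context {R : realType} {d : measure_display} {Y : borelMetricType d R}.
Hypothesis cY : compact [set: Y].

Lemma continuous_bounded_measurable (phi : Y -> R) : continuous phi -> bounded_measurable phi.
Proof.
move=> cphi; split; first exact: (continuous_measurable_realfun (@borel_metric_open _ _ _)).
by have [K _ HK] := compact_continuous_bounded cY cphi; exists K.
Qed.

(** By [countable_test_family], countably many convergence conditions decide
    whether a point belongs to the basin. *)
Lemma basin_measurable (S : Y -> Y) (zeta : probability Y R) : measurable_fun setT S ->
  measurable (basin S zeta).
Proof.
move=> mS; have [Psi [cPsi HPsi]] := countable_test_family cY.
have -> : basin S zeta = \bigcap_k \bigcap_j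
    [set x | avg (fun i => Psi k j (iter i S x)) n @[n --> \oo] --> \int[zeta]_y Psi k j y].
  apply/seteqP; split => x.
    move=> /(weak_star_empirical _ _ _ (@borel_metric_open _ _ _)) H k _ j _; exact: H.
  move=> H; apply/(weak_star_empirical _ _ _ (@borel_metric_open _ _ _)) => phi cphi.
  have [K _ HK] := compact_continuous_bounded cY cphi.
  apply: (@avg_approx _ _ K) => // eps eps0.
  have [k [m [a Ha]]] := HPsi phi eps cphi eps0.
  exists 0%N, (fun i => \sum_(j < m) a j * Psi k j (iter i S x)), (fun=> eps),
    (\sum_(j < m) a j * \int[zeta]_y Psi k j y), eps; split => //.
  - by move=> i; rewrite addn0.
  - rewrite (_ : avg _ = fun n => \sum_(j < m) a j * avg (fun i => Psi k j (iter i S x)) n).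
      apply: cvg_big => [|j _]; first exact: add_continuous.
      by apply: cvgMr; exact: (H k I j I).
    apply/funext => n; rewrite /avg exchange_big/= mulr_sumr; apply: eq_bigr => j _.
    by rewrite -mulr_sumr mulrCA.
  - exact: avg_cst_cvg.
  - have bP j : bounded_measurable (Psi k j) by exact: continuous_bounded_measurable.
    have E : \sum_(j < m) a j * \int[zeta]_y Psi k j y = \int[zeta]_y \sum_(j < m) a j * Psi k j y.
      rewrite (Rintegral_sum _ _ (h := fun j x => a j * Psi k j x)).
        by apply: eq_bigr => j _; rewrite RintegralZl//; exact: bounded_measurable_integrable.
      by move=> j; apply: bounded_measurableM => //; exact: bounded_measurable_cst.
    rewrite E -[leRHS](Rintegral_prob_cst zeta eps).
    apply: Rintegral_close => [|||y].
    + apply: (bounded_measurable_sum _ (h := fun (j : 'I_m) x => a j * Psi k j x)) => j.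
      by apply: bounded_measurableM => //; exact: bounded_measurable_cst.
    + exact: continuous_bounded_measurable.
    + exact: bounded_measurable_cst.
    + by rewrite distrC.
apply: bigcapT_measurable => k; apply: bigcapT_measurable => j.
apply: measurable_cvg_set => n; apply: measurable_avg => //.
exact: (continuous_measurable_realfun (@borel_metric_open _ _ _)).
Qed.

End basin_measurable.

(** Open rectangles generate the product sigma-algebra, and products of cut-off
    functions converge to their indicators. *)
Lemma probability_eq_continuous_prod {R : realType} {dY dZ : measure_display}
    {Y : borelMetricType dY R} {Z : borelMetricType dZ R} (P Q : probability (Y * Z)%type R) :
  (forall phi : Y * Z -> R, continuous phi -> \int[P]_x phi x = \int[Q]_x phi x) ->
  forall A, measurable A -> P A = Q A.
Proof.
move=> PQ; pose C := [set A `*` B | A in @open Y & B in @open Z].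
apply: (@probability_eq_tests _ _ _ P Q C).
- rewrite measurable_prod_measurableType eqEsubset; split.
    apply: smallest_sub; first exact: smallest_sigma_algebra.
    move=> _ [A mA [B mB <-]].
    have mf : measurable_fun setT (fst : g_sigma_algebraType C -> Y).
      apply: (measurability _ (@borel_measurableE _ _ Y)) => _ [U oU <-].
      rewrite setTI; apply: sub_sigma_algebra; exists U => //; exists setT; first exact: openT.
      by apply/seteqP; split => [z []|z].
    have ms : measurable_fun setT (snd : g_sigma_algebraType C -> Z).
      apply: (measurability _ (@borel_measurableE _ _ Z)) => _ [U oU <-].
      rewrite setTI; apply: sub_sigma_algebra; exists setT; first exact: openT.
      by exists U => //; apply/seteqP; split => [z []|z].
    have mAB : measurable ((fst @^-1` A `&` snd @^-1` B) : set (g_sigma_algebraType C)).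
      by apply: measurableI; rewrite -[X in measurable X]setTI; [exact: mf|exact: ms].
    exact: mAB.
  apply: smallest_sub; first exact: smallest_sigma_algebra.
  move=> _ [A oA [B oB <-]]; apply: sub_sigma_algebra.
  by exists A; [exact: borel_metric_open|exists B; [exact: borel_metric_open|]].
- move=> _ _ [A1 oA1 [B1 oB1 <-]] [A2 oA2 [B2 oB2 <-]].
  by exists (A1 `&` A2); [exact: openI|exists (B1 `&` B2); [exact: openI|rewrite setXI]].
- move=> _ [A oA [B oB <-]].
  exists (fun k z => cutoff A k z.1 * cutoff B k z.2); split.
  + move=> n; apply: measurable_funM.
      by apply: (measurableT_comp (measurable_fun_cutoff A n)); exact: measurable_fst.
    by apply: (measurableT_comp (measurable_fun_cutoff B n)); exact: measurable_snd.
  + by move=> n z; rewrite normrM mulr_ile1 ?cutoff_norm_le1.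
  + move=> [y z]; rewrite (_ : \1_(A `*` B) (y, z) = \1_A y * \1_B z :> R).
      by apply: cvgM; exact: cutoff_cvg.
    by rewrite !indicE in_setX/=; case: (y \in A); case: (z \in B); rewrite ?mulr1 ?mulr0.
  + move=> n; apply: PQ => z; apply: cvgM.
      by apply: (continuous_comp (f := fst)); [exact: cvg_fst|exact: cutoff_continuous].
    by apply: (continuous_comp (f := snd)); [exact: cvg_snd|exact: cutoff_continuous].
Qed.

Lemma probability_proportional {d : measure_display} {T : measurableType d} {R : realType}
    (mu : {measure set T -> \bar R}) (c : R) : mu setT = c%:E -> 0 < c ->
  exists P : probability T R, forall A, P A = (mu A * (c^-1)%:E)%E.
Proof.
move=> muT c0; exists (mnormalize mu (\d_point)) => A.
by rewrite /= /mnormalize muT eqe gt_eqF.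
Qed.

Section basins.
Context {R : realType} {d : measure_display} {Y : borelMetricType d R}.
Hypothesis cY : compact [set: Y].
Variables (S : Y -> Y) (zeta : probability Y R).
Hypothesis mS : measurable_fun setT S.

Lemma basin_preimage : S @^-1` basin S zeta = basin S zeta.
Proof.
have E (phi : Y -> R) x : continuous phi ->
    avg (fun i => phi (iter i S (S x))) n - avg (fun i => phi (iter i S x)) n @[n --> \oo] --> (0 : R).
  move=> cphi; have [K _ HK] := compact_continuous_bounded cY cphi.
  have := @avg_shift_cvg _ (fun i => phi (iter i S x)) K 1 (fun i => HK _).
  have -> : (fun i => phi (iter (i + 1) S x)) = (fun i => phi (iter i S (S x))).
    by apply/funext => i; rewrite addn1 iterSr.
  by [].
apply/seteqP; split => x /=.
  move=> /(weak_star_empirical _ _ _ (@borel_metric_open _ _ _)) H.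
  apply/(weak_star_empirical _ _ _ (@borel_metric_open _ _ _)) => phi cphi.
  rewrite (_ : avg _ = fun n => avg (fun i => phi (iter i S (S x))) n -
      (avg (fun i => phi (iter i S (S x))) n - avg (fun i => phi (iter i S x)) n)).
    by rewrite -[X in _ --> X]subr0; exact: cvgB (H phi cphi) (E phi x cphi).
  by apply/funext => n; rewrite subKr.
move=> /(weak_star_empirical _ _ _ (@borel_metric_open _ _ _)) H.
apply/(weak_star_empirical _ _ _ (@borel_metric_open _ _ _)) => phi cphi.
rewrite (_ : avg _ = fun n => avg (fun i => phi (iter i S x)) n +
    (avg (fun i => phi (iter i S (S x))) n - avg (fun i => phi (iter i S x)) n)).
  by rewrite -[X in _ --> X]addr0; exact: cvgD (H phi cphi) (E phi x cphi).
by apply/funext => n; rewrite subrKC.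
Qed.

(** Integrate the time averages: by invariance their integrals do not depend on
    the time, while they converge to the [zeta]-integral almost everywhere. *)
Lemma invariant_carried_by_basin (P : probability Y R) : invariant_measure S P ->
  P (basin S zeta) = 1%E -> forall A, measurable A -> P A = zeta A.
Proof.
move=> invP P1; set B := basin S zeta; have mB : measurable B := basin_measurable cY zeta mS.
apply: probability_eq_continuous => phi cphi.
have bphi := continuous_bounded_measurable cY cphi.
have [K K0 HK] := compact_continuous_bounded cY cphi.
have bS n : bounded_measurable (fun x => avg (fun i => phi (iter i S x)) n.+1).
  split; first by apply: measurable_avg => //; case: bphi.
  exists K => x; rewrite -(avg_cst K n).
  by apply: avg_norm_le => i; exact: HK.
have PBC : P (~` B) = 0%E by rewrite probability_setC// P1 subee.
have restr h : bounded_measurable h -> \int[P]_x h x = \int[P]_(x in B) h x.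
  move=> bh; rewrite /Rintegral; congr fine.
  rewrite (@negligible_integral _ _ _ _ setT (~` B))//; last 2 first.
  - exact: measurableC.
  - exact: bounded_measurable_integrable.
  by rewrite setDE setCK setTI.
have invk k : \int[P]_x phi x = \int[P]_x phi (iter k S x).
  apply: Rintegral_invariant => //; first exact: measurable_iter.
  move=> A mA; elim: k => // k IH; rewrite IH -invP.
    by apply: congr1; apply/funext => z; rewrite /preimage/= -iterSr.
  by rewrite -[X in measurable X]setTI; exact: (measurable_iter k mS).
have cst n : \int[P]_x avg (fun i => phi (iter i S x)) n.+1 = \int[P]_x phi x.
  have bk i : bounded_measurable (fun x => phi (iter i S x)).
    by apply: (bounded_measurable_comp bphi); exact: measurable_iter.
  rewrite /avg RintegralZl//; last first.
    by apply: bounded_measurable_integrable => //;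
      exact: (bounded_measurable_sum _ (fun i : 'I_n.+1 => bk i)).
  rewrite (Rintegral_sum _ _ bk); under eq_bigr do rewrite -invk.
  by rewrite sumr_const card_ord -[X in _ * X]mulr_natl mulKf ?pnatr_eq0.
have cv : \int[P]_(x in B) avg (fun i => phi (iter i S x)) n.+1 @[n --> \oo] -->
    \int[P]_(x in B) (\int[zeta]_y phi y).
  apply: (@Rintegral_bounded_cvg _ _ _ _ _ _ _ K) => //.
  - by move=> n; have [] := bS n.
  - move=> n x; rewrite -(avg_cst K n).
    by apply: avg_norm_le => i; exact: HK.
  - exact: bounded_measurable_cst.
  - move=> x /(weak_star_empirical _ _ _ (@borel_metric_open _ _ _)) H.
    by have := H phi cphi; rewrite -(cvg_shiftS (fun n => avg _ n)).
rewrite -restr in cv; last exact: bounded_measurable_cst.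
rewrite Rintegral_prob_cst in cv.
rewrite (_ : (fun n => _) = (fun=> \int[P]_x phi x)) in cv; last first.
  by apply/funext => n; rewrite -restr.
exact: (cvg_unique _ (cvg_cst _) cv).
Qed.

(** Conditioning [eta] on a basin of positive measure keeps it invariant, and
    the result can only be the measure of the basin. *)
Lemma basin_conditional (eta : probability Y R) (b : R) : invariant_measure S eta ->
  eta (basin S zeta) = b%:E -> 0 < b ->
  forall A, measurable A -> zeta A = (eta (A `&` basin S zeta) * (b^-1)%:E)%E.
Proof.
move=> inv etaB b0 A mA; have mB : measurable (basin S zeta) := basin_measurable cY zeta mS.
have [|//|P HP] := @probability_proportional _ _ _ (mrestr eta mB) b.
  by rewrite /= /mrestr setTI.
rewrite -[RHS]HP; apply/esym/invariant_carried_by_basin => //.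
  move=> C mC; rewrite !HP /= /mrestr -[in LHS]basin_preimage -preimage_setI inv//.
  exact: measurableI.
by rewrite HP /= /mrestr setIid etaB -EFinM mulfV// gt_eqF.
Qed.

End basins.

Lemma basin_unique_prod {R : realType} {dY dZ : measure_display} {Y : borelMetricType dY R}
    {Z : borelMetricType dZ R} (S : Y * Z -> Y * Z) (P Q : probability (Y * Z)%type R) z :
  compact [set: Y] -> compact [set: Z] -> basin S P z -> basin S Q z ->
  forall A, measurable A -> P A = Q A.
Proof.
move=> cY cZ Pz Qz; apply: probability_eq_continuous_prod => phi cphi.
move/(weak_star_empirical _ _ _ (open_prod_measurable cY cZ)): Pz => /(_ _ cphi) Pz.
move/(weak_star_empirical _ _ _ (open_prod_measurable cY cZ)): Qz => /(_ _ cphi) Qz.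
exact: (cvg_unique _ Pz Qz).
Qed.

Lemma basin_ext {R : realType} {d : measure_display} {M : topMeasurableType d} (S : M -> M)
    (P Q : probability M R) : (forall A, measurable A -> P A = Q A) -> basin S P = basin S Q.
Proof.
move=> PQ; have E (phi : M -> R) : \int[P]_x phi x = \int[Q]_x phi x.
  by rewrite /Rintegral; congr fine; apply: eq_measure_integral => A mA _; exact: PQ.
by apply/seteqP; split => x H phi cphi; have := H phi cphi; rewrite E.
Qed.

(** * Invariance of the lifted measure *)

Section lifted_measure.
Context {R : realType} {nO N : nat} {dO dX : measure_display}
  {Omega : borelMetricType dO R} {X : borelMetricType dX R}.
Variables (GO : riemannianManifold nO Omega) (mO : {measure set Omega -> \bar R})
  (f : Omega -> Omega) (g : Omega -> X -> X)
  (D : 'I_N -> set Omega) (fbar theta : 'I_N -> Omega -> Omega)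
  (eta : probability Omega R) (rho : Omega -> R)
  (nu : Omega -> probability X R) (mu : probability (Omega * X)%type R).
Let p := branch_weight GO D fbar theta rho.
Hypothesis cO : compact [set: Omega].
Hypothesis cX : compact [set: X].
Hypothesis vol : riemannian_volume GO mO.
Hypothesis mf : measurable_fun setT f.
Hypothesis mg : measurable_fun [set: (Omega * X)%type] (fun z => g z.1 z.2).
Hypothesis fb : full_branches GO mO f D fbar theta.
Hypothesis inv : invariant_measure f eta.
Hypothesis dens : equivalent_with_density mO eta rho.
Hypothesis reg : branch_regularity g theta p.
Hypothesis fix_nu : sectional_fixed_point g theta eta p nu.
Hypothesis dis : disintegration eta nu mu.

Lemma measurable_weight i : measurable_fun setT (p i).
Proof.
have [q [L [/andP[q0 _] _ /(_ i) [hp _]]]] := reg.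
apply: (continuous_measurable_realfun (@borel_metric_open _ _ _)).
exact: (@holder_continuous _ _ R^o _ _ _ q0 hp).
Qed.

Lemma sum_weights : {ae eta, forall w, \sum_(i < N) p i w = 1}.
Proof.
have [_] := fix_nu; apply: filterS => w /(_ setT measurableT).
rewrite probability_setT /sectional_transfer => h.
apply: EFin_inj; rewrite -sumEFin -h; apply: eq_bigr => i _.
by rewrite /pushforward preimage_setT probability_setT mule1.
Qed.

Lemma measurable_skew_product : measurable_fun setT (skew_product f g).
Proof.
exact: (measurable_fun_pair (measurableT_comp mf measurable_fst) mg).
Qed.

Lemma measurable_disintegration (B : set (Omega * X)) : measurable B ->
  measurable_fun setT (fun w => nu w (xsection B w)).
Proof. by move=> mB; apply: measurable_kernel_xsection => //; case: fix_nu. Qed.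

(** The fixed point equation for [nu] is the duality [integral_transfer] read on
    the functions [w |-> nu w (xsection A w)]. *)
Lemma invariant_lift : invariant_measure (skew_product f g) mu.
Proof.
move=> A mA; have [mnu nuE] := fix_nu.
have mTA : measurable (skew_product f g @^-1` A).
  by rewrite -[X in measurable X]setTI; exact: measurable_skew_product.
rewrite !dis//.
pose u i w := nu (theta i w) (g (theta i w) @^-1` (xsection A w)).
have mth i := theta_measurable fb i.
have mu_ i : measurable_fun setT (u i).
  pose B := (fun z : Omega * X => (z.1, g (theta i z.1) z.2)) @^-1` A.
  have mB : measurable B.
    rewrite -[X in measurable X]setTI.
    have mt : measurable_fun setT (fun z : Omega * X => (theta i z.1, z.2)).
      exact: (measurable_fun_pair (measurableT_comp (mth i) measurable_fst) measurable_snd).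
    exact: (measurable_fun_pair measurable_fst (measurableT_comp mg mt)).
  have mnut : W1_measurable (fun w => nu (theta i w)).
    move=> U oU; have := mnu U oU; rewrite -[X in _ -> measurable X]setTI => mU.
    exact: (mth i measurableT _ mU).
  rewrite (_ : u i = fun w => nu (theta i w) (xsection B w)).
    exact: measurable_kernel_xsection.
  by apply/funext => w; rewrite /u !xsectionE.
rewrite (@integral_transfer _ _ _ _ _ GO mO f D fbar theta eta rho cO vol mf fb dens inv
  measurable_weight sum_weights _ u)//; last 2 first.
- exact: measurable_disintegration.
- by move=> i w Dw; rewrite /u (theta_f fb Dw) !xsectionE.
apply: ae_eq_integral => //.
- apply: emeasurable_sum => i; apply: emeasurable_funM => //.
  by apply/measurable_EFinP; exact: measurable_weight.
- exact: measurable_disintegration.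
- apply: filterS nuE => w + _; move=> /(_ (xsection A w) (measurable_xsection w mA)) <-.
  by [].
Qed.

Lemma marginal_lift A : measurable A -> eta A = mu (fst @^-1` A).
Proof.
move=> mA; rewrite dis; last by rewrite -[X in measurable X]setTI; exact: measurable_fst.
rewrite (eq_integral (fun w => (\1_A w)%:E)).
  by rewrite integral_indic// setIT.
move=> w _; rewrite xsectionE indicE; have [Aw|Aw] := pselect (A w).
  rewrite mem_set// (_ : _ @^-1` _ = setT) ?probability_setT//.
  by apply/seteqP; split.
rewrite memNset// (_ : _ @^-1` _ = set0) ?measure0//.
by apply/seteqP; split.
Qed.

End lifted_measure.

(** * Contraction along the fibers *)

Lemma expR_quadratic {R : realType} (t : R) : `|t| <= 1 / 2 -> expR t <= 1 + t + 2 * t ^+ 2.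
Proof.
rewrite ler_norml => /andP[t1 t2].
have e1 : 1 - t <= expR (- t) by have := expR_ge1Dx (- t).
have p : 0 < 1 - t by lra.
rewrite -[leLHS]invrK -expRN.
apply: (@le_trans _ _ (1 - t)^-1); first by rewrite lef_pV2 ?posrE ?expR_gt0.
rewrite -div1r ler_pdivrMr// !expr2; nra.
Qed.

Section fiber_contraction.
Context {R : realType} {nO N : nat} {dO dX : measure_display}
  {Omega : borelMetricType dO R} {X : borelMetricType dX R}.
Variables (GO : riemannianManifold nO Omega) (mO : {measure set Omega -> \bar R})
  (f : Omega -> Omega) (g : Omega -> X -> X)
  (D : 'I_N -> set Omega) (fbar theta : 'I_N -> Omega -> Omega)
  (eta : probability Omega R) (rho : Omega -> R).
Let p := branch_weight GO D fbar theta rho.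
Hypothesis fb : full_branches GO mO f D fbar theta.
Hypothesis dens : equivalent_with_density mO eta rho.
Hypothesis reg : branch_regularity g theta p.
Hypothesis sum_p : {ae eta, forall w, \sum_(i < N) p i w = 1}.
Hypothesis mc : mean_contraction g theta eta p.
Variable L : R.
Hypothesis L0 : 0 < L.
Hypothesis hL : forall w, (L^-1%:E <= Lip (g w))%E /\ (Lip (g w) <= L%:E)%E.

Local Notation D0 := (\bigcup_i D i).
Local Notation T := (skew_product f g).

Definition fiber_lip (w : Omega) : R := fine (Lip (g w)).

Lemma fiber_lipE w : Lip (g w) = (fiber_lip w)%:E.
Proof.
rewrite /fiber_lip fineK//; have [h1 h2] := hL w.
by apply/fin_numPlt; rewrite (lt_le_trans _ h1) ?ltNyr// (le_lt_trans h2) ?ltry.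
Qed.

Lemma fiber_lip_bounds w : L^-1 <= fiber_lip w <= L.
Proof. by have := hL w; rewrite fiber_lipE !lee_fin => -[-> ->]. Qed.

Lemma fiber_lip_le w x y : mdist (g w x) (g w y) <= fiber_lip w * mdist x y.
Proof. by apply: Lip_le; rewrite fiber_lipE. Qed.

Lemma f_continuous w : D0 w -> {for w, continuous f}.
Proof.
move=> [i _ Dw]; have [oD _ _ /(_ i) [fE [cf _] _] _] := fb.
have := continuous_subspaceW (@subset_closure _ (D i)) cf.
rewrite continuous_open_subspace// => /(_ w (mem_set Dw)) cw A nA.
have : nbhs w (D i `&` fbar i @^-1` A).
  apply: filterI; first exact: open_nbhs_nbhs.
  by apply: cw; rewrite fE.
by apply: filterS => v [Dv]; rewrite /= fE.
Qed.

(** On a branch the fiber maps depend on the base point through the inverse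
    branch, along which they are Lipschitz uniformly in the fiber point. *)
Lemma fiber_equicontinuous w (e : R) : D0 w -> 0 < e ->
  \forall v \near w, forall x, mdist (g w x) (g v x) < e.
Proof.
move=> D0w e0; have fc := f_continuous D0w; case: D0w => i _ Dw.
have [oD _ _ _ _] := fb.
have [q [L' [_ L'0 /(_ i) [_ Lg]]]] := reg.
have eL : 0 < e / L' by rewrite divr_gt0.
have h1 : nbhs w (f @^-1` [set u | mdist (f w) u < e / L']).
  by apply: fc; apply/metric_nbhs; exists (e / L').
have : nbhs w (D i `&` (f @^-1` [set u | mdist (f w) u < e / L'])).
  by apply: filterI => //; exact: open_nbhs_nbhs.
apply: filterS => v [Dv /= fv] x.
have := Lip_le (Lg x) (f w) (f v); rewrite (theta_f fb Dw) (theta_f fb Dv) => /le_lt_trans; apply.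
by rewrite mulrC -ltr_pdivlMr.
Qed.

Lemma open_D0 : open D0.
Proof. by have [oD _ _ _ _] := fb; apply: bigcup_open. Qed.

(** Nothing is known on the measurability of [fiber_lip] outside the branches;
    the common lower bound [L^-1] is a measurable value there that preserves the
    mean contraction inequality. *)
Definition branch_lip (w : Omega) : R := if `[< D0 w >] then fiber_lip w else L^-1.

Lemma branch_lip_le w : branch_lip w <= fiber_lip w.
Proof.
by rewrite /branch_lip; case: ifP => // _; have /andP[] := fiber_lip_bounds w.
Qed.

Lemma branch_lip_bounds w : L^-1 <= branch_lip w <= L.
Proof.
have /andP[h1 h2] := fiber_lip_bounds w.
by rewrite /branch_lip; case: ifP => _; rewrite ?lexx ?h1 ?h2//= (le_trans h1).
Qed.

Lemma branch_lip_gt0 w : 0 < branch_lip w.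
Proof. by have /andP[h _] := branch_lip_bounds w; apply: lt_le_trans h; rewrite invr_gt0. Qed.

(** A Lipschitz constant is a supremum of difference quotients, each of which
    depends continuously on the base point within the branches. *)
Lemma fiber_lip_open (a : R) : open (D0 `&` [set w | a < fiber_lip w]).
Proof.
rewrite openE => w [Dw /= aw].
have [x [y [xy axy]]] : exists x y, x <> y /\ a < mdist (g w x) (g w y) / mdist x y.
  apply: contrapT => H; move: aw; apply/negP; rewrite -leNgt -lee_fin -fiber_lipE.
  apply: ge_ereal_sup => _ [x [y [xy ->]]]; rewrite lee_fin leNgt; apply/negP => axy.
  by apply: H; exists x, y.
have xy0 : 0 < mdist x y by rewrite mdist_gt0; exact/eqP.
rewrite ltr_pdivlMr// in axy.
pose e := (mdist (g w x) (g w y) - a * mdist x y) / 2.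
have e0 : 0 < e by rewrite divr_gt0// subr_gt0.
have : nbhs w (D0 `&` [set v | forall x, mdist (g w x) (g v x) < e]).
  apply: filterI; first by apply: open_nbhs_nbhs; split => //; exact: open_D0.
  exact: fiber_equicontinuous.
apply: filterS => v [Dv Hv]; split => //=.
apply: (@lt_le_trans _ _ (mdist (g v x) (g v y) / mdist x y)); last first.
  by rewrite ler_pdivrMr// fiber_lip_le.
rewrite ltr_pdivlMr//.
have h1 := Hv x; have h2 := Hv y.
have := metric_triangle (g w x) (g v x) (g w y); have := metric_triangle (g v x) (g v y) (g w y).
rewrite (metric_sym (g v y) (g w y)) => h3 h4; rewrite /e in h1 h2; lra.
Qed.

Lemma measurable_D0 : measurable D0.
Proof. exact: borel_metric_open open_D0. Qed.

Lemma measurable_branch_lip : measurable_fun setT branch_lip.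
Proof.
apply: (measurability _ (RGenOInfty.measurableE R)) => _ [_ [a ->] <-]; rewrite setTI.
have -> : branch_lip @^-1` `]a, +oo[ = (D0 `&` [set w | a < fiber_lip w]) `|`
    (~` D0 `&` [set w | a < L^-1]).
  apply/seteqP; split => w; rewrite /= in_itv/= andbT /branch_lip.
    by case: asboolP => Dw aw; [left|right].
  by case: asboolP => Dw [[]|[]].
apply: measurableU; first by apply: borel_metric_open; exact: fiber_lip_open.
apply: measurableI; first by apply: measurableC; exact: measurable_D0.
have [aL|aL] := ltP a L^-1.
  by rewrite (_ : [set w | _] = setT)//; apply/seteqP; split.
by rewrite (_ : [set w | _] = set0)//; apply/seteqP; split.
Qed.

Definition log_lip (w : Omega) : R := ln (branch_lip w).

Lemma measurable_log_lip : measurable_fun setT log_lip.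
Proof. by apply: measurableT_comp => //; exact: measurable_branch_lip. Qed.

Lemma log_lip_bounded : exists2 M : R, 0 < M & forall w, `|log_lip w| <= M.
Proof.
exists (`|ln L| + 1); first by rewrite ltr_wpDl.
move=> w; have /andP[h1 h2] := branch_lip_bounds w; have b0 := branch_lip_gt0 w.
have h3 : - ln L <= log_lip w by rewrite -lnV ?posrE// ler_ln ?posrE ?invr_gt0.
have h4 : log_lip w <= ln L by rewrite ler_ln ?posrE.
by rewrite ler_norml; have := ler_norm (ln L); have := ler_norm (- ln L); rewrite normrN; lra.
Qed.

(** For small [alpha], the second order Taylor bound of the exponential turns
    the mean contraction of [ln (Lip (g w))] into that of [Lip (g w) ^ alpha]. *)
Lemma power_contraction : exists alpha r : R, [/\ 0 < alpha <= 1, 0 <= r < 1 &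
  {ae eta, forall w, \sum_(i < N) p i w * expR (alpha * log_lip (theta i w)) <= r}].
Proof.
have [lambda l0 hl] := mc; have [M M0 hM] := log_lip_bounded.
pose b := - lambda; have b0 : 0 < b by rewrite oppr_gt0.
(* The exponent is [c^-1], chosen so that [c^-1 * M <= 1 / 2] and that the
   quadratic term [2 * (c^-1 * M) ^+ 2] is at most half of the gain [c^-1 * b]. *)
pose c := 1 + 2 * M + 4 * M ^+ 2 / b + b.
have c2 : 0 < 4 * M ^+ 2 / b by rewrite divr_gt0// mulr_gt0// exprn_gt0.
have c0 : 0 < c by rewrite /c; lra.
have ci : 0 < c^-1 by rewrite invr_gt0.
have cc : c^-1 * c = 1 by rewrite mulVf// gt_eqF.
have a1 : c^-1 <= 1 by rewrite /c in cc *; nra.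
have aM : c^-1 * M <= 1 / 2 by rewrite /c in cc *; nra.
have ab : c^-1 * b <= 1 by rewrite /c in cc *; nra.
have aM2 : c^-1 * (4 * M ^+ 2) <= b.
  have : c^-1 * (4 * M ^+ 2 / b) <= 1 by rewrite -[X in _ <= X]cc ler_wpM2l ?(ltW ci)// /c; lra.
  by rewrite mulrA ler_pdivrMr// mul1r.
exists c^-1, (1 - c^-1 * b / 2); split.
- by rewrite ci a1.
- by apply/andP; split; [lra|have := mulr_gt0 ci b0; lra].
apply: filterS2 hl sum_p => w hw sw.
have p0 i : 0 <= p i w by apply: branch_weight_ge0; exact: dens.
apply: (@le_trans _ _ (\sum_(i < N) p i w * (1 + c^-1 * ln (fine (Lip (g (theta i w)))) + 2 * (c^-1 * M) ^+ 2))).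
  apply: ler_sum => i _; rewrite ler_wpM2l//.
  have h1 : `|c^-1 * log_lip (theta i w)| <= c^-1 * M.
    by rewrite normrM (gtr0_norm ci) ler_wpM2l ?(ltW ci).
  apply: le_trans (expR_quadratic (le_trans h1 aM)) _.
  apply: lerD.
    rewrite lerD2l ler_wpM2l ?(ltW ci)// ler_ln ?posrE ?branch_lip_gt0//; first exact: branch_lip_le.
    by apply: lt_le_trans (branch_lip_le _); exact: branch_lip_gt0.
  by rewrite ler_wpM2l// -[leLHS]real_normK ?num_real// ler_sqr// nnegrE mulr_ge0// ltW.
rewrite (eq_bigr (fun i => p i w * (1 + 2 * (c^-1 * M) ^+ 2) +
    c^-1 * (p i w * ln (fine (Lip (g (theta i w))))))); last by move=> i _; ring.
rewrite big_split/= -mulr_suml -mulr_sumr sw mul1r.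
have h2 : c^-1 * \sum_(i < N) p i w * ln (fine (Lip (g (theta i w)))) <= c^-1 * lambda.
  by rewrite ler_wpM2l ?(ltW ci).
have h3 : 2 * (c^-1 * M) ^+ 2 <= c^-1 * b / 2.
  rewrite exprMn expr2 -!mulrA.
  have : c^-1 * (c^-1 * (4 * M ^+ 2)) <= c^-1 * b by rewrite ler_wpM2l ?(ltW ci).
  by lra.
have := h2; have := h3; rewrite /b; lra.
Qed.

End fiber_contraction.

Section fiber_diameter.
Context {R : realType} {nO N : nat} {dO dX : measure_display}
  {Omega : borelMetricType dO R} {X : borelMetricType dX R}.
Variables (GO : riemannianManifold nO Omega) (mO : {measure set Omega -> \bar R})
  (f : Omega -> Omega) (g : Omega -> X -> X)
  (D : 'I_N -> set Omega) (fbar theta : 'I_N -> Omega -> Omega)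
  (eta : probability Omega R) (rho : Omega -> R).
Let p := branch_weight GO D fbar theta rho.
Hypothesis cO : compact [set: Omega].
Hypothesis vol : riemannian_volume GO mO.
Hypothesis mf : measurable_fun setT f.
Hypothesis fb : full_branches GO mO f D fbar theta.
Hypothesis inv : invariant_measure f eta.
Hypothesis dens : equivalent_with_density mO eta rho.
Hypothesis reg : branch_regularity g theta p.
Hypothesis mp : forall i, measurable_fun setT (p i).
Hypothesis sum_p : {ae eta, forall w, \sum_(i < N) p i w = 1}.
Hypothesis mc : mean_contraction g theta eta p.
Variable L : R.
Hypothesis L0 : 0 < L.
Hypothesis hL : forall w, (L^-1%:E <= Lip (g w))%E /\ (Lip (g w) <= L%:E)%E.

Local Notation D0 := (\bigcup_i D i).
Local Notation T := (skew_product f g).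
Local Notation G k w x := (iter k T (w, x)).2.

Lemma iter_skew_fst k z : (iter k T z).1 = iter k f z.1.
Proof. by elim: k => //= k ->. Qed.

Lemma iter_skew_snd k w x : G k.+1 w x = g (iter k f w) (G k w x).
Proof. by rewrite iterS {1}/skew_product /= iter_skew_fst. Qed.

(** The open set of full measure where the first [k] iterates are continuous. *)
Definition regular_upto (k : nat) : set Omega := [set w | forall j, (j < k)%N -> D0 (iter j f w)].
Local Notation U := regular_upto.

Lemma regular_uptoS k : U k.+1 = D0 `&` f @^-1` U k.
Proof.
apply/seteqP; split => w.
  move=> Uw; split; first exact: (Uw 0%N).
  by move=> j jk; rewrite -iterSr; exact: Uw.
by move=> [Dw Uw] [|j] jk //; rewrite iterSr; exact: Uw.
Qed.

Lemma regular_upto_last k w : U k.+1 w -> U k w /\ D0 (iter k f w).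
Proof.
by move=> Uw; split; [move=> j jk; apply: Uw; exact: ltnW|exact: Uw].
Qed.

Lemma open_regular_upto k : open (U k).
Proof.
elim: k => [|k IH]; first by rewrite (_ : U 0 = setT); [exact: openT|apply/seteqP; split].
rewrite regular_uptoS openE => w [Dw Uw].
apply: filterI; first by apply: open_nbhs_nbhs; split => //; exact: (open_D0 fb).
by apply: (f_continuous fb Dw); exact: open_nbhs_nbhs.
Qed.

Lemma regular_upto_null k : eta (~` U k) = 0%E.
Proof.
have mU j : measurable (U j) by exact: borel_metric_open (open_regular_upto j).
elim: k => [|k IH]; first by rewrite (_ : ~` U 0 = set0)// -subset0 => w; apply.
have mfU : measurable (f @^-1` (~` U k)).
  by rewrite -[X in measurable X]setTI; apply: mf => //; exact: measurableC.
have mD := measurableC (measurable_D0 fb).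
apply/eqP; rewrite eq_le measure_ge0 andbT.
rewrite -[leRHS](_ : (eta (~` D0) + eta (f @^-1` (~` U k)) = _)%E); last first.
  rewrite inv; last exact: measurableC.
  by rewrite (eta_branches fb dens) add0e.
apply: le_trans (measureU2 _ mD mfU).
apply: le_measure; rewrite ?inE//; [exact: measurableC|exact: measurableU|].
by rewrite regular_uptoS setCI preimage_setC.
Qed.

Lemma iter_f_continuous k w : U k w -> {for w, continuous (iter k f)}.
Proof.
elim: k => [_|k IH]; first exact: cvg_id.
move=> /regular_upto_last [Uw Dw]; apply: (@continuous_comp _ _ _ (iter k f) f).
  exact: IH.
exact: (f_continuous fb Dw).
Qed.

Lemma iter_fiber_equicontinuous k w (e : R) : U k w -> 0 < e ->
  \forall v \near w, forall x, mdist (G k w x) (G k v x) < e.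
Proof.
elim: k e => [|k IH] e.
  by move=> _ e0; apply: nearW => v x /=; rewrite mdistxx.
move=> /regular_upto_last [Uw Dw] e0.
have e1 : 0 < e / 2 by rewrite divr_gt0.
have e2 : 0 < e / 2 / L by rewrite divr_gt0.
have h1 : nbhs w (iter k f @^-1` [set u | forall x, mdist (g (iter k f w) x) (g u x) < e / 2]).
  apply: (iter_f_continuous Uw).
  exact: (fiber_equicontinuous fb reg Dw e1).
have := @filterI _ (nbhs w) (nbhs_filter w) _ _ (IH _ Uw e2) h1; apply: filterS => v [Hk Hg] x.
rewrite !iter_skew_snd.
apply: le_lt_trans (metric_triangle _ (g (iter k f w) (G k v x)) _) _.
rewrite (splitr e); apply: ltr_leD; last by apply/ltW; exact: Hg.
apply: le_lt_trans (fiber_lip_le hL _ _ _) _.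
have /andP[_ lL] := fiber_lip_bounds hL (iter k f w).
apply: (@le_lt_trans _ _ (L * mdist (G k w x) (G k v x))).
  by rewrite ler_wpM2r// mdist_ge0.
by rewrite mulrC -ltr_pdivlMr.
Qed.

Definition log_lip_sum (k : nat) (w : Omega) : R :=
  \sum_(j < k) log_lip g D L (iter j f w).
Local Notation S := log_lip_sum.

Lemma log_lip_sumS k w : S k.+1 w = log_lip g D L w + S k (f w).
Proof.
rewrite /log_lip_sum big_ord_recl/=; congr (_ + _); apply: eq_bigr => j _.
by rewrite /= -iterSr.
Qed.

Lemma iter_fiber_contraction k w x y : U k w ->
  mdist (G k w x) (G k w y) <= expR (S k w) * mdist x y.
Proof.
elim: k => [_|k IH]; first by rewrite /log_lip_sum big_ord0 expR0 mul1r.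
move=> /regular_upto_last [Uw Dw].
rewrite !iter_skew_snd.
apply: le_trans (fiber_lip_le hL _ _ _) _.
rewrite /log_lip_sum big_ord_recr/= addrC expRD -mulrA.
have -> : expR (log_lip g D L (iter k f w)) = fiber_lip g (iter k f w).
  rewrite /log_lip lnK ?posrE; last exact: branch_lip_gt0.
  by rewrite /branch_lip asboolT.
apply: ler_wpM2l; last exact: IH.
by have /andP[h _] := fiber_lip_bounds hL (iter k f w); apply: le_trans h; rewrite invr_ge0 ltW.
Qed.

Lemma measurable_log_lip_sum k : measurable_fun setT (S k).
Proof.
apply: measurable_sum => j; apply: measurableT_comp; last exact: measurable_iter.
exact: (measurable_log_lip fb reg hL).
Qed.

(** One application of the transfer duality per step of the orbit. *)
Lemma integral_power_decay : exists alpha r : R, [/\ 0 < alpha <= 1, 0 <= r < 1 &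
  forall k, (\int[eta]_w (expR (alpha * S k w))%:E <= (r ^+ k)%:E)%E].
Proof.
have [alpha [r [a01 /andP[r0 r1] Hr]]] := power_contraction dens sum_p mc L0 hL.
exists alpha, r; split => //; first by rewrite r0.
have mexp (h : Omega -> R) : measurable_fun setT h ->
    measurable_fun setT (fun w => (expR (alpha * h w))%:E).
  by move=> mh; apply/measurable_EFinP; apply: measurableT_comp => //; exact: measurable_funM.
have ml := measurable_log_lip fb reg hL.
elim=> [|k IH].
  rewrite (eq_integral (fun=> 1%E)) => [|w _]; last by rewrite /log_lip_sum big_ord0 mulr0 expR0.
  by rewrite integral_cst// mul1e expr0 -[leLHS]/(eta setT) probability_setT.
pose u i w : \bar R := ((expR (alpha * log_lip g D L (theta i w)))%:E * (expR (alpha * S k w))%:E)%E.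
have mS := measurable_log_lip_sum k.
have mu i : measurable_fun setT (u i).
  apply: emeasurable_funM; apply: mexp => //.
  exact: (measurableT_comp ml (theta_measurable fb i)).
rewrite (@integral_transfer _ _ _ _ _ GO mO f D fbar theta eta rho cO vol mf fb dens inv mp sum_p _ u)//.
- apply: (@le_trans _ _ (\int[eta]_w (r%:E * (expR (alpha * S k w))%:E))%E); last first.
    rewrite ge0_integralZl_EFin//; last exact: mexp.
    by rewrite exprS EFinM; apply: lee_wpmul2l; rewrite ?lee_fin.
  have p0 i w : 0 <= p i w by apply: branch_weight_ge0; exact: dens.
  apply: ae_ge0_le_integral => //.
  + move=> w _; apply: sume_ge0 => i _; apply: mule_ge0; first by rewrite lee_fin.
    by rewrite /u -EFinM lee_fin mulr_ge0 ?expR_ge0.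
  + by apply: emeasurable_sum => i; apply: emeasurable_funM => //; exact/measurable_EFinP.
  + by move=> w _; rewrite -EFinM lee_fin mulr_ge0 ?expR_ge0.
  + by apply: measurable_funeM; exact: mexp.
  + apply: filterS Hr => w Hw _.
    rewrite (eq_bigr (fun i => (p i w * expR (alpha * log_lip g D L (theta i w)) * expR (alpha * S k w))%:E)).
      by rewrite sumEFin -EFinM lee_fin -mulr_suml ler_wpM2r// expR_ge0.
    by move=> i _; rewrite /u -!EFinM mulrA.
- by apply: mexp; exact: measurable_log_lip_sum.
- by move=> i w; rewrite /u -EFinM lee_fin mulr_ge0 ?expR_ge0.
- by move=> i w Dw; rewrite /u (theta_f fb Dw) -EFinM -expRD -mulrDr -log_lip_sumS.
Qed.

End fiber_diameter.

(** * Generic points of the skew product *)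

Lemma compact_diameter {R : realType} {d : measure_display} {X : borelMetricType d R} :
  compact [set: X] -> exists2 K : R, 0 < K & forall x y : X, mdist x y <= K.
Proof.
move=> cX; have cXX : compact [set: X * X] by rewrite -setXTT; exact: compact_setX.
have [K K0 HK] := compact_continuous_bounded cXX (@mdist_continuous R X).
exists K => // x y; have := HK (x, y); rewrite ger0_norm//; exact: mdist_ge0.
Qed.

Section fiber_collapse.
Context {R : realType} {nO N : nat} {dO dX : measure_display}
  {Omega : borelMetricType dO R} {X : borelMetricType dX R}.
Variables (GO : riemannianManifold nO Omega) (mO : {measure set Omega -> \bar R})
  (f : Omega -> Omega) (g : Omega -> X -> X)
  (D : 'I_N -> set Omega) (fbar theta : 'I_N -> Omega -> Omega)
  (eta : probability Omega R) (rho : Omega -> R).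
Let p := branch_weight GO D fbar theta rho.
Hypothesis cO : compact [set: Omega].
Hypothesis cX : compact [set: X].
Hypothesis vol : riemannian_volume GO mO.
Hypothesis mf : measurable_fun setT f.
Hypothesis mg : measurable_fun [set: (Omega * X)%type] (fun z => g z.1 z.2).
Hypothesis fb : full_branches GO mO f D fbar theta.
Hypothesis inv : invariant_measure f eta.
Hypothesis dens : equivalent_with_density mO eta rho.
Hypothesis reg : branch_regularity g theta p.
Hypothesis mp : forall i, measurable_fun setT (p i).
Hypothesis sum_p : {ae eta, forall w, \sum_(i < N) p i w = 1}.
Hypothesis mc : mean_contraction g theta eta p.
Hypothesis hL : bounded_fiber_Lip g.

Local Notation T := (skew_product f g).
Local Notation G k w x := (iter k T (w, x)).2.
Local Notation U := (regular_upto f D).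

Variable K : R.
Hypothesis K0 : 0 < K.
Hypothesis hK : forall x y : X, mdist x y <= K.

(** The diameter of the image of the fiber over [w] under [k] steps. The constant
    value outside [U k] makes it measurable, and continuous on the open set [U k]. *)
Definition fiber_diam (k : nat) (w : Omega) : R :=
  if `[< U k w >] then sup [set t | exists x y, t = mdist (G k w x) (G k w y)] else K.

Let diams k w := [set t | exists x y, t = mdist (G k w x) (G k w y)].

Let diams_ub k w : has_ubound (diams k w).
Proof. by exists K => _ [x [y ->]]. Qed.

Let diams0 k w : diams k w !=set0.
Proof. by exists (mdist (G k w point) (G k w point)); exists point, point. Qed.

Lemma fiber_diam_ge k w x y : mdist (G k w x) (G k w y) <= fiber_diam k w.
Proof.
rewrite /fiber_diam; case: ifP => _ //.
by apply: ub_le_sup; [exact: diams_ub|exists x, y].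
Qed.

Lemma fiber_diam_le k w B : U k w -> (forall x y, mdist (G k w x) (G k w y) <= B) ->
  fiber_diam k w <= B.
Proof.
move=> Uw H; rewrite /fiber_diam asboolT//; apply: ge_sup; first exact: diams0.
by move=> _ [x [y ->]].
Qed.

Lemma fiber_diam_bounds k w : 0 <= fiber_diam k w <= K.
Proof.
apply/andP; split.
  by apply: le_trans (fiber_diam_ge k w point point); exact: mdist_ge0.
have [Uw|Uw] := pselect (U k w); first by apply: fiber_diam_le.
by rewrite /fiber_diam asboolF.
Qed.

Lemma fiber_diam_near k w (e : R) : U k w -> 0 < e ->
  \forall v \near w, `|fiber_diam k w - fiber_diam k v| < e.
Proof.
move=> Uw e0; have [L L0 hL'] := hL.
have e2 : 0 < e / 4 by rewrite divr_gt0.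
have nU : nbhs w (U k) by apply: open_nbhs_nbhs; split => //; exact: (open_regular_upto fb).
have := @filterI _ (nbhs w) (nbhs_filter w) _ _ nU
  (iter_fiber_equicontinuous fb reg L0 hL' Uw e2).
apply: filterS => v [Uv Hv].
have le1 (a b : Omega) : U k a -> U k b -> (forall x, mdist (G k a x) (G k b x) < e / 4) ->
    fiber_diam k a <= fiber_diam k b + e / 2.
  move=> Ua Ub Hab; apply: fiber_diam_le => // x y.
  have := metric_triangle (G k a x) (G k b x) (G k a y).
  have := metric_triangle (G k b x) (G k b y) (G k a y).
  have := Hab x; have := Hab y; have := fiber_diam_ge k b x y.
  rewrite (metric_sym (G k b y) (G k a y)); lra.
have h1 := le1 w v Uw Uv Hv.
have h2 : fiber_diam k v <= fiber_diam k w + e / 2.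
  by apply: le1 => // x; rewrite metric_sym.
by rewrite ltr_norml; apply/andP; split; lra.
Qed.

Lemma fiber_diam_continuous k w : U k w -> {for w, continuous (fiber_diam k)}.
Proof.
move=> Uw A /nbhs_ballP[e /= e0 eA].
by apply: filterS (fiber_diam_near Uw e0) => v Hv; exact: eA.
Qed.

Lemma fiber_diam_bounded_measurable k : bounded_measurable (fiber_diam k).
Proof.
have oU := open_regular_upto fb k; split; last first.
  by exists K => w; have /andP[h1 h2] := fiber_diam_bounds k w; rewrite ger0_norm.
apply: (measurability _ (RGenOInfty.measurableE R)) => _ [_ [a ->] <-]; rewrite setTI.
have -> : fiber_diam k @^-1` `]a, +oo[ = (U k `&` [set w | a < fiber_diam k w]) `|`
    (~` U k `&` [set w | a < K]).
  apply/seteqP; split => w; rewrite /= in_itv/= andbT.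
    move=> aw; have [Uw|Uw] := pselect (U k w); [by left|right; split => //].
    by move: aw; rewrite /fiber_diam asboolF.
  by move=> [[]//|[Uw]]; rewrite /fiber_diam asboolF.
apply: measurableU; last first.
  apply: measurableI; first by apply: measurableC; exact: borel_metric_open.
  have [aK|aK] := ltP a K.
    by rewrite (_ : [set w | _] = setT)//; apply/seteqP; split.
  by rewrite (_ : [set w | _] = set0)//; apply/seteqP; split.
apply: borel_metric_open; rewrite openE => w [Uw /= aw].
have h1 : nbhs w (U k) by exact: open_nbhs_nbhs.
have h2 : nbhs w (fiber_diam k @^-1` [set t | a < t]).
  by apply: (fiber_diam_continuous Uw); exact: lt_nbhsr.
exact: (@filterI _ (nbhs w) (nbhs_filter w) _ _ h1 h2).
Qed.

Section dominated.
Variables (zeta : probability Omega R) (C : R).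
Hypothesis C0 : 0 <= C.
Hypothesis zC : forall A, measurable A -> (zeta A <= C%:E * eta A)%E.

Lemma regular_upto_null_dominated k : zeta (~` U k) = 0%E.
Proof.
have mU : measurable (~` U k).
  by apply: measurableC; apply: borel_metric_open; exact: (open_regular_upto fb).
apply/eqP; rewrite eq_le measure_ge0 andbT; apply: le_trans (zC mU) _.
by rewrite (regular_upto_null mf fb inv dens) mule0.
Qed.

(** The diameter is at most [K * expR (alpha * S)], where [S] is the sum of the
    logarithmic Lipschitz constants: if [S] is negative because [alpha <= 1], and
    otherwise because [K] bounds it. *)
Lemma integral_fiber_diam_small (e : R) : 0 < e -> exists k, \int[zeta]_w fiber_diam k w <= e.
Proof.
move=> e0; have [L L0 hL'] := hL.
have [alpha [r [/andP[a0 a1] /andP[r0 r1] dec]]] :=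
  integral_power_decay cO vol mf fb inv dens reg mp sum_p mc L0 hL'.
have cv : (C * K * r ^+ k) @[k --> \oo] --> C * K * 0.
  by apply: cvgMr; apply: cvg_expr; rewrite ger0_norm.
rewrite mulr0 in cv; have [k _ /(_ k (leqnn _)) Hk] := cvgr_le _ cv _ e0.
exists k; apply: le_trans Hk.
have mS := measurable_log_lip_sum mf fb reg hL' k.
have mexp : measurable_fun setT (fun w => (expR (alpha * log_lip_sum f g D L k w))%:E).
  by apply/measurable_EFinP; apply: measurableT_comp => //; exact: measurable_funM.
have [md _] := fiber_diam_bounded_measurable k.
have mE : measurable_fun setT (fun w => (fiber_diam k w)%:E) by exact/measurable_EFinP.
have d0 w : (0 <= (fiber_diam k w)%:E)%E.
  by rewrite lee_fin; have /andP[] := fiber_diam_bounds k w.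
rewrite /Rintegral -lee_fin fineK; last first.
  by apply: integrable_fin_num => //; apply: bounded_measurable_integrable => //;
    exact: fiber_diam_bounded_measurable.
apply: (@le_trans _ _ (\int[mscale (NngNum C0) eta]_w (fiber_diam k w)%:E)%E).
  by apply: ge0_le_measure_integral => // A mA; exact: zC.
rewrite ge0_integral_mscale//= -mulrA EFinM; apply: lee_wpmul2l; first by rewrite lee_fin.
apply: (@le_trans _ _ (\int[eta]_w (K%:E * (expR (alpha * log_lip_sum f g D L k w))%:E))%E); last first.
  rewrite ge0_integralZl_EFin//; last exact: ltW.
  by rewrite EFinM; apply: lee_wpmul2l => //; rewrite lee_fin ltW.
apply: ae_ge0_le_integral => //.
- by move=> w _; rewrite -EFinM lee_fin mulr_ge0 ?expR_ge0// ltW.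
- exact: measurable_funeM.
exists (~` U k); split.
- by apply: measurableC; apply: borel_metric_open; exact: (open_regular_upto fb).
- exact: (regular_upto_null mf fb inv dens).
apply: subsetC => w Uw _; rewrite -EFinM lee_fin.
set s := log_lip_sum f g D L k w.
have [s0|s0] := leP 0 s.
  have /andP[_ h] := fiber_diam_bounds k w; apply: le_trans h _.
  by rewrite ler_peMr ?(ltW K0)// -expR0 ler_expR mulr_ge0// ltW.
apply: fiber_diam_le => // x y.
apply: le_trans (iter_fiber_contraction L0 hL' x y Uw) _; rewrite mulrC -/s.
apply: ler_pM; [exact: mdist_ge0|exact: expR_ge0|exact: hK|].
by rewrite ler_expR; nra.
Qed.

Variable mu' : probability (Omega * X)%type R.
Hypothesis inv' : invariant_measure T mu'.
Hypothesis marg : forall A, measurable A -> zeta A = mu' (fst @^-1` A).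

Lemma continuous_bounded_measurable_prod (phi : Omega * X -> R) : continuous phi ->
  bounded_measurable phi.
Proof.
move=> cphi; split.
  by apply: continuous_measurable_realfun => //; exact: open_prod_measurable.
have cOX : compact [set: Omega * X] by rewrite -setXTT; exact: compact_setX.
by have [B _ HB] := compact_continuous_bounded cOX cphi; exists B.
Qed.

(** After [k] steps the fiber coordinate is almost forgotten: along the orbit of
    any [(w, x)] the test function is close on average to a function of the base
    point alone, which the orbit of [w] samples according to [zeta]. *)
Lemma generic_lift w x : basin f zeta w -> basin T mu' (w, x).
Proof.
move=> /(weak_star_empirical _ _ _ (@borel_metric_open _ _ _)) gen.
apply/(weak_star_empirical _ _ _ (open_prod_measurable cO cX)) => phi cphi.
have cOX : compact [set: Omega * X] by rewrite -setXTT; exact: compact_setX.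
have [B B0 HB] := compact_continuous_bounded cOX cphi.
have bphi := continuous_bounded_measurable_prod cphi.
have mT : measurable_fun setT T.
  exact: (measurable_fun_pair (measurableT_comp mf measurable_fst) mg).
apply: (@avg_approx _ _ B) => // eps eps0.
have e2 : 0 < eps / 2 by rewrite divr_gt0.
have [dl dl0 Hdl] := compact_uniform_continuity cOX cphi e2.
(* Two points of a small image of the fiber have close values under [phi];
   otherwise the diameter is at least [dl] and [c * fiber_diam] exceeds [2 * B]. *)
pose c := 2 * B / dl; have c0 : 0 < c by rewrite divr_gt0// mulr_gt0.
have [k Hk] : exists k, \int[zeta]_w fiber_diam k w <= eps / 2 / c.
  by apply: integral_fiber_diam_small; rewrite divr_gt0.
pose e w := eps / 2 + c * fiber_diam k w.
pose phik w := phi (iter k T (w, point)).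
have bd := fiber_diam_bounded_measurable k.
have be : bounded_measurable e.
  apply: bounded_measurableD; first exact: bounded_measurable_cst.
  by apply: bounded_measurableM => //; exact: bounded_measurable_cst.
have mpt : measurable_fun setT (fun w : Omega => (w, point : X)).
  exact: measurable_fun_pair.
have bphik : bounded_measurable phik.
  apply: (bounded_measurable_comp bphi).
  by apply: measurableT_comp mpt; exact: measurable_iter.
have close v y : `|phi (iter k T (v, y)) - phik v| <= e v.
  have dge : 0 <= fiber_diam k v by have /andP[] := fiber_diam_bounds k v.
  rewrite /phik (surjective_pairing (iter k T (v, y))) (surjective_pairing (iter k T (v, point))).
  rewrite !iter_skew_fst/=.
  have [ds|ds] := ltP (mdist (G k v y) (G k v point)) dl.
    apply: (@le_trans _ _ (eps / 2)); last by rewrite lerDl mulr_ge0// ltW.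
    apply/ltW/Hdl; split => /=; first exact: ballxx.
    by rewrite ballEmdist.
  apply: (@le_trans _ _ (2 * B)).
    apply: le_trans (ler_normB _ _) _.
    by have h1 := HB (iter k f v, G k v y); have h2 := HB (iter k f v, G k v point); lra.
  apply: (@le_trans _ _ (c * dl)); first by rewrite /c mulfVK// gt_eqF.
  apply: (@le_trans _ _ (c * fiber_diam k v)); last by rewrite lerDr ltW.
  by rewrite ler_wpM2l ?(ltW c0)//; apply: le_trans ds (fiber_diam_ge _ _ _ _).
have oU := open_regular_upto fb k.
have zU := regular_upto_null_dominated k.
have avg_gen h : bounded_measurable h -> (forall v, U k v -> {for v, continuous h}) ->
    avg (fun i => h (iter i f w)) n @[n --> \oo] --> \int[zeta]_v h v.
  by move=> bh ch; apply: (generic_avg_open gen oU zU bh ch).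
have inte : \int[zeta]_v e v <= eps.
  have bi : zeta.-integrable setT (EFin \o (fun v => c * fiber_diam k v)).
    apply: bounded_measurable_integrable => //.
    by apply: bounded_measurableM => //; exact: bounded_measurable_cst.
  rewrite RintegralD//; last first.
    by apply: bounded_measurable_integrable => //; exact: bounded_measurable_cst.
  rewrite Rintegral_prob_cst RintegralZl//; last exact: bounded_measurable_integrable.
  by rewrite [leRHS](splitr eps) lerD2l mulrC -ler_pdivlMr.
exists k, (fun i => phik (iter i f w)), (fun i => e (iter i f w)),
  (\int[zeta]_v phik v), (\int[zeta]_v e v); split => //.
- move=> i; rewrite addnC iterD (surjective_pairing (iter i T (w, x))) iter_skew_fst/=.
  exact: close.
- apply: avg_gen => // v Uv.
  apply: (@continuous_comp _ _ _ (fun v => iter k T (v, point)) phi); last exact: cphi.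
  rewrite (_ : (fun v => iter k T (v, point)) = (fun v => (iter k f v, G k v point))); last first.
    by apply/funext => u; rewrite [LHS]surjective_pairing iter_skew_fst.
  apply: cvg_pair; first exact: (iter_f_continuous fb Uv).
  have [L L0 hL'] := hL.
  move=> A /nbhs_ballP[e' /= e'0 eA].
  apply: filterS (iter_fiber_equicontinuous fb reg L0 hL' Uv e'0) => u Hu.
  by apply: eA; rewrite ballEmdist; exact: Hu.
- apply: avg_gen => // v Uv.
  by apply: cvgD; [exact: cvg_cst|apply: cvgMr; exact: fiber_diam_continuous].
- have mTk := measurable_iter k mT.
  have invk A : measurable A -> mu' A = mu' (iter k T @^-1` A).
    move=> mA; elim: (k) => // j IH; rewrite IH -inv'.
      by apply: congr1; apply/funext => z; rewrite /preimage/= -iterSr.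
    by rewrite -[X in measurable X]setTI; exact: (measurable_iter j mT).
  rewrite (Rintegral_invariant mTk invk bphi).
  rewrite (Rintegral_invariant measurable_fst marg bphik).
  apply: le_trans inte; rewrite (Rintegral_invariant measurable_fst marg be).
  apply: Rintegral_close.
  + exact: (bounded_measurable_comp bphik measurable_fst).
  + exact: (bounded_measurable_comp bphi mTk).
  + exact: (bounded_measurable_comp be measurable_fst).
  + by move=> [v y]; rewrite distrC; exact: close.
Qed.

End dominated.

End fiber_collapse.

(** * Physical measures *)

Section marginals.
Context {R : realType} {dO dX : measure_display}
  {Omega : borelMetricType dO R} {X : borelMetricType dX R}.
Variables (mO : {measure set Omega -> \bar R}) (mX : {sigma_finite_measure set X -> \bar R})
  (f : Omega -> Omega) (g : Omega -> X -> X).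
Hypothesis cO : compact [set: Omega].
Hypothesis cX : compact [set: X].
Hypothesis mf : measurable_fun setT f.
Variables (zeta : probability Omega R) (mu' : probability (Omega * X)%type R).
Hypothesis marg : forall A, measurable A -> zeta A = mu' (fst @^-1` A).

Local Notation T := (skew_product f g).

Lemma basin_fst : basin T mu' `<=` fst @^-1` basin f zeta.
Proof.
move=> [w x] /(weak_star_empirical _ _ _ (open_prod_measurable cO cX)) H.
apply/(weak_star_empirical _ _ _ (@borel_metric_open _ _ _)) => phi cphi /=.
have cp : continuous (fun z : Omega * X => phi z.1).
  by move=> z; apply: (continuous_comp (f := fst)); [exact: cvg_fst|exact: cphi].
have bphi := continuous_bounded_measurable cO cphi.
rewrite (Rintegral_invariant measurable_fst marg bphi).
have := H _ cp; rewrite (_ : (fun i => phi (iter i T (w, x)).1) = (fun i => phi (iter i f w)))//.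
by apply/funext => i; rewrite iter_skew_fst.
Qed.

Lemma invariant_marginal : invariant_measure T mu' -> invariant_measure f zeta.
Proof.
move=> inv A mA; have mfA : measurable (f @^-1` A).
  by rewrite -[X in measurable X]setTI; exact: mf.
rewrite !marg// -[RHS]inv//.
by rewrite -[X in measurable X]setTI; exact: measurable_fst.
Qed.

(** The basin of [mu'] has empty sections over the points outside
    [basin f zeta]. *)
Lemma physical_marginal : physical (mO \x mX)%E T mu' -> physical mO f zeta.
Proof.
move=> [inv pos]; split; first exact: invariant_marginal.
have mB := basin_measurable cO zeta mf; set B := basin f zeta in mB *.
rewrite lt0e measure_ge0 andbT; apply/eqP => B0.
move: pos; apply/negP; rewrite -leNgt.
apply: (@le_trans _ _ (\int[mO]_w (if w \in B then +oo else 0))%E).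
  apply: ge0_integral_monotone => // w _; case: ifPn => [_|/negP wB]; first exact: leey.
  rewrite /= (_ : xsection _ _ = set0) ?measure0//; apply/seteqP; split => // x.
  by rewrite /xsection/= inE => /basin_fst /mem_set.
rewrite -integral_mkcond integral_cst// B0 mule0//.
Qed.

End marginals.

Lemma marginal_exists {R : realType} {dY dZ : measure_display} {Y : borelMetricType dY R}
    {Z : borelMetricType dZ R} (P : probability (Y * Z)%type R) :
  exists Q : probability Y R, forall A, measurable A -> Q A = P (fst @^-1` A).
Proof.
have [|//|Q QE] := @probability_proportional _ _ _ (push_measure measurable_fst P) 1.
  exact: (probability_setT P).
by exists Q => A _; rewrite QE invr1 mule1.
Qed.

Section physical_lifts.
Context {R : realType} {nO nX N : nat} {dO dX : measure_display}
  {Omega : borelMetricType dO R} {X : borelMetricType dX R}.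
Variables (GO : riemannianManifold nO Omega) (GX : riemannianManifold nX X)
  (mO : {measure set Omega -> \bar R})
  (mX : {sigma_finite_measure set X -> \bar R})
  (f : Omega -> Omega) (g : Omega -> X -> X)
  (D : 'I_N -> set Omega) (fbar theta : 'I_N -> Omega -> Omega)
  (eta : probability Omega R) (rho : Omega -> R)
  (nu : Omega -> probability X R) (mu : probability (Omega * X)%type R).
Let p := branch_weight GO D fbar theta rho.
Hypothesis cO : compact [set: Omega].
Hypothesis cX : compact [set: X].
Hypothesis vol : riemannian_volume GO mO.
Hypothesis volX : riemannian_volume GX mX.
Hypothesis mf : measurable_fun setT f.
Hypothesis mg : measurable_fun [set: (Omega * X)%type] (fun z => g z.1 z.2).
Hypothesis hL : bounded_fiber_Lip g.
Hypothesis fb : full_branches GO mO f D fbar theta.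
Hypothesis inv : invariant_measure f eta.
Hypothesis dens : equivalent_with_density mO eta rho.
Hypothesis mc : mean_contraction g theta eta p.
Hypothesis reg : branch_regularity g theta p.
Hypothesis fix_nu : sectional_fixed_point g theta eta p nu.
Hypothesis dis : disintegration eta nu mu.

Local Notation T := (skew_product f g).
Local Notation vT := (mO \x mX)%E.

Lemma basin_lift (zeta : probability Omega R) (mu' : probability (Omega * X)%type R) (C : R) :
  0 <= C -> (forall A, measurable A -> (zeta A <= C%:E * eta A)%E) ->
  invariant_measure T mu' -> (forall A, measurable A -> zeta A = mu' (fst @^-1` A)) ->
  basin T mu' = basin f zeta `*` setT.
Proof.
move=> C0 zC inv' marg; have [K K0 hK] := compact_diameter cX.
apply/seteqP; split => [z Hz|[w x] [/= Hw _]].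
  by split => //; exact: (basin_fst cO cX marg Hz).
exact: (generic_lift cO cX vol mf mg fb inv dens reg (measurable_weight reg)
  (sum_weights fix_nu) mc hL K0 hK C0 zC inv' marg).
Qed.

Lemma physical_lift (zeta : probability Omega R) (mu' : probability (Omega * X)%type R) :
  invariant_measure T mu' -> basin T mu' = basin f zeta `*` setT ->
  physical mO f zeta -> physical vT T mu'.
Proof.
move=> inv' bas [_ pos]; split=> //; rewrite bas.
rewrite product_measure1E//; last exact: (basin_measurable cO zeta mf).
by apply: mule_gt0 => //; exact: (riemannian_volume_gt0 volX).
Qed.

(** A physical measure of [f] is [eta] conditioned on its basin, which suggests
    conditioning [mu] on the part of the product above that basin. *)
Lemma physical_lift_exists (zeta : probability Omega R) : physical mO f zeta ->
  exists mu', [/\ physical vT T mu', basin T mu' = basin f zeta `*` setT &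
    forall A, measurable A -> zeta A = mu' (fst @^-1` A)].
Proof.
move=> phz; have [_ pos] := phz; set B := basin f zeta in pos.
have mB : measurable B := basin_measurable cO zeta mf.
have [_ dom _ _ _] := dens.
have eB0 : eta B != 0%E.
  apply: contraTneq pos => /(measure0_null_setP _ mB) /dom /(measure0_null_setP _ mB) ->.
  by rewrite ltxx.
have etaB : eta B = (fine (eta B))%:E by rewrite fineK// fin_num_measure.
have b0 : 0 < fine (eta B) by rewrite -lte_fin -etaB lt0e eB0 measure_ge0.
set b := fine (eta B) in etaB b0.
have zE := basin_conditional cO mf inv etaB b0.
have mFB : measurable (fst @^-1` B : set (Omega * X)).
  by rewrite -[X in measurable X]setTI; exact: measurable_fst.
have marg_mu := marginal_lift dis.
have [||mu' mu'E] := @probability_proportional _ _ _ (mrestr mu mFB) b => //.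
  by rewrite /= /mrestr setTI -marg_mu.
have marg A : measurable A -> zeta A = mu' (fst @^-1` A).
  move=> mA; rewrite zE// mu'E /= /mrestr -preimage_setI -marg_mu//.
  exact: measurableI.
have inv' : invariant_measure T mu'.
  move=> A mA; rewrite !mu'E /= /mrestr.
  have TB : T @^-1` (fst @^-1` B) = fst @^-1` B.
    exact: (congr1 (fun A => fst @^-1` A) (basin_preimage cO f zeta)).
  rewrite -[in LHS]TB -preimage_setI (invariant_lift cO cX vol mf mg fb inv dens reg fix_nu dis)//.
  exact: measurableI.
have bas : basin T mu' = basin f zeta `*` setT.
  apply: (@basin_lift zeta mu' b^-1) => //; first by rewrite invr_ge0 ltW.
  move=> A mA; rewrite zE// muleC lee_wpmul2l ?lee_fin ?invr_ge0 ?(ltW b0)//.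
  by apply: le_measure; rewrite ?inE//; exact: measurableI.
by exists mu'; split => //; exact: physical_lift bas phz.
Qed.

Lemma physical_lift_iff : physical vT T mu <-> physical mO f eta.
Proof.
have marg_mu := marginal_lift dis.
split; first exact: (physical_marginal cO cX mf marg_mu).
have inv' := invariant_lift cO cX vol mf mg fb inv dens reg fix_nu dis.
apply: physical_lift => //; apply: (@basin_lift eta mu 1) => // A mA.
by rewrite mul1e.
Qed.

(** Marginals and lifts identify the physical measures of [T] with those of [f]:
    the basin of a physical measure of [T] lies above the basin of its marginal,
    hence meets the basin of the lift of this marginal. *)
Lemma unique_physical_lift_iff : unique_physical vT T <-> unique_physical mO f.
Proof.
split=> [[mu' phmu' uniq]|[zeta phz uniq]].
  have [zeta marg] := marginal_exists mu'.
  exists zeta; first exact: (physical_marginal cO cX mf marg phmu').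
  move=> zeta' /physical_lift_exists[mu'' [phmu'' _ marg']] A mA.
  rewrite marg// marg'// uniq//.
  by rewrite -[X in measurable X]setTI; exact: measurable_fst.
have [mu' [phmu' bas _]] := physical_lift_exists phz.
exists mu' => // mu'' phmu''; have [zeta' marg'] := marginal_exists mu''.
have zz' := uniq _ (physical_marginal cO cX mf marg' phmu'').
have [z Hz] : basin T mu'' !=set0.
  apply/set0P; apply: contraTneq (phmu''.2) => ->.
  by rewrite measure0 ltxx.
apply: (basin_unique_prod cO cX Hz); rewrite bas.
by split => //; rewrite -(basin_ext f zz'); exact: (basin_fst cO cX marg' Hz).
Qed.

End physical_lifts.

Theorem corollary2 (R : realType) (nO nX : nat) (dO dX : measure_display)
  (Omega : borelMetricType dO R) (X : borelMetricType dX R)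
  (GO : riemannianManifold nO Omega) (GX : riemannianManifold nX X)
  (mO : {sigma_finite_measure set Omega -> \bar R})
  (mX : {sigma_finite_measure set X -> \bar R})
  (f : Omega -> Omega) (g : Omega -> X -> X)
  (N : nat) (D : 'I_N -> set Omega) (fbar theta : 'I_N -> Omega -> Omega)
  (eta : probability Omega R) (rho : Omega -> R)
  (nu : Omega -> probability X R) (mu : probability (Omega * X)%type R) :
  let p := branch_weight GO D fbar theta rho in
  compact [set: Omega] -> compact [set: X] ->
  riemannian_volume GO mO -> riemannian_volume GX mX ->
  measurable_fun [set: Omega] f ->
  measurable_fun [set: (Omega * X)%type] (fun z => g z.1 z.2) ->
  bounded_fiber_Lip g ->
  full_branches GO mO f D fbar theta ->
  invariant_measure f eta ->
  equivalent_with_density mO eta rho ->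
  mean_contraction g theta eta p ->
  branch_regularity g theta p ->
  sectional_fixed_point g theta eta p nu ->
  disintegration eta nu mu ->
  (physical (mO \x mX)%E (skew_product f g) mu <-> physical mO f eta) /\
  (unique_physical (mO \x mX)%E (skew_product f g) <-> unique_physical mO f).
Proof.
move=> p cO cX vol volX mf mg hL fb inv dens mc reg fix_nu dis; split.
  exact: (physical_lift_iff cO cX vol volX mf mg hL fb inv dens mc reg fix_nu dis).
exact: (unique_physical_lift_iff cO cX vol volX mf mg hL fb inv dens mc reg fix_nu dis).
Qed.
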